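(* $2$-DSP can be solved in $O(nm)$ time. That is, there is an algorithm that, given a connected undirected graph $G$ with $n$ vertices and $m$ edges and two pairs of vertices $(s_1,t_1),(s_2,t_2)$, runs in $O(nm)$ time and finds vertex-disjoint paths $P_1,P_2$ such that $P_i$ is a shortest $s_i$-$t_i$-path in $G$ for each $i\in\{1,2\}$, or correctly reports that no such paths exist.
   Context: Graphs are unweighted; the length of a path is its number of edges. The problem $k$-DSP ($k$ Disjoint Shortest Paths): the input is a graph $G=(V,E)$ and $k\in\mathbb{N}$ pairs $(s_i,t_i)_{i\in[k]}$ of vertices, where $[k]=\{1,\dots,k\}$; the task is to find $k$ pairwise (vertex-)disjoint paths $P_i$ such that $P_i$ is a shortest $s_i$-$t_i$-path for each $i\in[k]$. Throughout, $G$ is undirected and connected, $n=|V|$ and $m=|E|$. *)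

(* Defs.v *)
From mathcomp Require Import all_boot.

Set Implicit Arguments.
Unset Strict Implicit.
Unset Printing Implicit Defensive.

(* A graph is a symmetric irreflexive relation [e] on a finite type. *)
Section DisjointShortestPaths.

Variables (V : finType) (e : rel V).

Definition connected_graph : Prop := forall x y : V, connect e x y.

(* A path is the nonempty list of the vertices it visits. *)
Definition is_path (x y : V) (P : seq V) : bool :=
  if P is z :: p then [&& z == x, path e z p, last z p == y & uniq P]
  else false.

Definition path_length (P : seq V) : nat := (size P).-1.

Definition shortest_path (x y : V) (P : seq V) : Prop :=
  is_path x y P /\
  forall Q : seq V, is_path x y Q -> path_length P <= path_length Q.

Definition dsp_solution (k : nat) (s t : 'I_k -> V) (P : 'I_k -> seq V) : Prop :=
  (forall i, shortest_path (s i) (t i) (P i)) /\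
  (forall i j, i != j -> [disjoint P i & P j]).

End DisjointShortestPaths.

Definition num_edges (n : nat) (e : rel 'I_n) : nat :=
  #|[set p : 'I_n * 'I_n | e p.1 p.2 & p.1 < p.2]|.

(* The order inside each adjacency list is arbitrary. *)
Definition adjacency_lists (n : nat) (e : rel 'I_n) (L : 'I_n -> seq 'I_n) : Prop :=
  forall u, uniq (L u) /\ forall v, (v \in L u) = e u v.

(* A word RAM, programmed in a structured language.  Scalar variables and
   arrays are named by literal numbers in the program text, so that a program
   uses only finitely many of them; array cells are accessed by computed index
   in unit time.  A word holds a natural number smaller than the bound [W],
   and a computation that produces a value [>= W] is stuck.  [Sub] is truncated. *)
Inductive expr : Type :=
| Const of nat
| Var of nat
| Get of nat & expr
| Add of expr & expr
| Sub of expr & expr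
| Mul of expr & expr
| Ltn of expr & expr
| Eqn of expr & expr.

Inductive cmd : Type :=
| Skip
| Assign of nat & expr
| Store of nat & expr & expr
| Seq of cmd & cmd
| If of expr & cmd & cmd
| While of expr & cmd.

Record state : Type := State { vars : nat -> nat; arrs : nat -> nat -> nat }.

Definition set_var (st : state) (x v : nat) : state :=
  State (fun y => if y == x then v else vars st y) (arrs st).

Definition set_cell (st : state) (a i v : nat) : state :=
  State (vars st)
        (fun b j => if (b == a) && (j == i) then v else arrs st b j).

Definition word (W v : nat) : option nat := if v < W then Some v else None.

Fixpoint eval (W : nat) (st : state) (E : expr) : option nat :=
  let op (f : nat -> nat -> nat) E1 E2 :=
    if eval W st E1 is Some u then
      if eval W st E2 is Some v then word W (f u v) else None
    else None in
  match E with
  | Const c => word W c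
  | Var x => word W (vars st x)
  | Get a E1 => if eval W st E1 is Some i then word W (arrs st a i) else None
  | Add E1 E2 => op addn E1 E2
  | Sub E1 E2 => op subn E1 E2
  | Mul E1 E2 => op muln E1 E2
  | Ltn E1 E2 => op (fun u v => nat_of_bool (u < v)) E1 E2
  | Eqn E1 E2 => op (fun u v => nat_of_bool (u == v)) E1 E2
  end.

Fixpoint ecost (E : expr) : nat :=
  match E with
  | Const _ | Var _ => 1
  | Get _ E1 => (ecost E1).+1
  | Add E1 E2 | Sub E1 E2 | Mul E1 E2 | Ltn E1 E2 | Eqn E1 E2 =>
      (ecost E1 + ecost E2).+1
  end.

(* [exec W c st T st']: with words bounded by [W], the program [c] started in
   [st] halts in [st'] after exactly [T] unit-cost steps.  A test succeeds when
   its value is nonzero. *)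
Inductive exec (W : nat) : cmd -> state -> nat -> state -> Prop :=
| exec_Skip st : exec W Skip st 1 st
| exec_Assign st x E v of eval W st E = Some v :
    exec W (Assign x E) st (ecost E).+1 (set_var st x v)
| exec_Store st a I E i v of eval W st I = Some i & eval W st E = Some v :
    exec W (Store a I E) st (ecost I + ecost E).+1 (set_cell st a i v)
| exec_Seq st st1 st2 c1 c2 T1 T2 of
    exec W c1 st T1 st1 & exec W c2 st1 T2 st2 :
    exec W (Seq c1 c2) st (T1 + T2) st2
| exec_If st st1 B c1 c2 b T of
    eval W st B = Some b & exec W (if b != 0 then c1 else c2) st T st1 :
    exec W (If B c1 c2) st (ecost B + T).+1 st1
| exec_WhileF st B c of eval W st B = Some 0 :
    exec W (While B c) st (ecost B).+1 st
| exec_WhileT st st1 st2 B c b T1 T2 of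
    eval W st B = Some b & b != 0 &
    exec W c st T1 st1 & exec W (While B c) st1 T2 st2 :
    exec W (While B c) st (ecost B + T1 + T2).+1 st2.

(* The machine is deterministic, so the running time and the final state are
   well defined. *)
Lemma exec_det W c st T1 st1 T2 st2 :
  exec W c st T1 st1 -> exec W c st T2 st2 -> T1 = T2 /\ st1 = st2.
Proof.
move=> H; elim: H T2 st2 => {c st T1 st1}.
- by move=> st T2 st2 H; inversion H.
- by move=> st x E v Ev T2 st2 H; inversion H; subst; split; congruence.
- by move=> st a I E i v Ei Ev T2 st2 H; inversion H; subst; split; congruence.
- move=> st st1 st2 c1 c2 T1 T2 _ IH1 _ IH2 T st' H.
  inversion H as [| | |? st1' ? ? ? ? ? H1 H2| | |]; subst.
  by case: (IH1 _ _ H1) => ? ?; subst; case: (IH2 _ _ H2) => ? ?; subst.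
- move=> st st1 B c1 c2 b T Eb _ IH T2 st2 H.
  inversion H as [| | | |? ? ? ? ? b' ? Eb' H1| |]; subst.
  move: Eb'; rewrite Eb => -[?]; subst b'.
  by case: (IH _ _ H1) => ? ?; subst.
- move=> st B c Eb T2 st2 H.
  inversion H as [| | | | | |? ? ? ? ? b' ? ? Eb' nb']; subst => //.
  by move: Eb' nb'; rewrite Eb => -[<-].
- move=> st st1 st2 B c b T1 T2 Eb nb _ IH1 _ IH2 T st' H.
  inversion H as [| | | | |? ? ? Eb'|? ? ? ? ? b' ? ? Eb' nb' H1 H2]; subst.
    by move: Eb' nb; rewrite Eb => -[->].
  by case: (IH1 _ _ H1) => ? ?; subst; case: (IH2 _ _ H2) => ? ?; subst.
Qed.

(* Input: variable 0 holds [n]; array 1 is the concatenation of the adjacency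
   lists of the vertices 0, ..., n-1, and the list of [u] occupies its cells
   from [offset u] to [offset u.+1 - 1], the offsets being in array 0 (cells
   0, ..., n); arrays 2 and 3 list the [s i] and the [t i].  All other memory
   is 0. *)
Definition offsets (n : nat) (L : 'I_n -> seq 'I_n) : seq nat :=
  mkseq (fun u => \sum_(w < n | w < u) size (L w)) n.+1.

Definition neighbours (n : nat) (L : 'I_n -> seq 'I_n) : seq nat :=
  [seq val v | v <- flatten [seq L u | u <- enum 'I_n]].

Definition dsp_input (k n : nat) (L : 'I_n -> seq 'I_n) (s t : 'I_k -> 'I_n) :
    state :=
  State (fun x => if x == 0 then n else 0)
        (fun a => nth 0 (nth [::] [:: offsets L; neighbours L;
                                      [seq val (s i) | i <- enum 'I_k];
                                      [seq val (t i) | i <- enum 'I_k]] a)).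

(* Output: variable 0 is 0 to report that there is no solution, and nonzero to
   announce one; then the number of vertices of the i-th path is in variable
   1 + i and its vertices are in array 4 + i. *)
Definition dsp_output_correct (k n : nat) (e : rel 'I_n) (s t : 'I_k -> 'I_n)
    (st : state) : Prop :=
  if vars st 0 == 0 then ~ exists P, dsp_solution e s t P
  else exists P, dsp_solution e s t P /\
         forall i : 'I_k,
           [seq val v | v <- P i] = mkseq (arrs st (4 + i)) (vars st (1 + i)).

(* Main.v *)
Require Import Defs.
From mathcomp Require Import all_boot zify.

Set Implicit Arguments.
Unset Strict Implicit.
Unset Printing Implicit Defensive.

(** Shift the distances from the two sources by one and call them [X] and [Y].
    A shortest path P from the first source raises [X] by one at every step
    while [Y] moves by at most one; a shortest path Q from the second source
    raises [Y] by one while [X] moves by at most one.  In the plane with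
    coordinates ([X], [Y]) the path P is thus the graph of a 1-Lipschitz
    function of [X], and Q that of a 1-Lipschitz function of [Y].  A vertex on
    both paths is in particular a meeting point in the plane, and two meeting
    points are at most as far apart vertically as horizontally, and conversely:
    all meeting points lie on one diagonal or on one antidiagonal.

    The level [X + Y] never decreases along P or Q, so a conflict can only occur
    inside one level, and there P runs with increasing [X] and Q with decreasing
    [X].  Therefore disjoint paths can be built by a game with one pebble per
    path that always advances the pebble on the lower level and needs almost no
    memory.  Only two pebbles that face each other on a common level are
    delicate; a mode in {0, 1, 2} records which of them has promised to leave the
    level with its next move.  A configuration is two vertices and a mode, and
    its moves are the edges at one of the two vertices, so the whole game has
    O(n^2) configurations and O(nm) moves.  Every won game yields disjoint paths
    ([pebble_sound]), and every pair of disjoint paths that do not cross within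
    an antidiagonal can be played ([pebble_complete]).

    The remaining pairs cross along an antidiagonal.  Read Q backwards, from its
    target to its source, and replace [Y] by n + 1 - [Y]: antidiagonals become
    diagonals, and the Lipschitz property shows that a pair which crosses along
    an antidiagonal in the first picture cannot do so in the second
    ([crossing_exclusive]).  Hence disjoint shortest paths exist exactly when one
    of the two games is won ([no_routes], [play_routes]).  The moves only look at
    distances from the sources: a path that raises this distance by one at every
    step is shortest ([route_shortest]).

    The program computes both distance layerings by breadth-first search
    ([bfs_correct]), fills a table of won configurations in decreasing order of
    [X] and then of [Y] ([run_fill_table]), and follows the stored winning moves,
    writing a vertex with [X] = i + 1 into cell i of the first output array, and
    likewise for the second path ([run_attempt]).  If the first game is lost it
    reverses the second path and tries again ([run_search]).  Since a connected
    graph with at least two vertices has no isolated vertex, n^2 is O(nm + 1), and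
    so is the total cost.

    Program correctness is expressed by [run], a total-correctness triple with a
    cost bound.  Word overflow is excluded once and for all: every stored number
    stays below B = (n + 2)^5 and every expression of the program has a value
    below B^12. *)

(** * Programs on bounded words: values, frames and running times *)

(** The value of an expression on a machine without overflow; [evalE] gives the
    conditions under which the real machine computes it. *)
Fixpoint ev (st : state) (E : expr) : nat :=
  match E with
  | Const c => c
  | Var x => vars st x
  | Get a E1 => arrs st a (ev st E1)
  | Add E1 E2 => ev st E1 + ev st E2
  | Defs.Sub E1 E2 => ev st E1 - ev st E2
  | Mul E1 E2 => ev st E1 * ev st E2
  | Ltn E1 E2 => ev st E1 < ev st E2
  | Eqn E1 E2 => ev st E1 == ev st E2
  end.

(** If all stored numbers are below B, the value of an expression E is below
    B ^ [edeg E].  This replaces the overflow test of every subexpression by one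
    closed computation on the program text. *)
Fixpoint edeg (E : expr) : nat :=
  match E with
  | Const _ | Var _ | Get _ _ | Ltn _ _ | Eqn _ _ => 1
  | Add E1 E2 => (maxn (edeg E1) (edeg E2)).+1
  | Defs.Sub E1 E2 => edeg E1
  | Mul E1 E2 => edeg E1 + edeg E2
  end.

(** The word bound is B ^ 12, and B is at least 100, so that the literals of the
    program are themselves below B. *)
Fixpoint small (E : expr) : bool :=
  (edeg E <= 12) &&
  match E with
  | Const c => c < 100
  | Var _ => true
  | Get _ E1 => small E1
  | Add E1 E2 | Defs.Sub E1 E2 | Mul E1 E2 | Ltn E1 E2 | Eqn E1 E2 =>
      small E1 && small E2
  end.

Definition bounded (B : nat) (st : state) : Prop :=
  (forall x, vars st x < B) /\ (forall a i, arrs st a i < B).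

Lemma ev_bound B st E : 100 <= B -> bounded B st -> small E ->
  ev st E < B ^ edeg E.
Proof.
move=> B100 [bv ba].
elim: E => [c|x|a E1 IH1|E1 IH1 E2 IH2|E1 IH1 E2 IH2|E1 IH1 E2 IH2|E1 _ E2 _|E1 _ E2 _] /=.
- by move=> c100; rewrite expn1; lia.
- by rewrite expn1.
- by rewrite expn1.
- case/and3P=> _ /IH1 h1 /IH2 h2.
  have B0 : 0 < B by lia.
  have l1 : B ^ edeg E1 <= B ^ maxn (edeg E1) (edeg E2)
    by rewrite leq_pexp2l // leq_maxl.
  have l2 : B ^ edeg E2 <= B ^ maxn (edeg E1) (edeg E2)
    by rewrite leq_pexp2l // leq_maxr.
  rewrite expnS; apply: leq_trans (_ : 2 * B ^ maxn (edeg E1) (edeg E2) <= _); first lia.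
  by rewrite leq_mul2r; apply/orP; right; lia.
- by case/and3P=> _ /IH1 h1 _; apply: leq_ltn_trans h1; rewrite leq_subr.
- by case/and3P=> _ /IH1 h1 /IH2 h2; rewrite expnD ltn_mul.
- by rewrite expn1 => _; apply: leq_ltn_trans (leq_b1 _) _; lia.
- by rewrite expn1 => _; apply: leq_ltn_trans (leq_b1 _) _; lia.
Qed.

Lemma evalE B st E : 100 <= B -> bounded B st -> small E ->
  eval (B ^ 12) st E = Some (ev st E).
Proof.
move=> B100 bnd.
have wordE E' : small E' -> word (B ^ 12) (ev st E') = Some (ev st E').
  move=> sE; rewrite /word; have -> // : ev st E' < B ^ 12.
  apply: leq_trans (ev_bound B100 bnd sE) _; rewrite leq_pexp2l //; first lia.
  by case: E' sE => [c|x|a E1|E1 E2|E1 E2|E1 E2|E1 E2|E1 E2] //= /andP[].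
elim: E => [c|x|a E1 IH1|E1 IH1 E2 IH2|E1 IH1 E2 IH2|E1 IH1 E2 IH2|E1 IH1 E2 IH2|E1 IH1 E2 IH2] sE;
  rewrite -(wordE _ sE) /= //; move: sE => /=.
- by move/IH1->.
1,2,3: by case/and3P=> _ /IH1-> /IH2->.
all: by case/andP=> /IH1-> /IH2->.
Qed.

Fixpoint wvars (c : cmd) : seq nat :=
  match c with
  | Assign x _ => [:: x]
  | Seq c1 c2 | If _ c1 c2 => wvars c1 ++ wvars c2
  | While _ c1 => wvars c1
  | Skip | Store _ _ _ => [::]
  end.

Fixpoint warrs (c : cmd) : seq nat :=
  match c with
  | Store a _ _ => [:: a]
  | Seq c1 c2 | If _ c1 c2 => warrs c1 ++ warrs c2
  | While _ c1 => warrs c1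
  | Skip | Assign _ _ => [::]
  end.

(** Arrays are compared cell by cell, because they are functions. *)
Definition agree (xs bs : seq nat) (st st' : state) : Prop :=
  (forall x, x \notin xs -> vars st' x = vars st x) /\
  (forall b, b \notin bs -> forall i, arrs st' b i = arrs st b i).

Lemma agree_trans xs bs st1 st2 st3 :
  agree xs bs st1 st2 -> agree xs bs st2 st3 -> agree xs bs st1 st3.
Proof.
move=> [v12 a12] [v23 a23]; split=> [x xn|b bn i]; first by rewrite v23 ?v12.
by rewrite a23 ?a12.
Qed.

Lemma agree_sub xs bs xs' bs' st1 st2 :
  {subset xs <= xs'} -> {subset bs <= bs'} ->
  agree xs bs st1 st2 -> agree xs' bs' st1 st2.
Proof.
move=> sx sb [v12 a12]; split=> [x xn|b bn i].
  by rewrite v12 //; apply: contra xn; apply: sx.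
by rewrite a12 //; apply: contra bn; apply: sb.
Qed.

Lemma exec_agree W c st T st' :
  exec W c st T st' -> agree (wvars c) (warrs c) st st'.
Proof.
elim=> {c st T st'}.
- by move=> st; split.
- move=> st x E v _; split=> //= y; rewrite inE => /negPf yx.
  by rewrite yx.
- move=> st a I E i v _ _; split=> //= b; rewrite inE => /negPf ba j.
  by rewrite ba.
- move=> st st1 st2 c1 c2 T1 T2 _ A1 _ A2 /=.
  by apply: agree_trans; [apply: agree_sub A1|apply: agree_sub A2];
    move=> x; rewrite mem_cat => -> //; rewrite orbT.
- move=> st st1 B c1 c2 b T _ _ A /=.
  apply: agree_sub A; move=> x; rewrite mem_cat;
    by case: (b != 0) => ->; rewrite ?orbT.
- by move=> st B c _; split.
- move=> st st1 st2 B c b T1 T2 _ _ _ A1 _ A2 /=.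
  exact: agree_trans A1 A2.
Qed.

(** Total correctness with a cost bound.  Boundedness by B is part of the
    conclusion because it is the precondition of every later evaluation. *)
Definition run (B K : nat) (c : cmd) (st : state) (Q : state -> Prop) : Prop :=
  exists T st', [/\ exec (B ^ 12) c st T st', T <= K, bounded B st' & Q st'].

Lemma bounded_var B st x v : bounded B st -> v < B -> bounded B (set_var st x v).
Proof. by move=> [bv ba] vB; split=> //= y; case: ifP. Qed.

Lemma bounded_cell B st a i v :
  bounded B st -> v < B -> bounded B (set_cell st a i v).
Proof. by move=> [bv ba] vB; split=> //= b j; case: ifP. Qed.

Section Rules.

Variable B : nat.
Hypothesis B100 : 100 <= B.

(** The frame of the command is available when a postcondition is weakened, so
    that specifications need only speak of what a command changes. *)
Lemma run_weaken K K' c st (Q Q' : state -> Prop) :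
  run B K c st Q -> K <= K' ->
  (forall st', bounded B st' -> agree (wvars c) (warrs c) st st' ->
    Q st' -> Q' st') ->
  run B K' c st Q'.
Proof.
move=> [T [st' [ex TK bnd q]]] KK' QQ'; exists T, st'; split=> //.
  exact: leq_trans KK'.
by apply: QQ' => //; apply: exec_agree ex.
Qed.

Lemma run_skip K st (Q : state -> Prop) :
  bounded B st -> 0 < K -> Q st -> run B K Skip st Q.
Proof. by move=> bnd K0 q; exists 1, st; split=> //; constructor. Qed.

Lemma run_assign K x E st (Q : state -> Prop) :
  bounded B st -> small E -> ecost E < K -> ev st E < B ->
  Q (set_var st x (ev st E)) -> run B K (Assign x E) st Q.
Proof.
move=> bnd sE cE vB q; exists (ecost E).+1, (set_var st x (ev st E)); split=> //.
  by constructor; rewrite evalE.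
exact: bounded_var.
Qed.

Lemma run_store K a I E st (Q : state -> Prop) :
  bounded B st -> small I && small E -> ecost I + ecost E < K -> ev st E < B ->
  Q (set_cell st a (ev st I) (ev st E)) -> run B K (Store a I E) st Q.
Proof.
move=> bnd /andP[sI sE] cE vB q.
exists (ecost I + ecost E).+1, (set_cell st a (ev st I) (ev st E)); split=> //.
  by constructor; rewrite evalE.
exact: bounded_cell.
Qed.

Lemma run_seq K1 K2 c1 c2 st (Q : state -> Prop) :
  run B K1 c1 st (fun st1 => run B K2 c2 st1 Q) ->
  run B (K1 + K2) (Seq c1 c2) st Q.
Proof.
move=> [T1 [st1 [ex1 T1K bnd1 [T2 [st2 [ex2 T2K bnd2 q]]]]]].
exists (T1 + T2), st2; split=> //; last by rewrite leq_add.
exact: exec_Seq ex1 ex2.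
Qed.

Lemma run_if K b c1 c2 st (Q : state -> Prop) :
  bounded B st -> small b ->
  run B K (if ev st b != 0 then c1 else c2) st Q ->
  run B (ecost b + K).+1 (If b c1 c2) st Q.
Proof.
move=> bnd sb [T [st' [ex TK bnd' q]]].
exists (ecost b + T).+1, st'; split=> //.
  by apply: exec_If ex; rewrite evalE.
by rewrite ltnS leq_add2l.
Qed.

Lemma run_cons K K1 c1 c2 st (Q1 Q : state -> Prop) :
  run B K1 c1 st Q1 -> K1 <= K ->
  (forall st1, bounded B st1 -> agree (wvars c1) (warrs c1) st st1 -> Q1 st1 ->
    run B (K - K1) c2 st1 Q) ->
  run B K (Seq c1 c2) st Q.
Proof.
move=> r1 K1K r2; rewrite -(subnKC K1K); apply: run_seq.
exact: run_weaken r1 (leqnn _) r2.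
Qed.

Lemma run_assign_cons K x E c st (Q : state -> Prop) :
  bounded B st -> small E -> ecost E < K -> ev st E < B ->
  (bounded B (set_var st x (ev st E)) ->
   run B (K - (ecost E).+1) c (set_var st x (ev st E)) Q) ->
  run B K (Seq (Assign x E) c) st Q.
Proof.
move=> bnd sE cE vB r; rewrite -(subnKC cE); apply: run_seq.
by apply: run_assign => //; apply: r; apply: bounded_var.
Qed.

Lemma run_store_cons K a I E c st (Q : state -> Prop) :
  bounded B st -> small I && small E -> ecost I + ecost E < K -> ev st E < B ->
  (bounded B (set_cell st a (ev st I) (ev st E)) ->
   run B (K - (ecost I + ecost E).+1) c (set_cell st a (ev st I) (ev st E)) Q) ->
  run B K (Seq (Store a I E) c) st Q.
Proof.
move=> bnd sE cE vB r; rewrite -(subnKC cE); apply: run_seq.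
by apply: run_store => //; apply: r; apply: bounded_cell.
Qed.

Lemma run_test K b c1 c2 st (Q : state -> Prop) :
  bounded B st -> small b -> ecost b < K ->
  (ev st b != 0 -> run B (K - (ecost b).+1) c1 st Q) ->
  (ev st b = 0 -> run B (K - (ecost b).+1) c2 st Q) ->
  run B K (If b c1 c2) st Q.
Proof.
move=> bnd sb cb r1 r2; rewrite -(subnKC cb) addSn; apply: run_if => //.
by case: eqP => [/r2|/eqP/r1].
Qed.

Definition For (i : nat) (lo hi : expr) (body : cmd) : cmd :=
  Seq (Assign i lo)
      (While (Ltn (Var i) hi) (Seq body (Assign i (Add (Var i) (Const 1))))).

(** The loop rule supplies the frame of the body, hence an invariant only has to
    mention cells that the body writes.  Each iteration adds 20 to the cost of
    the body for the test and the increment. *)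
Lemma run_for i lo hi body st0 l h (f : nat -> nat)
    (Inv : nat -> state -> Prop) K (Q : state -> Prop) :
  i \notin wvars body ->
  bounded B st0 -> small lo && small hi -> ev st0 lo = l -> l < B ->
  ecost hi <= 10 -> ecost lo <= 10 -> h < B ->
  (forall st, agree (i :: wvars body) (warrs body) st0 st -> ev st hi = h) ->
  Inv l (set_var st0 i l) ->
  (forall k st, l <= k < h -> bounded B st ->
     agree (i :: wvars body) (warrs body) st0 st -> vars st i = k -> Inv k st ->
     run B (f k) body st (fun st' => Inv k.+1 (set_var st' i k.+1))) ->
  30 + \sum_(l <= k < h) (f k + 20) <= K ->
  (forall k st, bounded B st -> agree (i :: wvars body) (warrs body) st0 st ->
     k = maxn l h -> vars st i = k -> Inv k st -> Q st) ->
  run B K (For i lo hi body) st0 Q.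
Proof.
move=> iw bnd0 /andP[slo shi] elo lB chi clo hB ehi inv0 step leK post.
set xs := i :: wvars body; set bs := warrs body.
pose wh := While (Ltn (Var i) hi) (Seq body (Assign i (Add (Var i) (Const 1)))).
have loop d k st : d = h - k -> l <= k -> k <= maxn l h -> bounded B st ->
    agree xs bs st0 st -> vars st i = k -> Inv k st ->
    run B (15 + \sum_(k <= j < h) (f j + 20)) wh st Q.
  elim: d k st => [|d IH] k st dk lk kmax bnd ag ik inv.
    exists (ecost (Ltn (Var i) hi)).+1, st; split=> //.
    - apply: exec_WhileF; rewrite evalE //=.
      by rewrite ehi // ik; have -> : (k < h) = false by lia.
    - by rewrite /=; lia.
    - by apply: post (k) _ bnd ag _ ik inv; lia.
  have kh : l <= k < h by lia.
  have [T [st1 [ex1 T1 bnd1 inv1]]] := step k st kh bnd ag ik inv.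
  have ik1 : vars st1 i = k by have [-> //] := exec_agree ex1.
  pose st2 := set_var st1 i k.+1.
  have bnd2 : bounded B st2 by apply: bounded_var => //; lia.
  have ag2 : agree xs bs st0 st2.
    have [v1 a1] := exec_agree ex1; have [v0 a0] := ag.
    split=> [x|b bb j] /=; last by rewrite a1 // a0.
    rewrite inE negb_or => /andP[xi xb].
    by rewrite (negPf xi) v1 // v0 // inE negb_or xi.
  have [T' [st' [ex' T'K bnd' q]]] :=
    IH k.+1 st2 ltac:(lia) ltac:(lia) ltac:(lia) bnd2 ag2 ltac:(by rewrite /= eqxx) inv1.
  exists (ecost (Ltn (Var i) hi) + (T + (ecost (Add (Var i) (Const 1))).+1) + T').+1, st'.
  split=> //.
    apply: exec_WhileT ex'; last 1 first.
    - apply: exec_Seq ex1 _; rewrite /st2.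
      have -> : k.+1 = ev st1 (Add (Var i) (Const 1)) by rewrite /= ik1 addn1.
      by constructor; rewrite evalE.
    - by rewrite evalE.
    - by rewrite /= ehi // ik; case/andP: kh => _ ->.
  rewrite big_ltn /=; last by lia.
  lia.
apply: run_weaken (_ : run B (11 + (15 + \sum_(l <= j < h) (f j + 20))) _ _ Q) _ _ => //.
  apply: run_seq; apply: run_assign => //.
    by rewrite elo.
  rewrite elo; apply: (loop (h - l)) => //; first by rewrite leq_maxl.
  - exact: bounded_var.
  - by split=> // x; rewrite inE negb_or /= => /andP[/negPf->].
  - by rewrite /= eqxx.
by apply: leq_trans leK; lia.
Qed.

End Rules.

(** * The two-pebble game *)

Section Pebbles.

Variables (n : nat) (E : rel nat) (X Y : nat -> nat) (t1 t2 : nat).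

(** The vertex n is an exit that is entered from the target only; it stands for
    a path that has ended. *)
Definition pebble_arc (Z : nat -> nat) (t u w : nat) : bool :=
  (E u w && (Z w == (Z u).+1)) || ((u == t) && (w == n)).

Definition level (u : nat) : nat := X u + Y u.

Definition same_level (u v : nat) : bool := level u == level v.

(** On a common level the first pebble only moves towards larger X and the
    second one towards smaller X, so pebbles that do not face each other will not
    meet on this level any more. *)
Definition facing (u v : nat) : bool := same_level u v && (X u < X v).

(** Mode 1: the second pebble has to leave the common level with its next move,
    which happens after the first one has left.  Mode 2: the same with the
    pebbles exchanged. *)
Definition first_moves (u v m : nat) : bool :=
  if m == 0 then (level u < level v) || (same_level u v && (X v <= X u))
  else if m == 1 then same_level u v else ~~ same_level u v.

(** How the mover may go from z to w.  Facing pebbles in mode 0: the second may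
    approach the first inside the level without reaching its X.  Mode 1: inside
    the level the first pebble must not pass the second, whose earlier vertices
    on this level lie beyond it.  Mode 2: the first pebble occupies a single
    vertex of the level, so the second may even pass it. *)
Definition admissible (u v m z w : nat) : bool :=
  if m == 0 then ~~ facing u v || ((level w == level z) && (X u < X w))
  else if m == 1 then (level z < level w) || (same_level u v && (X w <= X v))
  else (level z < level w) || same_level u v.

Definition next_mode (u v m : nat) : nat := if same_level u v then m else 0.

Definition config : Type := (nat * nat * nat)%type.

Definition pebble_move (s s' : config) : bool :=
  let: (u, v, m) := s in let: (u', v', m') := s' in
  [&& u != v, m' == next_mode u v m &
   if first_moves u v m
   then [&& v' == v, pebble_arc X t1 u u' & admissible u v m u u']
   else [&& u' == u, pebble_arc Y t2 v v' & admissible u v m v v']].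

(** A mode is entered implicitly: facing pebbles in mode 0 may use the moves of
    mode 1 or of mode 2.  So every step moves a pebble, and the length of a game
    is bounded by the lengths of the two paths. *)
Definition pebble_step (s s' : config) : bool :=
  let: (u, v, m) := s in
  pebble_move s s' ||
  [&& m == 0, facing u v & pebble_move (u, v, 1) s' || pebble_move (u, v, 2) s'].

Definition goal_config : config := (n, n, 0).

Inductive winning : config -> Prop :=
| winning_goal : winning goal_config
| winning_step s s' : pebble_step s s' -> winning s' -> winning s.

Hypothesis En : forall u w, E u w -> (u < n) && (w < n).
Hypothesis XE : forall u w, E u w -> (X w <= (X u).+1) && (X u <= (X w).+1).
Hypothesis YE : forall u w, E u w -> (Y w <= (Y u).+1) && (Y u <= (Y w).+1).
Hypothesis Xn : forall u, u < n -> X u <= n.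
Hypothesis Yn : forall u, u < n -> Y u <= n.
Hypothesis Xbot : X n = n + n + 2.
Hypothesis Ybot : Y n = n + n + 2.
Hypothesis t1n : t1 < n.
Hypothesis t2n : t2 < n.

Definition advance (Z : nat -> nat) (u w : nat) : bool :=
  (Z u < Z w) && (level u <= level w).

Lemma advance_trans Z : transitive (advance Z).
Proof. by move=> b a c; rewrite /advance; lia. Qed.

Lemma arcX_advance u w : pebble_arc X t1 u w -> advance X u w && (u < n).
Proof.
rewrite /pebble_arc /advance /level; case/orP=> [/andP[e /eqP->]|/andP[/eqP-> /eqP->]].
  by have := En e; have := YE e; lia.
by have := Xn t1n; have := Yn t1n; lia.
Qed.

Lemma arcY_advance v w : pebble_arc Y t2 v w -> advance Y v w && (v < n).
Proof.
rewrite /pebble_arc /advance /level; case/orP=> [/andP[e /eqP->]|/andP[/eqP-> /eqP->]].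
  by have := En e; have := XE e; lia.
by have := Xn t2n; have := Yn t2n; lia.
Qed.

Lemma path_advance Z t u p :
  (forall a b, pebble_arc Z t a b -> advance Z a b && (a < n)) ->
  path (pebble_arc Z t) u (rcons p n) -> all (advance Z u) p.
Proof.
move=> adv pp; have : path (advance Z) u (rcons p n).
  by apply: sub_path pp => a b /adv/andP[].
by move/(order_path_min (@advance_trans Z)); rewrite all_rcons => /andP[].
Qed.

(** What is left of a path whose pebble is on u; it is empty if u is the exit. *)
Definition chain (Z : nat -> nat) (t u : nat) (p : seq nat) : Prop :=
  head n p = u /\ sorted (pebble_arc Z t) (rcons p n).

Lemma chain_cons Z t u w p : u < n -> pebble_arc Z t u w -> chain Z t w p ->
  chain Z t u (u :: p).
Proof.
move=> un uw [hp sp]; split=> //=.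
by case: p hp sp => [|a p] /= hp sp; rewrite ?hp uw // -hp.
Qed.

Lemma chain_mem Z t u p w :
  (forall a b, pebble_arc Z t a b -> advance Z a b && (a < n)) ->
  chain Z t u p -> w \in p -> w < n /\ (w = u \/ advance Z u w).
Proof.
move=> adv [hu pp] wp; split.
  move: wp pp; elim: p {hu} => [|a p IH] //=; rewrite inE.
  case/orP=> [/eqP-> {IH}|/IH h pp].
    by case: p => [|b p] /= /andP[/adv/andP[]].
  by apply: h; apply: path_sorted pp.
case: p hu pp wp => [|a p] //= <-{u} pp; rewrite inE => /orP[/eqP->|wp]; first by left.
by right; apply: (allP (path_advance adv pp)).
Qed.

Definition mode_pre (s : config) : Prop :=
  let: (u, v, m) := s in
  [/\ m <= 2, m = 1 -> level v <= level u /\ (same_level u v -> X u <= X v) &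
   m = 2 -> level u <= level v].

(** What the two remaining paths satisfy besides being disjoint.  The second
    clause is what makes it safe to put the current vertex of the second pebble
    in front of its path: inside the level the first path does not get beyond
    it. *)
Definition mode_post (s : config) (p q : seq nat) : Prop :=
  let: (u, v, m) := s in
  [/\ forall w, w \in p -> w \in q -> False,
      m <= 1 -> same_level u v -> X u + (m == 0) <= X v ->
        forall w, w \in p -> level w = level u -> X w <= X v,
      m = 1 -> forall w, w \in q -> w != v -> level v < level w &
      m = 2 -> forall w, w \in p -> w != u -> level u < level w].

Lemma move_pre s s' : mode_pre s -> pebble_move s s' -> mode_pre s'.
Proof.
case: s s' => [[u v] m] [[u' v'] m'] [m2 pre1 pre2] /= /and3P[uv /eqP->].
have {m2}: [\/ m = 0, m = 1 | m = 2].
  by case: m m2 {pre1 pre2} => [|[|[|]]] // _; [constructor 1|constructor 2|constructor 3].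
rewrite /first_moves /next_mode /admissible /facing /same_level.
case: (level u =P level v) => luv /=; last by [].
case=> em; subst m => //=.
- move=> /and3P[/eqP-> /arcX_advance/andP[/andP[_ le] _]] H; split=> //.
  move=> _; split; first by rewrite -luv.
  by move/eqP=> luv'; move: H; lia.
- by move=> /and3P[/eqP-> /arcY_advance/andP[/andP[_ le] _]] H; split=> // _; lia.
Qed.

(** The current vertex of the mover is added to its path.  It is not on the other
    path: that one stays on higher levels, or has passed it on the common level,
    or is kept away from it by the clauses of [mode_post]. *)
Lemma move_sound s s' p' q' : mode_pre s -> pebble_move s s' ->
  chain X t1 s'.1.1 p' -> chain Y t2 s'.1.2 q' -> mode_post s' p' q' ->
  exists p q, [/\ chain X t1 s.1.1 p, chain Y t2 s.1.2 q, mode_post s p q,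
    {subset p <= s.1.1 :: p'} & {subset q <= s.1.2 :: q'}].
Proof.
case: s s' => [[u v] m] [[u' v'] m'] [m2 pre1 pre2] /= /and3P[uv /eqP->].
have {m2}: [\/ m = 0, m = 1 | m = 2].
  by case: m m2 {pre1 pre2} => [|[|[|]]] // _; [constructor 1|constructor 2|constructor 3].
move=> Hm mv cp cq [dis post0 post1 post2].
have nuv : u <> v by apply/eqP.
case fm: (first_moves u v m) mv => /and3P[/eqP ee ar ad]; subst.
- exists (u :: p'), q'; have /andP[/andP[au lu] un] := arcX_advance ar.
  split=> //; [exact: chain_cons cp| |by move=> x; rewrite inE orbC => ->].
  have memq w : w \in q' -> [\/ w = v | advance Y v w].
    by case/(chain_mem arcY_advance cq) => _ [->|]; [left|right].
  have memp w : w \in p' -> [\/ w = u' | advance X u' w].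
    by case/(chain_mem arcX_advance cp) => _ [->|]; [left|right].
  split.
  + move=> w; rewrite inE => /orP[/eqP->{w}|/dis//] uq.
    have := memq _ uq; rewrite /advance.
    case: Hm => em; subst m; move: fm post1 uq; rewrite /first_moves /next_mode /same_level /level /=.
      by move=> fm _ _ [|]; lia.
      move=> fm; rewrite fm => /(_ erefl) h uq; have := h u uq.
      have -> : u != v by apply/eqP.
      by move=> /(_ erefl); rewrite /level; lia.
    by move: pre2; rewrite /level => /(_ erefl) ? fm _ _ [|]; lia.
  + case: Hm => em m1 luv xuv; subst m => //.
      by move: fm luv xuv; rewrite /first_moves /same_level /=; lia.
    move: fm post0 ad; rewrite /first_moves /next_mode /admissible /= => fm.
    rewrite fm /= => post0 ad w; rewrite inE => /orP[/eqP->|wp]; first by lia.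
    move=> lw; have lu'w : level u' <= level w.
      by case: (memp _ wp) => [->|/andP[]].
    move: fm ad; rewrite /same_level => fm ad.
    by apply: post0 wp _ => //; rewrite /same_level; lia.
  + move=> em; subst m; move: fm post1; rewrite /first_moves /next_mode /= => fm.
    by rewrite fm; apply.
  + move=> em; subst m; move: fm ad; rewrite /first_moves /admissible /= => fm ad w.
    rewrite inE => /orP[/eqP->|wp _]; first by rewrite eqxx.
    by case: (memp _ wp) => [->|/andP[_]]; lia.
- exists p', (v :: q'); have /andP[/andP[av lv] vn] := arcY_advance ar.
  split=> //; [exact: chain_cons cq| |by move=> x; rewrite inE orbC => ->].
  have memq w : w \in q' -> level v' <= level w.
    by case/(chain_mem arcY_advance cq) => _ [->|/andP[]].
  have memp w : w \in p' -> [\/ w = u | advance X u w].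
    by case/(chain_mem arcX_advance cp) => _ [->|]; [left|right].
  split.
  + move=> w wp; rewrite inE => /orP[/eqP ew|/dis]; last by apply.
    subst w; have := memp _ wp; rewrite /advance.
    case: Hm => em; subst m; move: fm post0 post2 ad wp;
      rewrite /first_moves /next_mode /admissible /facing /same_level /=.
    * case: (level u =P level v) => luv /=; last by move=> ? _ _ _ _ [|]; lia.
      move=> fm post0 _ ad vp _; have := post0 erefl _ _ _ vp.
      by move: av fm ad luv; rewrite /level /=; lia.
    * by move=> fm _ _ _ _ [|]; lia.
    * move=> /negbFE fm; rewrite fm => _ /(_ erefl) h _ /h.
      by rewrite (_ : v != u); [move=> /(_ erefl); lia|apply/eqP => ?; subst].
  + case: Hm => em m1 luv xuv w wp lw; subst m => //.
      move: post0 ad; rewrite /next_mode /admissible /facing luv /= => post0 ad.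
      have := post0 erefl _ _ _ wp lw.
      by move: luv av xuv ad; rewrite /same_level /level /=; lia.
    by move: fm luv; rewrite /first_moves /= => ->.
  + move=> em; subst m; move: fm ad; rewrite /first_moves /admissible /= => -> /=.
    rewrite orbF => ad w; rewrite inE => /orP[/eqP->|/memq wq _]; first by rewrite eqxx.
    by lia.
  + move=> em; subst m; move: fm post2; rewrite /first_moves /next_mode /=.
    by move/negbFE => ->; apply.
Qed.

(** Induction from the end of the game; the vertices of the two paths are
    positions of the pebbles, which is how the program will output them. *)
Lemma pebble_sound s ss : path pebble_step s ss -> last s ss = goal_config ->
  mode_pre s ->
  exists p q, [/\ chain X t1 s.1.1 p, chain Y t2 s.1.2 q, mode_post s p q,
    forall w, w \in p -> exists2 s', s' \in s :: ss & s'.1.1 = w &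
    forall w, w \in q -> exists2 s', s' \in s :: ss & s'.1.2 = w].
Proof.
elim: ss s => [|s' ss IH] s /=.
  by move=> _ -> _; exists [::], [::]; split.
case/andP=> st pss lst pre.
have [r [mr prer postr erf]] : exists r, [/\ pebble_move r s', mode_pre r,
    forall p q, mode_post r p q -> mode_post s p q & r.1 = s.1].
  case: s st pre => [[u v] m]; case/orP=> [mv pre|]; first by exists (u, v, m).
  case/and3P=> /eqP-> fc mv pre; move: (fc); rewrite /facing => /andP[luv xuv].
  have luv' : level u = level v by apply/eqP.
  case/orP: mv => mv; [exists (u, v, 1)|exists (u, v, 2)]; split=> //=.
  - by split=> // _; split=> [|_]; [rewrite luv'|exact: ltnW].
  - move=> p q [d p0 p1 p2]; split=> // _ _ _ w wp lw; apply: p0 => //.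
    by rewrite addn0 ltnW.
  - by split=> // _; rewrite luv'.
  - move=> p q [d p0 p1 p2]; split=> // _ _ _ w wp lw.
    have [->|wu] := eqVneq w u; first exact: ltnW.
    by have := p2 erefl w wp wu; lia.
have [p' [q' [cp' cq' post' inp' inq']]] := IH s' pss lst (move_pre prer mr).
have [p [q [cp cq post inp inq]]] := move_sound prer mr cp' cq' post'.
exists p, q; rewrite -erf; split=> //; first exact: postr.
- move=> w /inp; rewrite inE => /orP[/eqP->|/inp'[s2 s2i <-]].
    by exists s; rewrite ?mem_head // erf.
  by exists s2 => //; rewrite inE s2i orbT.
- move=> w /inq; rewrite inE => /orP[/eqP->|/inq'[s2 s2i <-]].
    by exists s; rewrite ?mem_head // erf.
  by exists s2 => //; rewrite inE s2i orbT.
Qed.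

(** The two situations that the game cannot play: inside one level the paths swap
    their places in the plane, or P passes straight through a point of Q. *)
Definition crossing (P Q : seq nat) : Prop :=
  (exists i j, [/\ i.+1 < size P, j.+1 < size Q,
     level (nth n P i.+1) = level (nth n P i),
     level (nth n Q j.+1) = level (nth n Q j) &
     level (nth n P i) = level (nth n Q j) /\ X (nth n P i) = X (nth n Q j.+1)]) \/
  (exists i j, [/\ i.+2 < size P, j < size Q,
     level (nth n P i.+1) = level (nth n P i),
     level (nth n P i.+2) = level (nth n P i.+1) &
     level (nth n P i.+1) = level (nth n Q j) /\ X (nth n P i.+1) = X (nth n Q j)]).

Lemma chain_arc Z t P i : sorted (pebble_arc Z t) (rcons P n) -> i < size P ->
  pebble_arc Z t (nth n P i) (nth n P i.+1).
Proof.
move=> /(sortedP n) sP iP; have nthE k : k <= size P -> nth n (rcons P n) k = nth n P k.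
  move=> kP; rewrite nth_rcons; case: ltngtP => // ek; first by lia.
  by rewrite nth_default // ek.
have := sP i; rewrite size_rcons ltnS => /(_ iP).
by rewrite !nthE // ltnW.
Qed.

Section Complete.

Variables P Q : seq nat.
Hypothesis chP : sorted (pebble_arc X t1) (rcons P n).
Hypothesis chQ : sorted (pebble_arc Y t2) (rcons Q n).
Hypothesis disPQ : forall w, w \in P -> w \in Q -> False.
Hypothesis noX : ~ crossing P Q.

Let u i := nth n P i.
Let v j := nth n Q j.

Lemma winning_move s s' : pebble_move s s' -> winning s' -> winning s.
Proof.
move=> mv; apply: winning_step; case: s mv => [[a b] m] mv.
by rewrite /pebble_step mv.
Qed.

(** Committing costs no step, so a win from the committed configuration has to
    contain a step that can be taken directly from mode 0. *)
Lemma winning_commit a b m : 0 < m <= 2 -> facing a b ->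
  winning (a, b, m) -> winning (a, b, 0).
Proof.
move=> m12 fc w; inversion w as [e|s s' st w' e]; first by move: m12; lia.
apply: winning_step w'; rewrite /pebble_step /= fc /=.
have m0 : (m == 0) = false by lia.
move: st; rewrite /pebble_step m0 /= orbF.
have [->|->] : m = 1 \/ m = 2 by lia.
  by move=> ->; rewrite orbT.
by move=> ->; rewrite !orbT.
Qed.

(** The pebbles follow P and Q.  When they face each other: if P leaves the level
    next, mode 2 is right; if Q leaves next, mode 1 is right, since P stops at Q
    at the latest for lack of a straight passage; and if neither leaves, Q moves,
    because it could reach the X of P only by a swap. *)
Lemma pebble_complete : winning (u 0, v 0, 0).
Proof.
have uP i : i < size P -> [/\ pebble_arc X t1 (u i) (u i.+1), X (u i) < X (u i.+1),
    level (u i) <= level (u i.+1) & u i < n].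
  by move=> iP; have h := chain_arc chP iP; have /andP[/andP[]] := arcX_advance h.
have vQ j : j < size Q -> [/\ pebble_arc Y t2 (v j) (v j.+1), Y (v j) < Y (v j.+1),
    level (v j) <= level (v j.+1) & v j < n].
  by move=> jQ; have h := chain_arc chQ jQ; have /andP[/andP[]] := arcY_advance h.
have ud i : size P <= i -> u i = n by apply: nth_default.
have vd j : size Q <= j -> v j = n by apply: nth_default.
have neq i j : i < size P \/ j < size Q -> u i != v j.
  move=> ij; apply/eqP => e.
  have [iP|iP] := ltnP i (size P); have [jQ|jQ] := ltnP j (size Q).
  - by apply: (@disPQ (u i)); [|rewrite e]; apply: mem_nth.
  - by have [_ _ _] := uP i iP; rewrite e vd // ltnn.
  - by have [_ _ _] := vQ j jQ; rewrite -e ud // ltnn.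
  - by move: ij; lia.
have top w : w < n -> level w < level n.
  by move=> wn; rewrite /level Xbot Ybot; have := Xn wn; have := Yn wn; lia.
have noX1 i j : i.+1 < size P -> j.+1 < size Q -> level (u i.+1) = level (u i) ->
    level (v j.+1) = level (v j) -> level (u i) = level (v j) ->
    X (u i) = X (v j.+1) -> False.
  by move=> *; apply: noX; left; exists i, j.
have noX2 i j : i.+2 < size P -> j < size Q -> level (u i.+1) = level (u i) ->
    level (u i.+2) = level (u i.+1) -> level (u i.+1) = level (v j) ->
    X (u i.+1) = X (v j) -> False.
  by move=> *; apply: noX; right; exists i, j.
clearbody u v.
(* the three modes are proved together, by induction on what is left of P and Q *)
suff main d i j : size P - i + (size Q - j) < d ->
  [/\ winning (u i, v j, 0),
   j < size Q -> level (v j) < level (v j.+1) -> level (v j) <= level (u i) ->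
   (level (u i) = level (v j) -> X (u i) <= X (v j)) ->
   (level (u i) = level (v j) -> X (u i) = X (v j) -> level (u i) < level (u i.+1)) ->
   winning (u i, v j, 1) &
   i < size P -> level (u i) < level (u i.+1) -> level (u i) <= level (v j) ->
   winning (u i, v j, 2)].
  by have [] := main _ 0 0 (ltnSn _).
elim: d i j => [|d IH] i j // ltd.
(* the last hypothesis remembers that P is not passing straight through Q *)
have C1 : j < size Q -> level (v j) < level (v j.+1) -> level (v j) <= level (u i) ->
   (level (u i) = level (v j) -> X (u i) <= X (v j)) ->
   (level (u i) = level (v j) -> X (u i) = X (v j) -> level (u i) < level (u i.+1)) ->
   winning (u i, v j, 1).
  move=> jQ vex lvu xuv xex; have [av yv lv vn] := vQ j jQ.
  have [luv|luv] := eqVneq (level (u i)) (level (v j)); last first.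
    have [w0 _ _] := IH i j.+1 ltac:(lia).
    apply: winning_move w0; rewrite /= neq ?jQ; last by right.
    by rewrite /next_mode /first_moves /admissible /same_level (negPf luv) !eqxx av vex.
  have iP : i < size P.
    by case: ltnP => // iP; have := top _ vn; rewrite -luv ud // ltnn.
  have [au xu lu un] := uP i iP.
  have xu1 : level (u i.+1) = level (u i) -> X (u i.+1) = (X (u i)).+1.
    move: au; rewrite /pebble_arc => /orP[/andP[_ /eqP]|/andP[_ /eqP->]] //.
    by have := top _ un; lia.
  have [_ w1 _] := IH i.+1 j ltac:(lia).
  apply: (winning_move (s' := (u i.+1, v j, 1))); last first.
    apply: w1 => //; [by lia|by lia|].
    move=> luv' xuv'; have [iP1|iP1] := ltnP i.+1 (size P); last first.
      by move: luv'; rewrite ud // => luv'; have := top _ vn; lia.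
    have [_ _ lu1 un1] := uP _ iP1.
    have [//|lu2] := ltnP (level (u i.+1)) (level (u i.+2)).
    have [iP2|iP2] := ltnP i.+2 (size P); last first.
      by move: lu2; rewrite ud // => lu2; have := top _ un1; lia.
    by exfalso; apply: (noX2 i j) => //; lia.
  rewrite /= neq; last by left.
  rewrite /next_mode /first_moves /admissible /same_level luv !eqxx au /=.
  by lia.
have C2 : i < size P -> level (u i) < level (u i.+1) -> level (u i) <= level (v j) ->
   winning (u i, v j, 2).
  move=> iP uex luv; have [au xu lu un] := uP i iP.
  have [euv|nuv] := eqVneq (level (u i)) (level (v j)); last first.
    have [w0 _ _] := IH i.+1 j ltac:(lia).
    apply: winning_move w0; rewrite /= neq ?iP; last by left.
    by rewrite /next_mode /first_moves /admissible /same_level (negPf nuv) !eqxx au uex.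
  have jQ : j < size Q.
    by case: ltnP => // jQ; have := top _ un; rewrite euv vd // ltnn.
  have [av yv lv vn] := vQ j jQ.
  have [_ _ w2] := IH i j.+1 ltac:(lia).
  apply: (winning_move (s' := (u i, v j.+1, 2))); last by apply: w2 => //; lia.
  rewrite /= neq; last by left.
  rewrite /next_mode /first_moves /admissible /same_level euv !eqxx av /=.
  by rewrite orbT.
split=> //.
have [iP|iP] := ltnP i (size P); last first.
  have [jQ|jQ] := ltnP j (size Q); last by rewrite ud // vd //; exact: winning_goal.
  have [av yv lv vn] := vQ j jQ.
  have [w0 _ _] := IH i j.+1 ltac:(lia).
  apply: winning_move w0; rewrite /= neq; last by right.
  have := top _ vn; rewrite -(ud i iP) => lt.
  have -> : first_moves (u i) (v j) 0 = false by rewrite /first_moves /same_level /=; lia.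
  rewrite /next_mode /admissible if_same !eqxx av /facing /same_level /=.
  by lia.
have [au xu lu un] := uP i iP.
have uv := neq i j (or_introl iP).
have [fc|nfc] := boolP (facing (u i) (v j)); last first.
  have [fm|nfm] := boolP (first_moves (u i) (v j) 0).
    have [w0 _ _] := IH i.+1 j ltac:(lia).
    apply: winning_move w0; rewrite /= uv fm.
    by rewrite /next_mode /admissible nfc au !eqxx if_same.
  have jQ : j < size Q.
    case: ltnP => // jQ; move: nfm; rewrite /first_moves (vd _ jQ) /=.
    by have := top _ un; lia.
  have [av yv lv vn] := vQ j jQ.
  have [w0 _ _] := IH i j.+1 ltac:(lia).
  apply: winning_move w0; rewrite /= uv (negPf nfm).
  by rewrite /next_mode /admissible nfc av !eqxx if_same.
move: (fc); rewrite /facing /same_level => /andP[/eqP luv xuv].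
have [uex|uin] := ltnP (level (u i)) (level (u i.+1)).
  by apply: (winning_commit (m := 2)) => //; apply: C2 => //; rewrite luv.
have jQ : j < size Q.
  by case: ltnP => // jQ; have := top _ un; rewrite luv vd // ltnn.
have [av yv lv vn] := vQ j jQ.
have [vex|vin] := ltnP (level (v j)) (level (v j.+1)).
  by apply: (winning_commit (m := 1)) => //; apply: C1 => //; lia.
have iP1 : i.+1 < size P.
  by case: ltnP => // iP1; move: uin; rewrite ud //; have := top _ un; lia.
have jQ1 : j.+1 < size Q.
  by case: ltnP => // jQ1; move: vin; rewrite vd //; have := top _ vn; lia.
have yv1 : Y (v j.+1) = (Y (v j)).+1.
  move: av; rewrite /pebble_arc => /orP[/andP[_ /eqP]|/andP[_ /eqP e]] //.
  by have [_ _ _] := vQ _ jQ1; rewrite e ltnn.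
have xuv' : X (u i) != X (v j.+1).
  by apply/eqP => xe; apply: (noX1 i j) => //; lia.
have lv1 : level (v j.+1) = level (v j) by lia.
have [w0 _ _] := IH i j.+1 ltac:(lia).
apply: winning_move w0; rewrite /= uv.
have -> : first_moves (u i) (v j) 0 = false.
  by rewrite /first_moves /same_level /=; lia.
rewrite /next_mode /admissible if_same !eqxx av fc /=.
by move: lv1 xuv xuv' yv1; rewrite /level; lia.
Qed.

End Complete.

End Pebbles.

(** * Crossings along antidiagonals exclude crossings along diagonals *)

(** The second coordinate for the reversed second path; the exit keeps its
    value. *)
Definition mirror (n : nat) (Y : nat -> nat) (v : nat) : nat :=
  if v < n then n.+1 - Y v else Y v.

Lemma lipschitz_along (E : rel nat) (Z : nat -> nat) x0 P :
  (forall u w, E u w -> (Z w <= (Z u).+1) && (Z u <= (Z w).+1)) ->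
  sorted E P -> forall a b, a < size P -> b < size P ->
  Z (nth x0 P b) <= Z (nth x0 P a) + (a - b) + (b - a).
Proof.
move=> ZE /(sortedP x0) sP.
have up a k : a + k < size P ->
    Z (nth x0 P (a + k)) <= Z (nth x0 P a) + k /\
    Z (nth x0 P a) <= Z (nth x0 P (a + k)) + k.
  elim: k => [|k IH]; first by rewrite !addn0.
  by rewrite !addnS => ak; have := ZE _ _ (sP _ ak); have := IH (ltnW ak); lia.
move=> a b aP bP; have [ab|ba] := leqP a b.
  by have := up a (b - a); rewrite subnKC // => /(_ bP); lia.
by have := up b (a - b); rewrite subnKC ?(ltnW ba) // => /(_ aP); lia.
Qed.

(** A crossing gives a meeting point that P leaves along an antidiagonal and one,
    not earlier on P, that P enters along an antidiagonal; in mirrored coordinates the same holds with diagonals.  Between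
    two meeting points P and Q are straight, because the points are equally far
    apart on both ([iso]), so a segment that P leaves downwards cannot contain a
    point that P leaves upwards. *)
Lemma crossing_exclusive n (E : rel nat) (X Y : nat -> nat) P Q :
  (forall u w, E u w -> (u < n) && (w < n)) ->
  (forall u w, E u w -> (X w <= (X u).+1) && (X u <= (X w).+1)) ->
  (forall u w, E u w -> (Y w <= (Y u).+1) && (Y u <= (Y w).+1)) ->
  (forall v, v < n -> Y v <= n) ->
  sorted E P -> sorted E Q ->
  (forall i, i < size P -> nth n P i < n /\ X (nth n P i) = i.+1) ->
  (forall j, j < size Q -> nth n Q j < n /\ Y (nth n Q j) = j.+1) ->
  crossing n X Y P Q -> crossing n X (mirror n Y) P (rev Q) -> False.
Proof.
move=> En XE YE Yn sP sQ XP YQ.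
have lf := lipschitz_along n YE sP.
have lg := lipschitz_along n XE sQ.
rewrite /crossing size_rev.
have mir v : v < n -> mirror n Y v = n.+1 - Y v by rewrite /mirror => ->.
have revE j : j < size Q -> nth n (rev Q) j = nth n Q (size Q - j.+1).
  by move=> jQ; rewrite nth_rev.
set F := nth n P in XP lf *; set G := nth n Q in YQ lg revE *.
clearbody F G.
have YF i : i < size P -> Y (F i) <= n by move=> /XP[] /Yn.
have YG i : i < size Q -> Y (G i) <= n by move=> /YQ[] /Yn.
have lvF i : i < size P -> level X Y (F i) = i.+1 + Y (F i).
  by move=> iP; rewrite /level; have [_ ->] := XP i iP.
have lvG i : i < size Q -> level X Y (G i) = X (G i) + i.+1.
  by move=> iP; rewrite /level; have [_ ->] := YQ i iP.
have lvF' i : i < size P -> level X (mirror n Y) (F i) = i.+1 + (n.+1 - Y (F i)).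
  by move=> iP; rewrite /level; have [? ->] := XP i iP; rewrite mir.
have lvG' i : i < size Q -> level X (mirror n Y) (G i) = X (G i) + (n.+1 - i.+1).
  by move=> iP; rewrite /level; have [? e] := YQ i iP; rewrite mir // e.
have XF i : i < size P -> X (F i) = i.+1 by case/XP.
have lf2 a b : a < size P -> b < size P ->
    Y (F b) <= Y (F a) + (a - b) + (b - a) /\ Y (F a) <= Y (F b) + (a - b) + (b - a).
  by move=> aP bP; have := lf a b aP bP; have := lf b a bP aP; lia.
have lg2 a b : a < size Q -> b < size Q ->
    X (G b) <= X (G a) + (a - b) + (b - a) /\ X (G a) <= X (G b) + (a - b) + (b - a).
  by move=> aP bP; have := lg a b aP bP; have := lg b a bP aP; lia.
have antiF a : a.+1 < size P -> level X Y (F a.+1) = level X Y (F a) ->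
    Y (F a) = (Y (F a.+1)).+1.
  by move=> aP; rewrite !lvF //; lia.
have diagF a : a.+1 < size P -> level X (mirror n Y) (F a.+1) = level X (mirror n Y) (F a) ->
    Y (F a.+1) = (Y (F a)).+1.
  by move=> aP; rewrite !lvF' //; [have := YF _ aP; have := YF a (ltnW aP); lia|lia].
have antiG a : a.+1 < size Q -> level X Y (G a.+1) = level X Y (G a) ->
    X (G a) = (X (G a.+1)).+1.
  by move=> aP; rewrite !lvG //; lia.
have diagG a : a.+1 < size Q -> level X (mirror n Y) (G a) = level X (mirror n Y) (G a.+1) ->
    X (G a.+1) = (X (G a)).+1.
  move=> aP; rewrite !lvG' //; last by lia.
  have := YG _ aP; have := YG a (ltnW aP); have [_ ->] := YQ _ aP.
  by have [_ ->] := YQ _ (ltnW aP); lia.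
have meet a b : a < size P -> b < size Q -> level X Y (F a) = level X Y (G b) ->
    X (F a) = X (G b) -> Y (F a) = b.+1 /\ X (G b) = a.+1.
  by move=> aP bQ; rewrite lvF // lvG // XF //; lia.
have meet' a b : a < size P -> b < size Q ->
    level X (mirror n Y) (F a) = level X (mirror n Y) (G b) ->
    X (F a) = X (G b) -> Y (F a) = b.+1 /\ X (G b) = a.+1.
  move=> aP bQ; rewrite lvF' // lvG' // XF //; have := YF _ aP; have := YG _ bQ.
  by have [_ ->] := YQ _ bQ; lia.
(* two meeting points are as far apart on P as on Q *)
have iso a b c d : a < size P -> c < size P -> b < size Q -> d < size Q ->
    Y (F a) = b.+1 -> X (G b) = a.+1 -> Y (F c) = d.+1 -> X (G d) = c.+1 ->
    Y (F a) + a = Y (F c) + c \/ Y (F a) + c = Y (F c) + a.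
  by move=> aP cP bQ dQ *; have := lf2 a c aP cP; have := lg2 b d bQ dQ; lia.
(* a and c are where P leaves downwards and upwards, a' + 1 and c' + 1 where it
   enters in these directions; the four points would have to coincide *)
have key a b a' b' c d c' d' :
    a.+1 < size P -> a'.+1 < size P -> c.+1 < size P -> c'.+1 < size P ->
    b < size Q -> b' < size Q -> d < size Q -> d' < size Q ->
    Y (F a) = b.+1 /\ X (G b) = a.+1 -> Y (F a'.+1) = b'.+1 /\ X (G b') = a'.+2 ->
    Y (F c) = d.+1 /\ X (G d) = c.+1 -> Y (F c'.+1) = d'.+1 /\ X (G d') = c'.+2 ->
    Y (F a) = (Y (F a.+1)).+1 -> Y (F a') = (Y (F a'.+1)).+1 ->
    Y (F c.+1) = (Y (F c)).+1 -> Y (F c'.+1) = (Y (F c')).+1 ->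
    a <= a'.+1 -> c <= c'.+1 -> False.
  move=> aP aP' cP cP' bQ bQ' dQ dQ' [a1 a2] [a1' a2'] [c1 c2] [c1' c2'] fa fa' fc fc' aa cc.
  have ca : c' < a.
    have := iso a b _ d' (ltnW aP) cP' bQ dQ' a1 a2 c1' c2'.
    have := lf2 a.+1 c'.+1 aP cP'; have := lf2 a c' (ltnW aP) (ltnW cP').
    clear -fa fc'; lia.
  have ac : a' < c.
    have := iso c d _ b' (ltnW cP) aP' dQ bQ' c1 c2 a1' a2'.
    have := lf2 c.+1 a'.+1 cP aP'; have := lf2 c a' (ltnW cP) (ltnW aP').
    clear -fc fa'; lia.
  have ea : a = c by lia.
  by subst c; lia.
case=> -[i [j [iP jQ h1 h2 [h3 h4]]]] -[] [i' [j' [iP' jQ']]].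
- rewrite !revE; [|lia|lia]; rewrite (_ : size Q - j'.+1 = (size Q - j'.+2).+1); last by lia.
  set k := size Q - j'.+2; have kQ : k.+1 < size Q by lia.
  move=> k1 k2 [k3 k4]; clearbody k.
  have fi := antiF i iP h1; have gj := antiG j jQ h2.
  have fi' := diagF i' iP' k1; have gk := diagG k kQ k2.
  have m1 : Y (F i) = j.+2 /\ X (G j.+1) = i.+1.
    by apply: (meet i j.+1) => //; [lia|rewrite h2].
  have m2 : Y (F i.+1) = j.+1 /\ X (G j) = i.+2.
    by case: m1; rewrite gj; lia.
  have m3 : Y (F i') = k.+1 /\ X (G k) = i'.+1.
    by apply: (meet' i' k) => //; [lia|lia|rewrite k2].
  have m4 : Y (F i'.+1) = k.+2 /\ X (G k.+1) = i'.+2.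
    by case: m3; rewrite gk; lia.
  by apply: (key i j.+1 i j i' k i' k.+1) => //; lia.
- rewrite !revE; [|lia].
  set k := size Q - j'.+1; have kQ : k < size Q by lia.
  move=> k1 k2 [k3 k4]; clearbody k.
  have fi := antiF i iP h1; have gj := antiG j jQ h2.
  have fi' := diagF i' (ltnW iP') k1; have fi2 := diagF i'.+1 iP' k2.
  have m1 : Y (F i) = j.+2 /\ X (G j.+1) = i.+1.
    by apply: (meet i j.+1) => //; [lia|rewrite h2].
  have m2 : Y (F i.+1) = j.+1 /\ X (G j) = i.+2.
    by case: m1; rewrite gj; lia.
  have m3 : Y (F i'.+1) = k.+1 /\ X (G k) = i'.+2 by apply: meet' => //; lia.
  by apply: (key i j.+1 i j i'.+1 k i' k) => //; lia.
- rewrite !revE; [|lia|lia]; rewrite (_ : size Q - j'.+1 = (size Q - j'.+2).+1); last by lia.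
  set k := size Q - j'.+2; have kQ : k.+1 < size Q by lia.
  move=> k1 k2 [k3 k4]; clearbody k.
  have fi := antiF i (ltnW iP) h1; have fi2 := antiF i.+1 iP h2.
  have fi' := diagF i' iP' k1; have gk := diagG k kQ k2.
  have m1 : Y (F i.+1) = j.+1 /\ X (G j) = i.+2 by apply: meet => //; lia.
  have m3 : Y (F i') = k.+1 /\ X (G k) = i'.+1.
    by apply: (meet' i' k) => //; [lia|lia|rewrite k2].
  have m4 : Y (F i'.+1) = k.+2 /\ X (G k.+1) = i'.+2.
    by case: m3; rewrite gk; lia.
  by apply: (key i.+1 j i j i' k i' k.+1) => //; lia.
- rewrite !revE; [|lia].
  set k := size Q - j'.+1; have kQ : k < size Q by lia.
  move=> k1 k2 [k3 k4]; clearbody k.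
  have fi := antiF i (ltnW iP) h1; have fi2 := antiF i.+1 iP h2.
  have fi' := diagF i' (ltnW iP') k1; have fi2' := diagF i'.+1 iP' k2.
  have m1 : Y (F i.+1) = j.+1 /\ X (G j) = i.+2 by apply: meet => //; lia.
  have m3 : Y (F i'.+1) = k.+1 /\ X (G k) = i'.+2 by apply: meet' => //; lia.
  by apply: (key i.+1 j i j i'.+1 k i' k) => //; lia.
Qed.

(** * Layering the graph by distance *)

(** The arrays of adjacency lists read as a graph on the numbers below n.  The
    list of the exit n is empty, because the cell after the last offset is 0. *)
Record csr (n : nat) (E : rel nat) (off nbr : nat -> nat) : Prop := Csr {
  csr_lt : forall u w, E u w -> (u < n) && (w < n);
  csr_sym : forall u w, E u w -> E w u;
  csr_mem : forall u w, u < n ->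
    (E u w <-> exists2 k, off u <= k < off u.+1 & nbr k = w);
  csr_end : off n.+1 = 0 }.

Definition graph_at (n : nat) (off nbr : nat -> nat) (st : state) : Prop :=
  [/\ vars st 3 = n, vars st 4 = n.+1, arrs st 0 =1 off & arrs st 1 =1 nbr].

(** The result of a breadth-first search from s: d is the distance plus one, so
    that 0 can mean unvisited, and o enumerates the vertices by distance. *)
Record layering (n : nat) (E : rel nat) (s : nat) (d o : nat -> nat) : Prop :=
  Layering {
  lay_src : d s = 1;
  lay_pos : forall u, u < n -> 0 < d u <= n;
  lay_edge : forall u w, E u w -> d w <= (d u).+1;
  lay_path : forall w, w < n ->
    exists p, [/\ path E s p, last s p = w & (size p).+1 = d w];
  lay_bot : d n = n + n + 2;
  lay_obot : o n = n;
  lay_perm : perm_eq (mkseq o n) (iota 0 n);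
  lay_sorted : sorted leq (map d (mkseq o n)) }.

(** Variables of the search: 5 the source, 6 the current distance, 7 the vertex,
    8 and 9 the position in and the end of its list, 10 the number of vertices
    enumerated so far. *)
Definition bfs_relax (D : nat) : cmd :=
  If (Eqn (Get D (Get 1 (Var 8))) (Const 0))
     (Store D (Get 1 (Var 8)) (Add (Var 6) (Const 1)))
     Skip.

Definition bfs_visit (D O : nat) : cmd :=
  If (Eqn (Get D (Var 7)) (Var 6))
    (Seq (Store O (Var 10) (Var 7)) (
     Seq (Assign 10 (Add (Var 10) (Const 1))) (
     Seq (Assign 9 (Get 0 (Add (Var 7) (Const 1))))
         (For 8 (Get 0 (Var 7)) (Var 9) (bfs_relax D)))))
    Skip.

(** In round r all vertices are scanned for those with d = r.  A queue would save
    the n scans, but their cost O(n^2) is within the budget, and the rounds produce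
    the enumeration by distance as well. *)
Definition bfs (D O : nat) : cmd :=
  Seq (Store D (Var 5) (Const 1)) (
  Seq (Assign 10 (Const 0)) (
  Seq (For 6 (Const 1) (Var 4) (For 7 (Const 0) (Var 3) (bfs_visit D O))) (
  Seq (Store D (Var 3) (Add (Add (Var 3) (Var 3)) (Const 2)))
      (Store O (Var 3) (Var 3))))).

Lemma sum_affine l h a b c (F : nat -> nat) :
  \sum_(l <= k < h) (a + b * F k + c) =
  (h - l) * (a + c) + b * \sum_(l <= k < h) F k.
Proof.
by rewrite !big_split /= !sum_nat_const_nat big_distrr /= mulnDr addnAC.
Qed.

Section Bfs.

Variables (B n : nat) (E : rel nat) (off nbr : nat -> nat).
Hypothesis Bn : 9 * (n.+1 * n.+1) + 100 <= B.
Hypothesis G : csr n E off nbr.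

Let B100 : 100 <= B. Proof. by lia. Qed.

(** The vertices whose lists have been read before vertex u is looked at in round
    r. *)
Definition expanded (d : nat -> nat) (r u z : nat) : bool :=
  (0 < d z) && ((d z < r) || ((d z == r) && (z < u))).

Record bfs_inv (s : nat) (d o : nat -> nat) (r u c : nat) : Prop := BfsInv {
  bi_src : d s = 1;
  bi_le : forall w, w < n -> d w <= r.+1;
  bi_path : forall w, w < n -> 0 < d w ->
    exists p, [/\ path E s p, last s p = w & (size p).+1 = d w];
  bi_edge : forall z w, expanded d r u z -> E z w -> 0 < d w <= (d z).+1;
  bi_uniq : uniq (mkseq o c);
  bi_mem : forall z, (z \in mkseq o c) = (z < n) && expanded d r u z;
  bi_sorted : sorted leq (map d (mkseq o c)) }.

Lemma bfs_inv_ext s d o d' o' r u c : s < n ->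
  (forall z, z < n -> d z = d' z) -> (forall i, i < c -> o i = o' i) ->
  bfs_inv s d o r u c -> bfs_inv s d' o' r u c.
Proof.
move=> sn ed eo [i1 i2 i3 i4 i5 i6 i7].
have eq_o : mkseq o c = mkseq o' c.
  by apply/eq_in_map => i; rewrite mem_iota => /andP[_]; apply: eo.
have exE z : z < n -> expanded d' r u z = expanded d r u z.
  by move=> zn; rewrite /expanded ed.
split; rewrite -?eq_o //.
- by rewrite -ed.
- by move=> w wn; rewrite -ed //; apply: i2.
- by move=> w wn; rewrite -ed //; apply: i3.
- move=> z w + e; have /andP[zn wn] := csr_lt G e.
  by rewrite exE // -!ed // => ex; apply: i4.
- by move=> z; rewrite i6; case: ltnP => //= /exE ->.
- rewrite -(_ : map d (mkseq o c) = map d' (mkseq o c)) //.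
  by apply/eq_in_map => z; rewrite i6 => /andP[/ed].
Qed.

Lemma bfs_inv_next_round s d o r c : bfs_inv s d o r n c ->
  bfs_inv s d o r.+1 0 c.
Proof.
case=> i1 i2 i3 i4 i5 i6 i7.
have exE z : z < n -> expanded d r.+1 0 z = expanded d r n z.
  by move=> zn; rewrite /expanded zn; lia.
split=> //.
- by move=> w /i2; lia.
- by move=> z w ex e; apply: (i4 z w) => //; rewrite -exE //; case/andP: (csr_lt G e).
- by move=> z; rewrite i6; case: (ltnP z n) => //= /exE ->.
Qed.

Lemma bfs_inv_skip s d o r u c : d u <> r -> bfs_inv s d o r u c ->
  bfs_inv s d o r u.+1 c.
Proof.
move=> du [i1 i2 i3 i4 i5 i6 i7].
have exE z : expanded d r u.+1 z = expanded d r u z.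
  rewrite /expanded; have [->|zu] := eqVneq z u; last by lia.
  by move/eqP: du => /negPf->.
by split=> // z; [move=> w|]; rewrite exE; [apply: i4|apply: i6].
Qed.

Lemma bfs_inv_expand s d o r u c d' : 0 < r -> u < n -> d u = r ->
  bfs_inv s d o r u c -> o c = u ->
  (forall w, w < n -> d' w = d w \/ [/\ d w = 0, d' w = r.+1 & E u w]) ->
  (forall w, E u w -> d' w <> 0) -> s < n ->
  bfs_inv s d' o r u.+1 c.+1.
Proof.
move=> r0 un du [i1 i2 i3 i4 i5 i6 i7] oc ch nz sn.
have exE z : z < n -> expanded d' r u.+1 z = (z == u) || expanded d r u z.
  move=> zn; rewrite /expanded; case: (ch z zn) => [->|[d0 ->]]; last first.
    by have -> : (z == u) = false; [apply/eqP => ?; subst; lia|rewrite d0; lia].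
  by case: (z =P u) => [->|/eqP] ; [rewrite du|]; lia.
have keep z : z < n -> 0 < d z -> d' z = d z by move=> /ch[|[-> ]].
split.
- by rewrite keep // i1.
- by move=> w wn; case: (ch w wn) => [->|[_ -> _]//]; apply: i2.
- move=> w wn; case: (ch w wn) => [->|[d0 -> e _]]; first exact: i3.
  have [p [pp lp sp]] := i3 u un ltac:(lia).
  exists (rcons p w); split; first by rewrite rcons_path pp lp.
    by rewrite last_rcons.
  by rewrite size_rcons sp du.
- move=> z w ex e; have /andP[zn wn] := csr_lt G e.
  move: ex; rewrite exE //; case/orP=> [/eqP ezu|ex]; last first.
    have /andP[d0 _] := ex; have /andP[w0 wz] := i4 z w ex e.
    by rewrite !keep // w0 wz.
  subst z; have dn := nz w e; rewrite (keep u un) ?du //.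
  by case: (ch w wn) => [e'|[_ -> _]]; have := i2 w wn; lia.
- rewrite /mkseq -addn1 iotaD map_cat cat_uniq -/(mkseq o c) i5 /= oc orbF andbT.
  by rewrite i6 /expanded du ltnn; lia.
- move=> z; rewrite /mkseq -addn1 iotaD map_cat mem_cat -/(mkseq o c) /= oc i6 inE.
  have [zn|zn] := ltnP z n; last by apply/negbTE; lia.
  by rewrite exE // orbC.
- have -> : map d' (mkseq o c.+1) = rcons (map d (mkseq o c)) r.
    rewrite /mkseq -addn1 iotaD !map_cat -cats1; congr (_ ++ _); last first.
      by rewrite /= oc keep ?du.
    apply/eq_in_map => z; rewrite -/(mkseq o c) i6 => /andP[zn /andP[d0 _]].
    exact: keep.
  have le z : z \in map d (mkseq o c) -> z <= r.
    case/mapP=> y; rewrite i6 => /andP[_ /andP[_]] + ->; lia.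
  case em: (map d (mkseq o c)) i7 le => [|x l] //= i7 le.
  by rewrite rcons_path i7 /=; apply: le; rewrite mem_last.
Qed.

Lemma bfs_count s d o r u c : bfs_inv s d o r u c -> c <= n.
Proof.
move=> [_ _ _ _ uq mem _].
have := @uniq_leq_size _ (mkseq o c) (iota 0 n) uq.
rewrite size_mkseq size_iota; apply=> z; rewrite mem => /andP[zn _].
by rewrite mem_iota.
Qed.

(** The label of a vertex is at most one more than the length of any path to it.
    As there is a path without repetitions, all labels are at most n after n
    rounds, so every vertex has been expanded. *)
Lemma bfs_layering s d o c : s < n ->
  (forall w, w < n -> exists2 p, path E s p & last s p = w) ->
  bfs_inv s d o n.+1 0 c -> d n = n + n + 2 -> o n = n ->
  layering n E s d o /\ c = n.
Proof.
move=> sn conn inv dn on; have cn := bfs_count inv.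
case: inv => i1 i2 i3 i4 i5 i6 i7.
have near p : path E s p -> (size p).+1 <= n ->
    0 < d (last s p) <= (size p).+1.
  elim/last_ind: p => [|p w IH]; first by rewrite /= i1.
  rewrite rcons_path size_rcons last_rcons => /andP[pp e] sp.
  have /andP[d0 dp] := IH pp (ltnW sp).
  have ex : expanded d n.+1 0 (last s p) by rewrite /expanded; lia.
  by have := i4 _ w ex e; lia.
have pos w : w < n -> 0 < d w <= n.
  move=> wn; have [p0 pp0 lp0] := conn w wn.
  case: (shortenP pp0) lp0 => p pp up _ lp.
  have sp : (size p).+1 <= n.
    have := @uniq_leq_size _ (s :: p) (iota 0 n) up.
    rewrite /= size_iota; apply=> z; rewrite mem_iota /= inE => /orP[/eqP->//|zp].
    elim: p s zp pp {up lp near i1 i3 sn conn pp0} => //= a p IH x.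
    rewrite inE => /orP[/eqP->|zp] /andP[e pp]; last exact: IH zp pp.
    by case/andP: (csr_lt G e).
  by have /andP[d0 dp] := near p pp sp; rewrite -lp d0 (leq_trans dp sp).
have mem z : (z \in mkseq o c) = (z < n).
  by rewrite i6 /expanded; case: ltnP => //= /pos; lia.
have perm : perm_eq (mkseq o c) (iota 0 n).
  by apply: uniq_perm => // [|z]; [exact: iota_uniq|rewrite mem mem_iota].
have ec : c = n by have := perm_size perm; rewrite size_mkseq size_iota.
split=> //; subst c; split=> //.
- move=> u w e; have /andP[un wn] := csr_lt G e.
  have ex : expanded d n.+1 0 u by rewrite /expanded; have := pos u un; lia.
  by have := i4 _ w ex e; lia.
- by move=> w wn; apply: i3 => //; have := pos w wn; lia.
Qed.

Lemma graph_agree xs bs st st' : agree xs bs st st' ->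
  3 \notin xs -> 4 \notin xs -> 0 \notin bs -> 1 \notin bs ->
  graph_at n off nbr st -> graph_at n off nbr st'.
Proof.
move=> [av aa] x3 x4 b0 b1 [g1 g2 g3 g4]; split; rewrite ?av //.
  by move=> i; rewrite aa.
by move=> i; rewrite aa.
Qed.

Definition degree u := off u.+1 - off u.
Definition volume := \sum_(0 <= u < n) degree u.

Lemma run_bfs_visit D O s r u st : 1 < D -> 1 < O -> D != O -> s < n ->
  bounded B st -> graph_at n off nbr st -> 0 < r < n.+1 -> u < n ->
  vars st 6 = r -> vars st 7 = u ->
  bfs_inv s (arrs st D) (arrs st O) r u (vars st 10) ->
  run B (100 + 50 * degree u) (bfs_visit D O) st (fun st' =>
    bfs_inv s (arrs st' D) (arrs st' O) r u.+1 (vars st' 10)).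
Proof.
move=> D1 O1 DO sn bnd gr r0 un er eu inv; have cn := bfs_count inv.
have [nDO nOD] : (D == O) = false /\ (O == D) = false.
  by split; apply/negbTE; rewrite // eq_sym.
have notin : (0 \notin [:: O; D]) && (1 \notin [:: O; D]).
  by rewrite !inE; lia.
apply: run_test => //= [|]; rewrite er eu.
- rewrite eqb0 negbK => /eqP du.
  have [v3 v4 a0 a1] := gr.
  apply: (run_store_cons B100) => //= [|]; first by rewrite eu; lia.
  rewrite eu => bnd1.
  apply: (run_assign_cons B100) => //= [|]; first by lia.
  move=> bnd2.
  apply: (run_assign_cons B100) => //; [exact: (proj2 bnd2)|].
  move=> bnd3; set st3 := set_var _ 9 _ in bnd3 *.
  have gr3 : graph_at n off nbr st3.
    split=> //= i; first by rewrite (_ : (0 == O) = false) ?a0 //; lia.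
    by rewrite (_ : (1 == O) = false) ?a1 //; lia.
  have [_ _ b0 b1] := gr3.
  have d3 j : arrs st3 D j = arrs st D j by rewrite /= nDO.
  have o3 j : arrs st3 O j = if j == vars st 10 then u else arrs st O j.
    by rewrite /= eqxx.
  have e3 : [/\ vars st3 6 = r, vars st3 7 = u, vars st3 9 = off u.+1 &
      vars st3 10 = (vars st 10).+1].
    split=> //=; last by rewrite addn1.
    by rewrite (_ : (0 == O) = false) /= ?a0 ?eu ?addn1 //; lia.
  clearbody st3; case: e3 => e6 e7 e9 e10.
  have offB w : off w < B by rewrite -b0; apply: (proj2 bnd3).
  apply: (run_for B100 (l := off u) (h := off u.+1) (f := fun _ => 20)
    (Inv := fun k st' => (forall w, w < n -> arrs st' D w = arrs st D w \/
       [/\ arrs st D w = 0, arrs st' D w = r.+1 & E u w]) /\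
       (forall j, off u <= j < k -> arrs st' D (nbr j) <> 0))) => //.
  + by rewrite /= e7 b0.
  + by move=> st' [ag _] /=; rewrite ag // e9.
  + by split=> [w _|j]; [left; rewrite /= d3|lia].
  + move=> k st4 uk bnd4 ag4 ek [ch nz].
    have [w6 _ _ w1] : [/\ vars st4 6 = r, True, True & arrs st4 1 =1 nbr].
      split=> //; first by case: (ag4) => ->.
      by move=> i; case: ag4 => _ -> //; rewrite /= inE; lia.
    have eE : E u (nbr k) by apply/(csr_mem G _ un); exists k.
    have /andP[_ wn] := csr_lt G eE.
    apply: run_test => //= [|]; rewrite ek w1.
      rewrite eqb0 negbK => /eqP dw.
      apply: (run_store B100) => //=; first by rewrite w6; lia.
      rewrite ek w1 w6 addn1; split=> [w wn'|j jk].
        rewrite eqxx /=; case: eqP => [->|_]; last exact: ch.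
        by right; split=> //; case: (ch _ wn) => [<-|[]] //.
      rewrite eqxx /=; case: eqP => // ne; apply: nz.
      by have [?|?] := eqVneq j k; [subst|lia].
    move/eqP; rewrite eqb0 => /eqP dw; apply: run_skip => //; split=> // j jk.
    by have [->|?] := eqVneq j k; [|apply: nz; lia].
  + by rewrite sum_nat_const_nat /degree /=; lia.
  + move=> k st4 bnd4 ag4 ek _ [ch nz].
    have -> : vars st4 10 = (vars st 10).+1 by case: (ag4) => ->.
    apply: (bfs_inv_expand (d := arrs st D)) => //; [by lia| | |].
    * apply: bfs_inv_ext inv => // i ic.
      case: (ag4) => _ ->; last first.
        by rewrite /= inE; lia.
      by rewrite o3 ltn_eqF.
    * by case: (ag4) => _ ->; rewrite ?o3 ?eqxx //= inE; lia.
    * move=> w e; have [j jk <-] := proj1 (csr_mem G w un) e.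
      by apply: nz; lia.
- move/eqP; rewrite eqb0 => /eqP du.
  by apply: run_skip => //; apply: bfs_inv_skip.
Qed.

Lemma bfs_correct D O s st : 1 < D -> 1 < O -> D != O -> s < n ->
  (forall w, w < n -> exists2 p, path E s p & last s p = w) ->
  bounded B st -> graph_at n off nbr st -> vars st 5 = s ->
  (forall i, i < n -> arrs st D i = 0) ->
  run B (400 * (n * (n + volume) + 1)) (bfs D O) st
    (fun st' => layering n E s (arrs st' D) (arrs st' O)).
Proof.
move=> D1 O1 DO sn conn bnd gr es D0.
have [nDO nOD] : (D == O) = false /\ (O == D) = false.
  by split; apply/negbTE; rewrite // eq_sym.
have n0 : 0 < n by lia.
have [NV eNV] : exists NV, NV = n * (n + volume) by eexists.
rewrite -eNV.
have notin0 : 0 \notin [:: O; D] by rewrite !inE; lia.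
have notin1 : 1 \notin [:: O; D] by rewrite !inE; lia.
apply: (run_store_cons B100) => //; [by rewrite /=; lia|by rewrite /=; lia|].
move=> bnd1; apply: (run_assign_cons B100) => //; [by rewrite /=; lia|by rewrite /=; lia|].
move=> bnd2.
set st2 := set_var _ _ _ in bnd2 *.
have gr2 : graph_at n off nbr st2.
  case: gr => g1 g2 g3 g4; split=> // i /=.
    by rewrite (_ : (0 == D) = false) ?g3 //; lia.
  by rewrite (_ : (1 == D) = false) ?g4 //; lia.
have ex0 d z : expanded d 1 0 z = false by rewrite /expanded; lia.
have inv2 : bfs_inv s (arrs st2 D) (arrs st2 O) 1 0 (vars st2 10).
  rewrite /st2 /= es eqxx; split=> //.
  - by rewrite eqxx.
  - by move=> w wn; case: eqP => // _; rewrite D0.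
  - move=> w wn; case: eqP => [->|_]; last by rewrite D0.
    by exists [::].
  - by move=> z w; rewrite ex0.
  - by move=> z; rewrite ex0 andbF.
pose K1 := 300 * (NV + 1).
apply: (@run_cons _ _ K1 _ _ _ (fun st' =>
    bfs_inv s (arrs st' D) (arrs st' O) n.+1 0 (vars st' 10))); last first.
- move=> st3 bnd3 ag3 inv3.
  have gr3 : graph_at n off nbr st3.
    by apply: graph_agree ag3 _ _ _ _ gr2.
  have [v3 v4 _ _] := gr3.
  apply: (run_store_cons B100) => //; [by rewrite /K1 /=; lia|by rewrite /= v3; lia|].
  move=> bnd4; apply: (run_store B100) => //; [by rewrite /K1 /=; lia|by rewrite /= v3; lia|].
  rewrite /= v3 !eqxx nDO nOD /=.
  apply: (proj1 (bfs_layering (c := vars st3 10) sn conn _ _ _)); rewrite ?eqxx //.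
  have cn := bfs_count inv3.
  apply: bfs_inv_ext inv3 => // i ic; rewrite ltn_eqF //; lia.
- by rewrite /K1 /=; lia.
- apply: (run_for B100 (l := 1) (h := n.+1) (f := fun _ => 50 + 60 * volume + 120 * n)
    (Inv := fun r st => bfs_inv s (arrs st D) (arrs st O) r 0 (vars st 10))) => //.
  + by lia.
  + by lia.
  + by move=> st' ag /=; have [_ -> _ _] := graph_agree ag isT isT notin0 notin1 gr2.
  + move=> r st3 rn bnd3 ag3 er inv3.
    have gr3 := graph_agree ag3 isT isT notin0 notin1 gr2.
    apply: (run_for B100 (l := 0) (h := n) (f := fun u => 100 + 50 * degree u)
      (Inv := fun u st => bfs_inv s (arrs st D) (arrs st O) r u (vars st 10))) => //.
    * by lia.
    * by lia.
    * by move=> st' ag /=; have [-> _ _ _] := graph_agree ag isT isT notin0 notin1 gr3.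
    * move=> u st4 un bnd4 ag4 eu inv4 /=.
      have gr4 := graph_agree ag4 isT isT notin0 notin1 gr3.
      by apply: run_bfs_visit => //; case: (ag4) => -> .
    * by rewrite sum_affine -/volume; lia.
    * move=> k st4 _ _; rewrite max0n => -> _ /bfs_inv_next_round; exact.
  + rewrite sum_nat_const_nat /K1 eNV; nia.
  + by move=> k st' _ _ -> _; rewrite (maxn_idPr _).
Qed.

End Bfs.

(** * Deciding one configuration of the game *)

(** Registers: 3 and 4 hold n and n + 1; 7, 15 and 16 the configuration (u, v, m)
    and 22 its code; 23 and 24 the targets; 17 the table entry under construction;
    18 whether the first pebble moves, 19 the vertex of the mover, 25 its target;
    26 whether the pebbles face each other, 27 whether they are on one level, 29
    the next mode; 11 the vertex w tried by the mover, 28 whether the move is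
    possible, 30 the code of the new configuration.

    Arrays: 6 and 8 the coordinates X and Y; 7 and 9 the vertices sorted by them;
    10 the table, with 0 for lost and the code of the next configuration plus one
    for won; 11 and 12 the vertices of a code, since the machine cannot divide. *)
Definition lev (w : expr) : expr := Add (Get 6 w) (Get 8 w).

Definition code_expr (m u v : expr) : expr :=
  Add (Mul (Add (Mul m (Var 4)) u) (Var 4)) v.

Definition test_admissible : cmd :=
  If (Eqn (Var 16) (Const 0))
    (Assign 28 (Add (Defs.Sub (Const 1) (Var 26))
       (Mul (Eqn (lev (Var 11)) (lev (Var 19)))
            (Ltn (Get 6 (Var 7)) (Get 6 (Var 11))))))
  (If (Eqn (Var 16) (Const 1))
    (Assign 28 (Add (Ltn (lev (Var 19)) (lev (Var 11)))
       (Mul (Var 27) (Defs.Sub (Const 1) (Ltn (Get 6 (Var 15)) (Get 6 (Var 11)))))))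
    (Assign 28 (Add (Ltn (lev (Var 19)) (lev (Var 11))) (Var 27)))).

Definition look_up : cmd :=
  Seq (If (Var 18) (Seq (Assign 20 (Var 11)) (Assign 21 (Var 15)))
                   (Seq (Assign 20 (Var 7)) (Assign 21 (Var 11)))) (
  Seq (Assign 30 (code_expr (Var 29) (Var 20) (Var 21)))
      (If (Get 10 (Var 30)) (Assign 17 (Add (Var 30) (Const 1))) Skip)).

Definition candidate : cmd :=
  Seq (If (Var 28) test_admissible Skip) (If (Var 28) look_up Skip).

Definition neighbour_candidate : cmd :=
  Seq (Assign 11 (Get 1 (Var 8))) (
  Seq (If (Var 18)
        (Assign 28 (Eqn (Get 6 (Var 11)) (Add (Get 6 (Var 19)) (Const 1))))
        (Assign 28 (Eqn (Get 8 (Var 11)) (Add (Get 8 (Var 19)) (Const 1)))))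
      candidate).

Definition exit_candidate : cmd :=
  Seq (Assign 11 (Var 3)) (Seq (Assign 28 (Const 1)) candidate).

Definition choose_mover : cmd :=
  Seq (Assign 27 (Eqn (lev (Var 7)) (lev (Var 15)))) (
  Seq (Assign 26 (Mul (Var 27) (Ltn (Get 6 (Var 7)) (Get 6 (Var 15))))) (
  Seq (Assign 29 (Mul (Var 27) (Var 16))) (
  Seq (If (Eqn (Var 16) (Const 0))
        (Assign 18 (Add (Ltn (lev (Var 7)) (lev (Var 15)))
                        (Defs.Sub (Var 27) (Var 26))))
        (If (Eqn (Var 16) (Const 1)) (Assign 18 (Var 27))
            (Assign 18 (Defs.Sub (Const 1) (Var 27))))) (
      If (Var 18) (Seq (Assign 19 (Var 7)) (Assign 25 (Var 23)))
                  (Seq (Assign 19 (Var 15)) (Assign 25 (Var 24))))))).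

Definition try_commit : cmd :=
  If (Mul (Var 26) (Eqn (Var 16) (Const 0)))
    (Seq (Assign 17 (Get 10 (Add (Var 22) (Mul (Var 4) (Var 4)))))
      (If (Var 17) Skip
        (Assign 17 (Get 10 (Add (Var 22) (Mul (Const 2) (Mul (Var 4) (Var 4))))))))
    Skip.

Definition cell_search : cmd :=
  Seq (Assign 17 (Const 0)) (
  Seq choose_mover (
  Seq try_commit (
  Seq (Assign 9 (Get 0 (Add (Var 19) (Const 1)))) (
  Seq (For 8 (Get 0 (Var 19)) (Var 9) neighbour_candidate)
      (If (Eqn (Var 19) (Var 25)) exit_candidate Skip))))).

Definition cell : cmd :=
  Seq (Assign 22 (code_expr (Var 16) (Var 7) (Var 15))) (
  Seq (If (Eqn (Var 7) (Var 15))
        (Assign 17 (Mul (Eqn (Var 7) (Var 3)) (Eqn (Var 16) (Const 0))))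
        cell_search) (
  Seq (Store 10 (Var 22) (Var 17)) (
  Seq (Store 11 (Var 22) (Var 7))
      (Store 12 (Var 22) (Var 15))))).

Section Table.

Variables (B n : nat) (E : rel nat) (off nbr x y : nat -> nat) (t1 t2 : nat).
Hypothesis Bn : 9 * (n.+1 * n.+1) + 100 <= B.

Let B100 : 100 <= B. Proof. by lia. Qed.

Let guard_free_lt (a b c : bool) : 1 - a + b * c < B.
Proof. by case: a; case: b; case: c => /=; lia. Qed.

Let guard_second_lt (a b c : bool) : a + b * (1 - c) < B.
Proof. by case: a; case: b; case: c => /=; lia. Qed.

Let guard_first_lt (a b : bool) : a + b < B.
Proof. by case: a; case: b => /=; lia. Qed.

Let guard_freeE (a b c : bool) : (1 - a + b * c != 0) = ~~ a || b && c.
Proof. by case: a; case: b; case: c. Qed.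

Let guard_secondE (a b c : bool) : (a + b * (1 - c) != 0) = a || b && ~~ c.
Proof. by case: a; case: b; case: c. Qed.

Let guard_firstE (a b : bool) : (a + b != 0) = a || b.
Proof. by case: a; case: b. Qed.

Definition code (s : config) : nat := (s.2 * n.+1 + s.1.1) * n.+1 + s.1.2.

Definition config_ok (s : config) : bool :=
  [&& s.1.1 <= n, s.1.2 <= n & s.2 <= 2].

Lemma code_inj s s' : config_ok s -> config_ok s' -> code s = code s' -> s = s'.
Proof.
case: s s' => [[u v] m] [[u' v'] m'] /and3P[/= un vn mn] /and3P[/= un' vn' mn'].
rewrite /code /= => e.
have ev' : v = v'.
  by move: (congr1 (modn^~ n.+1) e); rewrite !modnMDl !modn_small.
have eu' : m * n.+1 + u = m' * n.+1 + u'.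
  by move: (congr1 (divn^~ n.+1) e); rewrite !divnMDl // !divn_small // !addn0.
have eu : u = u'.
  by move: (congr1 (modn^~ n.+1) eu'); rewrite !modnMDl !modn_small.
have em : m = m'.
  by move: (congr1 (divn^~ n.+1) eu'); rewrite !divnMDl // !divn_small // !addn0.
by subst.
Qed.

Lemma code_bound s : config_ok s -> code s < 3 * (n.+1 * n.+1).
Proof. by case: s => [[u v] m] /and3P[/= un vn mn]; rewrite /code /=; nia. Qed.

Lemma code_lt s : config_ok s -> (code s).+2 < B.
Proof.
move/code_bound; move: Bn; set M := n.+1 * n.+1; clearbody M; lia.
Qed.

Hypothesis G : csr n E off nbr.
Hypothesis t1n : t1 < n.
Hypothesis t2n : t2 < n.

Definition env (st : state) : Prop :=
  [/\ graph_at n off nbr st, vars st 23 = t1, vars st 24 = t2,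
      arrs st 6 =1 x & arrs st 8 =1 y].

Lemma env_agree xs bs st st' : agree xs bs st st' ->
  all (fun z => z \notin xs) [:: 3; 4; 23; 24] ->
  all (fun b => b \notin bs) [:: 0; 1; 6; 8] -> env st -> env st'.
Proof.
move=> ag /= /and5P[x3 x4 x23 x24 _] /and5P[b0 b1 b6 b8 _] [g v23 v24 a6 a8].
split; first exact: graph_agree ag _ _ _ _ g.
- by case: ag => -> .
- by case: ag => -> .
- by move=> i; case: ag => _ ->.
- by move=> i; case: ag => _ ->.
Qed.

Notation Level := (level x y).
Notation Same := (same_level x y).
Notation Facing := (facing x y).
Notation First := (first_moves x y).
Notation Adm := (admissible x y).
Notation Next := (next_mode x y).
Notation Move := (pebble_move n E x y t1 t2).
Notation Step := (pebble_step n E x y t1 t2).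

Definition mover (u v m : nat) : nat := if First u v m then u else v.

Definition target (u v m w : nat) : config :=
  if First u v m then (w, v, Next u v m) else (u, w, Next u v m).

Definition cell_at (u v m : nat) (st : state) : Prop :=
  [/\ vars st 7 = u, vars st 15 = v, vars st 16 = m & vars st 22 = code (u, v, m)].

Definition mover_at (u v m : nat) (st : state) : Prop :=
  [/\ vars st 18 = First u v m, vars st 19 = mover u v m,
      vars st 26 = Facing u v, vars st 27 = Same u v & vars st 29 = Next u v m].

Lemma cell_at_agree xs bs u v m st st' : agree xs bs st st' ->
  all (fun z => z \notin xs) [:: 7; 15; 16; 22] -> cell_at u v m st -> cell_at u v m st'.
Proof.
move=> [ag _] /= /and5P[x7 x15 x16 x22 _] [? ? ? ?].
by split; rewrite ag.
Qed.

Lemma mover_at_agree xs bs u v m st st' : agree xs bs st st' ->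
  all (fun z => z \notin xs) [:: 18; 19; 26; 27; 29] ->
  mover_at u v m st -> mover_at u v m st'.
Proof.
move=> [ag _] /= /and5P[x18 x19 x26 x27 /andP[x29 _]] [? ? ? ? ?].
by split; rewrite ag.
Qed.

Lemma run_test_admissible u v m w st : bounded B st -> env st ->
  cell_at u v m st -> mover_at u v m st -> vars st 11 = w -> m <= 2 ->
  run B 60 test_admissible st (fun st' =>
    (vars st' 28 != 0) = Adm u v m (mover u v m) w).
Proof.
move=> bnd [gr v23 v24 a6 a8] [e7 e15 e16 e22] [e18 e19 e26 e27 e29] e11 m2.
apply: run_test => //= [|]; rewrite e16.
  rewrite eqb0 negbK => /eqP em; subst m.
  apply: (run_assign B100) => //=; rewrite e26 e7 e11 e19 !a6 !a8.
    exact: guard_free_lt.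
  rewrite em /admissible /= /level.
  exact: guard_freeE.
move/eqP; rewrite eqb0 => /eqP m0.
apply: run_test => //= [|]; rewrite e16.
  rewrite eqb0 negbK => /eqP em.
  apply: (run_assign B100) => //=; rewrite e27 e15 e11 e19 !a6 !a8.
    exact: guard_second_lt.
  rewrite em /admissible /= /level (leqNgt (x w)).
  exact: guard_secondE.
move/eqP; rewrite eqb0 => /eqP m1.
apply: (run_assign B100) => //=; rewrite e27 e11 e19 !a6 !a8.
  exact: guard_first_lt.
have em : m = 2 by lia.
rewrite em /admissible /= /level.
exact: guard_firstE.
Qed.

Lemma run_look_up u v m w st : bounded B st -> env st ->
  cell_at u v m st -> mover_at u v m st -> vars st 11 = w -> m <= 2 ->
  u <= n -> v <= n -> w <= n ->
  run B 60 look_up st (fun st' =>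
    vars st' 17 = if arrs st 10 (code (target u v m w)) != 0
                  then (code (target u v m w)).+1 else vars st 17).
Proof.
move=> bnd [[v3 v4 _ _] v23 v24 a6 a8] [e7 e15 e16 e22] [e18 e19 e26 e27 e29] e11 m2 un vn wn.
have ok : config_ok (target u v m w).
  by rewrite /config_ok /target /next_mode; case: ifP => _ /=; rewrite ?un ?vn ?wn; case: ifP.
have cb := code_lt ok.
apply: (@run_cons _ _ 20 _ _ _ (fun st' => code (target u v m w) =
   (vars st' 29 * vars st' 4 + vars st' 20) * vars st' 4 + vars st' 21)) => //.
  apply: run_test => //= [|]; rewrite e18; case fm: (First u v m) => //= _.
    apply: (run_assign_cons B100) => //=; first exact: (proj1 bnd).
    move=> bnd1; apply: (run_assign B100) => //=; first exact: (proj1 bnd).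
    by rewrite e29 v4 e11 e15 /target fm.
  apply: (run_assign_cons B100) => //=; first exact: (proj1 bnd).
  move=> bnd1; apply: (run_assign B100) => //=; first exact: (proj1 bnd).
  by rewrite e29 v4 e11 e7 /target fm.
move=> st1 bnd1 [ag1 aa1] /= ec.
apply: (run_assign_cons B100) => //=; first by rewrite -ec; lia.
rewrite -ec => bnd2; apply: run_test => //=; rewrite aa1 // => T0.
  apply: (run_assign B100) => //=; first by lia.
  by rewrite T0 addn1.
by apply: run_skip => //; rewrite /= T0 /= ag1.
Qed.

Lemma run_candidate (b : bool) u v m w st : bounded B st -> env st ->
  cell_at u v m st -> mover_at u v m st -> vars st 11 = w -> m <= 2 ->
  u <= n -> v <= n -> w <= n -> vars st 28 = b ->
  run B 140 candidate st (fun st' =>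
    vars st' 17 = if [&& b, Adm u v m (mover u v m) w &
                         arrs st 10 (code (target u v m w)) != 0]
                  then (code (target u v m w)).+1 else vars st 17).
Proof.
move=> bnd ev ca ma e11 m2 un vn wn e28.
apply: (@run_cons _ _ 65 _ _ _ (fun st' =>
   (vars st' 28 != 0) = b && Adm u v m (mover u v m) w)) => //.
  case: b e28 => e28; apply: run_test => //=; rewrite e28 // => _.
    exact: run_weaken (run_test_admissible bnd ev ca ma e11 m2) _ _.
  by apply: run_skip => //; rewrite e28.
move=> st1 bnd1 ag e28'.
have ev1 := env_agree ag isT isT ev.
have ca1 := cell_at_agree ag isT ca; have ma1 := mover_at_agree ag isT ma.
have e11' : vars st1 11 = w by case: ag => ->.
have e17 : vars st1 17 = vars st 17 by case: ag => ->.
apply: run_test => //=; last first.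
  move=> b0; move: e28'; rewrite b0 andbA => <-.
  by apply: run_skip.
rewrite e28' => /andP[-> ->] /=; rewrite -e17.
apply: run_weaken (run_look_up bnd1 ev1 ca1 ma1 e11' m2 un vn wn) _ _ => //.
by move=> st2 bnd2 _ ->; case: ag => _ ->.
Qed.

Lemma run_neighbour_candidate u v m w st : bounded B st -> env st ->
  cell_at u v m st -> mover_at u v m st -> arrs st 1 (vars st 8) = w -> m <= 2 ->
  u <= n -> v <= n -> w <= n ->
  run B 170 neighbour_candidate st (fun st' =>
    vars st' 17 = if [&& (if First u v m then x w == (x (mover u v m)).+1
                          else y w == (y (mover u v m)).+1),
                         Adm u v m (mover u v m) w &
                         arrs st 10 (code (target u v m w)) != 0]
                  then (code (target u v m w)).+1 else vars st 17).
Proof.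
move=> bnd ev ca ma ew m2 un vn wn.
apply: (run_assign_cons B100) => //; first exact: (proj2 bnd).
set st1 := set_var _ _ _ => bnd1.
have ag : agree [:: 11] [::] st st1.
  by split=> // z; rewrite inE /= => /negPf->.
have ev1 := env_agree ag isT isT ev.
have ca1 := cell_at_agree ag isT ca; have ma1 := mover_at_agree ag isT ma.
have e11 : vars st1 11 = w by rewrite /= ew.
have e17 : vars st1 17 = vars st 17 by [].
have e10 : arrs st1 10 = arrs st 10 by [].
clearbody st1; rewrite -e17 -e10.
set b := (if First _ _ _ then _ else _).
apply: (@run_cons _ _ 20 _ _ _ (fun st' => vars st' 28 = b)) => //.
  have [_ _ _ a6 a8] := ev1; have [e18 e19 _ _ _] := ma1.
  apply: run_test => //=; rewrite e18 /b; case: (First u v m) => //= _.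
    by apply: (run_assign B100) => //=; rewrite e11 e19 !a6 addn1 //;
      apply: leq_ltn_trans (leq_b1 _) _; lia.
  by apply: (run_assign B100) => //=; rewrite e11 e19 !a8 addn1 //;
      apply: leq_ltn_trans (leq_b1 _) _; lia.
move=> st2 bnd2 ag2 e28.
have ev2 := env_agree ag2 isT isT ev1.
have ca2 := cell_at_agree ag2 isT ca1; have ma2 := mover_at_agree ag2 isT ma1.
have e11' : vars st2 11 = w by case: (ag2) => ->.
apply: run_weaken (run_candidate bnd2 ev2 ca2 ma2 e11' m2 un vn wn e28) _ _ => //.
by move=> st3 _ _ ->; case: (ag2) => -> // ->.
Qed.

Lemma run_exit_candidate u v m st : bounded B st -> env st ->
  cell_at u v m st -> mover_at u v m st -> m <= 2 -> u <= n -> v <= n ->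
  run B 160 exit_candidate st (fun st' =>
    vars st' 17 = if Adm u v m (mover u v m) n &&
                     (arrs st 10 (code (target u v m n)) != 0)
                  then (code (target u v m n)).+1 else vars st 17).
Proof.
move=> bnd ev ca ma m2 un vn.
apply: (run_assign_cons B100) => //; first exact: (proj1 bnd).
move=> bnd1; apply: (run_assign_cons B100) => //; first by rewrite /=; lia.
set st1 := set_var _ 28 _ => bnd2.
have ag : agree [:: 11; 28] [::] st st1.
  by split=> // z; rewrite !inE negb_or /= => /andP[/negPf-> /negPf->].
have ev1 := env_agree ag isT isT ev.
have ca1 := cell_at_agree ag isT ca; have ma1 := mover_at_agree ag isT ma.
have e11 : vars st1 11 = n by have [[]] := ev.
apply: run_weaken (run_candidate (b := true) bnd2 ev1 ca1 ma1 e11 m2 un vn (leqnn n) _) _ _ => //.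
Qed.

Lemma run_choose_mover u v m st : bounded B st -> env st ->
  cell_at u v m st -> m <= 2 ->
  run B 100 choose_mover st (fun st' => mover_at u v m st' /\
    vars st' 25 = if First u v m then t1 else t2).
Proof.
move=> bnd ev ca m2.
have [gr v23 v24 a6 a8] := ev; have [e7 e15 e16 e22] := ca.
have bB (b : bool) : b < B by apply: leq_ltn_trans (leq_b1 _) _; lia.
apply: (run_assign_cons B100) => //; first exact: bB.
move=> bnd1; apply: (run_assign_cons B100) => //=; first by rewrite mulnb; exact: bB.
move=> bnd2; apply: (run_assign_cons B100) => //=.
  by rewrite e16; case: (_ == _) => /=; lia.
set st1 := set_var _ 29 _ => bnd3.
have ag : agree [:: 26; 27; 29] [::] st st1.
  split=> // z; rewrite !inE !negb_or => /and3P[z1 z2 z3] /=.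
  by rewrite (negPf z1) (negPf z2) (negPf z3).
have ev1 := env_agree ag isT isT ev; have ca1 := cell_at_agree ag isT ca.
have e27 : vars st1 27 = Same u v by rewrite /= e7 e15 !a6 !a8.
have e26 : vars st1 26 = Facing u v.
  by rewrite /= e7 e15 !a6 !a8 mulnb.
have e29 : vars st1 29 = Next u v m.
  by rewrite /= e7 e15 e16 !a6 !a8 /next_mode /same_level /level; case: (_ == _); rewrite ?mul1n.
clearbody st1.
apply: (@run_cons _ _ 40 _ _ _ (fun st' => vars st' 18 = First u v m)) => //.
  have [_ _ _ a6' a8'] := ev1; have [e7' e15' e16' _] := ca1.
  rewrite /first_moves.
  have fE : (Level u < Level v) + (Same u v - Facing u v) =
      (Level u < Level v) || (Same u v && (x v <= x u)) :> nat.
    rewrite /facing /same_level (leqNgt (x v)).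
    by case: ltngtP => //=; case: (_ < _).
  apply: run_test => //=; rewrite e16'.
    rewrite eqb0 negbK => ->; apply: (run_assign B100) => //=;
      by rewrite e27 e26 e7' e15' !a6' !a8' -!/(level x y _) fE ?bB.
  move/eqP; rewrite eqb0 => /negPf ->.
  apply: run_test => //=; rewrite e16'.
    by rewrite eqb0 negbK => ->; apply: (run_assign B100) => //=; rewrite e27 ?bB.
  move/eqP; rewrite eqb0 => /negPf ->.
  by apply: (run_assign B100) => //=; rewrite e27; case: (Same u v) => //=; lia.
move=> st2 bnd4 ag2 e18.
have ev2 := env_agree ag2 isT isT ev1; have ca2 := cell_at_agree ag2 isT ca1.
have [e7' e15' _ _] := ca2; have [_ v23' v24' _ _] := ev2.
have [e26' e27' e29'] : [/\ vars st2 26 = Facing u v, vars st2 27 = Same u v &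
    vars st2 29 = Next u v m] by case: ag2 => ag2 _; split; rewrite ag2.
apply: run_test => //=; rewrite e18; case fm: (First u v m) => //= _.
  apply: (run_assign_cons B100) => //; first exact: (proj1 bnd4).
  move=> bnd5; apply: (run_assign B100) => //; first exact: (proj1 bnd5).
  by split=> //=; split=> //=; rewrite ?fm // /mover fm.
apply: (run_assign_cons B100) => //; first exact: (proj1 bnd4).
move=> bnd5; apply: (run_assign B100) => //; first exact: (proj1 bnd5).
by split=> //=; split=> //=; rewrite ?fm // /mover fm.
Qed.

(** The graph part of a move, without the level conditions. *)
Definition arrow (u v m w : nat) : bool :=
  if First u v m then pebble_arc n E x t1 u w else pebble_arc n E y t2 v w.

Lemma move_target u v m w : u != v -> arrow u v m w -> Adm u v m (mover u v m) w ->
  Move (u, v, m) (target u v m w).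
Proof.
rewrite /arrow /mover /target => uv; case fm: (First u v m) => ar ad /=;
  by rewrite uv fm !eqxx ar ad.
Qed.

Lemma move_inv u v m s' : Move (u, v, m) s' ->
  exists w, [/\ arrow u v m w, Adm u v m (mover u v m) w & s' = target u v m w].
Proof.
case: s' => [[u' v'] m'] /= /and3P[_ /eqP-> ]; rewrite /arrow /mover /target.
by case: ifP => fm /and3P[/eqP-> ar ad]; [exists u'|exists v'].
Qed.

Lemma arrow_lt u v m w : arrow u v m w -> (mover u v m < n) && (w <= n).
Proof.
have H z t a : t < n -> pebble_arc n E z t a w -> (a < n) && (w <= n).
  move=> tn /orP[/andP[/(csr_lt G)/andP[-> /ltnW]]//|/andP[/eqP-> /eqP->]].
  by rewrite tn /=.
by rewrite /arrow /mover; case: ifP => _; apply: H.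
Qed.

(** Correctness of one table entry relative to the entries of the successors;
    [winning_filled] and the replay of the game follow by induction. *)
Definition cell_spec (T : nat -> nat) (s : config) : Prop :=
  (T (code s) != 0 -> s = goal_config n \/
    exists s', [/\ Step s s', T (code s') != 0 & T (code s) = (code s').+1]) /\
  (T (code s) = 0 -> s <> goal_config n /\ forall s', Step s s' -> T (code s') = 0).

Definition found (T : nat -> nat) (s : config) (c : nat) : Prop :=
  c != 0 -> exists s', [/\ Step s s', T (code s') != 0 & c = (code s').+1].

Lemma step_move_pos u v m s' : m != 0 -> Step (u, v, m) s' = Move (u, v, m) s'.
Proof. by move=> m0; rewrite /pebble_step (negPf m0) orbF. Qed.

(** Entries of the committed modes already contain a winning step, and it is also
    a step of mode 0; copying them implements the implicit commitment. *)
Lemma run_try_commit u v m T st : bounded B st -> env st ->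
  cell_at u v m st -> mover_at u v m st -> m <= 2 -> u <= n -> v <= n -> u != v ->
  vars st 17 = 0 -> arrs st 10 =1 T ->
  (Facing u v -> m = 0 -> cell_spec T (u, v, 1) /\ cell_spec T (u, v, 2)) ->
  run B 60 try_commit st (fun st' => found T (u, v, m) (vars st' 17) /\
    (vars st' 17 = 0 -> Facing u v -> m = 0 ->
     forall s', Move (u, v, 1) s' || Move (u, v, 2) s' -> T (code s') = 0)).
Proof.
move=> bnd ev ca ma m2 un vn uv e17 eT spec.
have [[v3 v4 _ _] _ _ _ _] := ev; have [e7 e15 e16 e22] := ca.
have [_ _ e26 _ _] := ma.
apply: run_test => //=; rewrite e26 e16; last first.
  rewrite mulnb; move/eqP; rewrite eqb0 => nc; apply: run_skip => //.
  by split=> [|_ fc m0]; [rewrite /found e17|move: nc; rewrite fc m0].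
rewrite mulnb eqb0 negbK => /andP[fc /eqP m0].
rewrite m0 in e22 *.
have [spec1 spec2] := spec fc m0.
have e1 : vars st 22 + vars st 4 * vars st 4 = code (u, v, 1).
  by rewrite e22 v4 /code /=; lia.
have e2 : vars st 22 + 2 * (vars st 4 * vars st 4) = code (u, v, 2).
  by rewrite e22 v4 /code /=; lia.
have ng k : (u, v, k) <> goal_config n by move=> [eu ev']; rewrite eu ev' eqxx in uv.
have commit k s' : k = 1 \/ k = 2 -> Step (u, v, k) s' -> Step (u, v, 0) s'.
  move=> k12; rewrite step_move_pos; last by case: k12 => ->.
  by rewrite /pebble_step fc /=; case: k12 => -> ->; rewrite ?orbT.
have fnd k : k = 1 \/ k = 2 -> cell_spec T (u, v, k) -> found T (u, v, 0) (T (code (u, v, k))).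
  move=> k12 [sp _] T0; case: (sp T0) => [/ng//|[s' [st' T' ->]]].
  by exists s'; split=> //; apply: commit st'.
apply: (run_assign_cons B100) => //; first exact: (proj2 bnd).
rewrite /= e1 eT => bnd1; apply: run_test => //= T1.
  apply: run_skip => //=; split; first by apply: fnd; [left|].
  by move=> e; rewrite e in T1.
apply: (run_assign B100) => //; first exact: (proj2 bnd1).
rewrite /= e2 eT; split; first by apply: fnd; [right|].
move=> T2 _ _ s' /orP[mv|mv].
  by apply: (proj2 (proj2 spec1 T1)); rewrite step_move_pos.
by apply: (proj2 (proj2 spec2 T2)); rewrite step_move_pos.
Qed.

Lemma step_of_move u v m s' : Move (u, v, m) s' -> Step (u, v, m) s'.
Proof. by rewrite /pebble_step => ->. Qed.

(** All successors are tried: the committed modes, the neighbours of the mover,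
    and its exit. *)
Lemma run_cell_search u v m T st : bounded B st -> env st ->
  cell_at u v m st -> m <= 2 -> u <= n -> v <= n -> u != v -> arrs st 10 =1 T ->
  (Facing u v -> m = 0 -> cell_spec T (u, v, 1) /\ cell_spec T (u, v, 2)) ->
  run B (500 + 200 * (degree off u + degree off v)) cell_search st (fun st' =>
    found T (u, v, m) (vars st' 17) /\
    (vars st' 17 = 0 -> forall s', Step (u, v, m) s' -> T (code s') = 0)).
Proof.
move=> bnd ev ca m2 un vn uv eT spec.
apply: (run_assign_cons B100) => //; first by rewrite /=; lia.
set st1 := set_var _ _ _ => bnd1.
have ag : agree [:: 17] [::] st st1.
  by split=> // z; rewrite inE /= => /negPf->.
have ev1 := env_agree ag isT isT ev; have ca1 := cell_at_agree ag isT ca.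
have eT1 : arrs st1 10 =1 T by [].
have e17 : vars st1 17 = 0 by [].
clearbody st1.
apply: (run_cons (run_choose_mover bnd1 ev1 ca1 m2)); first by rewrite /=; lia.
move=> st2 bnd2 ag2 [ma2 e25].
have ev2 := env_agree ag2 isT isT ev1; have ca2 := cell_at_agree ag2 isT ca1.
have e17b : vars st2 17 = 0 by case: (ag2) => ->.
have eT2 : arrs st2 10 =1 T by move=> i; case: (ag2) => _ ->.
apply: (run_cons (run_try_commit bnd2 ev2 ca2 ma2 m2 un vn uv e17b eT2 spec));
  first by rewrite /=; lia.
move=> st3 bnd3 ag3 [fnd3 com3].
have ev3 := env_agree ag3 isT isT ev2; have ca3 := cell_at_agree ag3 isT ca2.
have ma3 := mover_at_agree ag3 isT ma2.
have e25b : vars st3 25 = if First u v m then t1 else t2 by case: (ag3) => ->.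
have eT3 : arrs st3 10 =1 T by move=> i; case: (ag3) => _ ->.
apply: (run_assign_cons B100) => //; first exact: (proj2 bnd3).
set st4 := set_var _ _ _ => bnd4.
have ag4 : agree [:: 9] [::] st3 st4.
  by split=> // z; rewrite inE /= => /negPf->.
have ev4 := env_agree ag4 isT isT ev3; have ca4 := cell_at_agree ag4 isT ca3.
have ma4 := mover_at_agree ag4 isT ma3.
have e25c : vars st4 25 = if First u v m then t1 else t2 by [].
have eT4 : arrs st4 10 =1 T by [].
set z := mover u v m.
have e19 : vars st3 19 = z by case: ma3.
have e9 : vars st4 9 = off z.+1.
  by rewrite /= e19 addn1; case: ev3 => -[_ _ -> _].
have e17c : vars st4 17 = vars st3 17 by [].
have e19b : vars st4 19 = z by [].
clearbody st4.
rewrite -e17c in fnd3 com3.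
have off4 : arrs st4 0 =1 off by case: ev4 => -[].
have offB w : off w < B by rewrite -off4; apply: (proj2 bnd4).
have dz : degree off z <= degree off u + degree off v.
  by rewrite /z /mover; case: ifP => _; rewrite ?leq_addr ?leq_addl.
pose Inv k st' := found T (u, v, m) (vars st' 17) /\
  (vars st' 17 = 0 -> vars st4 17 = 0 /\
   forall w, (exists2 j, off z <= j < k & nbr j = w) -> arrow u v m w ->
     w < n -> Adm u v m z w -> T (code (target u v m w)) = 0).
have zn : z <= n by rewrite /z /mover; case: ifP.
apply: (@run_cons _ _ (100 + 190 * degree off z) _ _ _ (fun st' => Inv (maxn (off z) (off z.+1)) st'));
  last first.
- move=> st5 bnd5 ag5 [fnd5 inv5].
  have ev5 := env_agree ag5 isT isT ev4; have ca5 := cell_at_agree ag5 isT ca4.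
  have ma5 := mover_at_agree ag5 isT ma4.
  have eT5 : arrs st5 10 =1 T by move=> i; case: (ag5) => _ ->.
  have [e19c e25d] : vars st5 19 = z /\ vars st5 25 = if First u v m then t1 else t2.
    by case: (ag5) => ag5v _; split; rewrite ag5v.
  have adj c : c = 0 -> (z == (if First u v m then t1 else t2) ->
      Adm u v m z n -> T (code (target u v m n)) = 0) ->
      (c = 0 -> vars st5 17 = 0) ->
      forall s', Step (u, v, m) s' -> T (code s') = 0.
    move=> c0 ext /(_ c0) e5 s'; have [e4 nb] := inv5 e5.
    case/orP=> [/move_inv[w [ar ad ->]]|/and3P[/eqP m0 fc mv]]; last first.
      by apply: com3 => //; rewrite -m0.
    have := ar; rewrite /arrow /pebble_arc => arE.
    have [wn|nw] := ltnP w n.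
      apply: nb => //.
      have Ezw : E z w.
        move: arE; rewrite /z /mover; case: ifP => _ /orP[/andP[]//|/andP[_ /eqP ew]];
          by rewrite ew ltnn in wn.
      have /andP[znb _] := csr_lt G Ezw.
      have [j jz <-] := proj1 (csr_mem G w znb) Ezw.
      by exists j => //; case/andP: jz => -> /leq_trans -> //; rewrite leq_maxr.
    have ewn : w = n by apply/eqP; rewrite eqn_leq nw; case/andP: (arrow_lt ar) => _ ->.
    subst w; apply: ext => //; move: arE; rewrite /z /mover; case: ifP => _;
      by case/orP=> [/andP[/(csr_lt G)]|/andP[]//]; rewrite ltnn andbF.
  apply: run_test => //; [by rewrite /=; lia| |]; rewrite /= e19c e25d.
    rewrite eqb0 negbK => zt.
    apply: run_weaken (run_exit_candidate bnd5 ev5 ca5 ma5 m2 un vn) _ _; first by lia.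
    move=> st6 bnd6 ag6 ->; rewrite eT5 -/z; case: ifP => [/andP[ad T0]|nad].
      split=> [_|//]; exists (target u v m n); split=> //.
      apply: step_of_move; apply: move_target => //.
      by move: zt; rewrite /arrow /pebble_arc /z /mover; case: ifP => _ ->; rewrite eqxx orbT.
    split=> // c0; apply: adj (c0) _ _ => // _ ad.
    by move: nad; rewrite ad /= => /negbT; rewrite negbK => /eqP.
  move/eqP; rewrite eqb0 => zt; apply: run_skip => //; first by lia.
  by split=> // c0; apply: adj (c0) _ _ => //; rewrite (negPf zt).
- by rewrite /=; lia.
- apply: (run_for B100 (l := off z) (h := off z.+1) (f := fun _ => 170) (Inv := Inv)) => //.
  + by rewrite /= e19b off4.
  + by move=> st' [ag5 _] /=; rewrite ag5.
  + by split=> // c0; split=> // w [j]; lia.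
  + move=> k st5 zk bnd5 ag5 ek [fnd5 inv5].
    have ev5 := env_agree ag5 isT isT ev4; have ca5 := cell_at_agree ag5 isT ca4.
    have ma5 := mover_at_agree ag5 isT ma4.
    have eT5 : arrs st5 10 =1 T by move=> i; case: (ag5) => _ ->.
    have ew : arrs st5 1 (vars st5 8) = nbr k by case: ev5 => -[_ _ _ ->]; rewrite ek.
    have znb : z < n.
      rewrite ltn_neqAle zn andbT; apply/eqP => ez; move: zk.
      by rewrite ez (csr_end G); lia.
    have Ez : E z (nbr k) by apply/(csr_mem G _ znb); exists k.
    have /andP[_ wn] := csr_lt G Ez.
    apply: run_weaken (run_neighbour_candidate bnd5 ev5 ca5 ma5 ew m2 un vn (ltnW wn)) _ _ => //.
    move=> st6 bnd6 ag6; rewrite eT5 -/z => e6.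
    rewrite /Inv /= e6; case: ifP => [/and3P[val ad T0]|nad].
      split=> [_|//]; exists (target u v m (nbr k)); split=> //.
      apply: step_of_move; apply: move_target => //.
      by move: Ez val; rewrite /arrow /pebble_arc /z /mover; case: ifP => _ -> ->.
    split=> // c0; have [e4 nb] := inv5 c0; split=> // w [j jk ewj ar wnb ad].
    have [ej|nj] := eqVneq j k; last by apply: nb => //; exists j => //; lia.
    subst j w; move: nad; rewrite ad /=.
    have -> : (if First u v m then x (nbr k) == (x z).+1 else y (nbr k) == (y z).+1).
      move: ar; rewrite /arrow /pebble_arc /z /mover; case: ifP => _;
      by case/orP=> /andP[] // _ /eqP ewn; rewrite ewn ltnn in wnb.
    by move=> /negbT; rewrite negbK => /eqP.
  + by rewrite sum_nat_const_nat /degree /=; lia.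
  + by move=> k st' _ _ -> _.
Qed.

End Table.

(** * Deciding the whole game and replaying a won one *)

(** Every step raises X of the first pebble or Y of the second, so all successors
    of a configuration come earlier if both enumerations are run backwards.  For
    one pair of vertices the modes 2 and 1 come before mode 0. *)
Definition fill_table : cmd :=
  For 12 (Const 0) (Var 4) (
    Seq (Assign 7 (Get 7 (Defs.Sub (Var 3) (Var 12)))) (
    For 13 (Const 0) (Var 4) (
      Seq (Assign 15 (Get 9 (Defs.Sub (Var 3) (Var 13)))) (
      For 14 (Const 0) (Const 3) (
        Seq (Assign 16 (Defs.Sub (Const 2) (Var 14))) cell))))).

(** Variable 22 is the code of the current configuration and 34 that of the goal.
    The coordinate of a vertex is its position on the path, counted from one, so
    the vertex can be written to its final place; arrays 4 and 5 receive the two paths. *)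
Definition trace_step : cmd :=
  If (Eqn (Var 22) (Var 34)) Skip (
    Seq (Assign 7 (Get 11 (Var 22))) (
    Seq (Assign 15 (Get 12 (Var 22))) (
    Seq (Store 4 (Defs.Sub (Get 6 (Var 7)) (Const 1)) (Var 7)) (
    Seq (Store 5 (Defs.Sub (Get 13 (Var 15)) (Const 1)) (Var 15))
        (Assign 22 (Defs.Sub (Get 10 (Var 22)) (Const 1))))))).

Definition attempt : cmd :=
  Seq fill_table (
  Seq (Assign 22 (code_expr (Const 0) (Var 31) (Var 32))) (
  Seq (Assign 34 (code_expr (Const 0) (Var 3) (Var 3))) (
  Seq (Assign 33 (Mul (Mul (Var 4) (Var 4)) (Const 3)))
      (If (Get 10 (Var 22))
        (Seq (For 14 (Const 0) (Var 33) trace_step) (Assign 0 (Const 1)))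
        (Assign 0 (Const 0)))))).

Section Fill.

Variables (B n : nat) (E : rel nat) (off nbr x y ox oy : nat -> nat) (t1 t2 : nat).
Hypothesis Bn : 9 * (n.+1 * n.+1) + 100 <= B.
Hypothesis G : csr n E off nbr.
Hypothesis t1n : t1 < n.
Hypothesis t2n : t2 < n.

Let B100 : 100 <= B. Proof. by lia. Qed.

Notation Env := (env n off nbr x y t1 t2).
Notation Move := (pebble_move n E x y t1 t2).
Notation Step := (pebble_step n E x y t1 t2).
Notation Code := (code n).
Notation Spec := (cell_spec n E x y t1 t2).

Lemma run_cell u v m T U V st : bounded B st -> Env st ->
  vars st 7 = u -> vars st 15 = v -> vars st 16 = m ->
  m <= 2 -> u <= n -> v <= n ->
  arrs st 10 =1 T -> arrs st 11 =1 U -> arrs st 12 =1 V ->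
  (facing x y u v -> m = 0 -> Spec T (u, v, 1) /\ Spec T (u, v, 2)) ->
  run B (700 + 200 * (degree off u + degree off v)) cell st (fun st' =>
    let c := Code (u, v, m) in
    [/\ forall i, i <> c -> [/\ arrs st' 10 i = T i, arrs st' 11 i = U i &
                                arrs st' 12 i = V i],
        arrs st' 11 c = u, arrs st' 12 c = v,
        arrs st' 10 c != 0 -> (u, v, m) = goal_config n \/
          exists s', [/\ Step (u, v, m) s', T (Code s') != 0 &
                        arrs st' 10 c = (Code s').+1] &
        arrs st' 10 c = 0 -> (u, v, m) <> goal_config n /\
          forall s', Step (u, v, m) s' -> T (Code s') = 0]).
Proof.
move=> bnd en e7 e15 e16 m2 un vn eT eU eV spec.
have [[v3 v4 a0 a1] _ _ _ _] := en.
have ec : ev st (code_expr (Var 16) (Var 7) (Var 15)) = Code (u, v, m).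
  by rewrite /= e16 e7 e15 v4.
have cB : (Code (u, v, m)).+2 < B by apply: (code_lt Bn); apply/and3P.
apply: (run_assign_cons B100) => //; first by rewrite ec; lia.
rewrite ec; set st1 := set_var _ _ _ => bnd1.
have en1 : Env st1 by apply: (env_agree (xs := [:: 22]) (bs := [::]) _ isT isT en);
  split=> // z; rewrite inE /= => /negPf->.
have ca1 : cell_at n u v m st1 by [].
have eT1 : arrs st1 10 =1 T by [].
have eU1 : arrs st1 11 =1 U by [].
have eV1 : arrs st1 12 =1 V by [].
clearbody st1; have [e7' e15' e16' e22'] := ca1.
apply: (@run_cons _ _ (550 + 200 * (degree off u + degree off v)) _ _ _ (fun st' =>
    (vars st' 17 != 0 -> (u, v, m) = goal_config n \/
          exists s', [/\ Step (u, v, m) s', T (Code s') != 0 &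
                        vars st' 17 = (Code s').+1]) /\
    (vars st' 17 = 0 -> (u, v, m) <> goal_config n /\
          forall s', Step (u, v, m) s' -> T (Code s') = 0))); last first.
- move=> st2 bnd2 ag2 [h1 h2].
  have [e7'' e15'' _ e22''] := cell_at_agree ag2 isT ca1.
  have eT2 : arrs st2 10 =1 T by move=> i; case: (ag2) => _ ->.
  have eU2 : arrs st2 11 =1 U by move=> i; case: (ag2) => _ ->.
  have eV2 : arrs st2 12 =1 V by move=> i; case: (ag2) => _ ->.
  apply: (run_store_cons B100) => //; [by rewrite /=; lia|exact: (proj1 bnd2)|].
  move=> bnd3; apply: (run_store_cons B100) => //; [by rewrite /=; lia|exact: (proj1 bnd2)|].
  move=> bnd4; apply: (run_store B100) => //; [by rewrite /=; lia|exact: (proj1 bnd2)|].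
  rewrite /= e22'' e7'' e15'' eqxx; split=> //.
  by move=> i /eqP/negPf->.
- by rewrite /=; lia.
- apply: run_test => //; rewrite /= e7' e15'.
    rewrite eqb0 negbK => /eqP uv; have [[v3' _ _ _] _ _ _ _] := en1.
    have b1 (b : bool) : b < B by apply: leq_ltn_trans (leq_b1 _) _; lia.
    apply: (run_assign B100) => //=; rewrite ?e7' ?v3' ?e16' mulnb //.
    split; first by rewrite eqb0 negbK => /andP[/eqP un' /eqP->]; left; rewrite -uv un'.
    move/eqP; rewrite eqb0 => ng; split=> [[un' _ m0]|[[u' v'] m'] /=].
      by move: ng; rewrite un' m0 !eqxx.
    by rewrite -uv /facing ltnn eqxx !andbF.
  move/eqP; rewrite eqb0 => uv.
  have [w1|] := leqP 6 (550 + 200 * (degree off u + degree off v)); last by lia.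
  apply: run_weaken (run_cell_search Bn G t1n t2n bnd1 en1 ca1 m2 un vn uv eT1 spec) _ _.
    by lia.
  move=> st2 bnd2 ag2 [fnd none]; split; first by move=> /fnd; right.
  move=> c0; split; last exact: none.
  by move=> [u' v' _]; move: uv; rewrite u' v' eqxx.
Qed.

Definition rank (o : nat -> nat) (u : nat) : nat := n - index u (mkseq o n.+1).

(** What the table needs of an enumeration of the vertices and the exit. *)
Record ordering (z o : nat -> nat) : Prop := Ordering {
  ord_perm : perm_eq (mkseq o n.+1) (iota 0 n.+1);
  ord_mono : forall a b, a <= n -> b <= n -> z (o a) < z (o b) -> a < b }.

Lemma ordering_mem z o u : ordering z o -> (u \in mkseq o n.+1) = (u <= n).
Proof. by case=> p _; rewrite (perm_mem p) mem_iota. Qed.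

Lemma ordering_index z o u : ordering z o -> u <= n ->
  index u (mkseq o n.+1) <= n /\ o (index u (mkseq o n.+1)) = u.
Proof.
move=> oz un; have um : u \in mkseq o n.+1 by rewrite (ordering_mem _ oz).
have il : index u (mkseq o n.+1) < n.+1.
  by have := um; rewrite -index_mem size_mkseq.
by split=> //; rewrite -[RHS](nth_index 0 um) nth_mkseq.
Qed.

Lemma rank_nth z o a : ordering z o -> a <= n -> rank o (o (n - a)) = a /\ o (n - a) <= n.
Proof.
move=> oz an; have uq : uniq (mkseq o n.+1) by rewrite (perm_uniq (ord_perm oz)) iota_uniq.
have an' : n - a < n.+1 by rewrite ltnS leq_subr.
rewrite -(ordering_mem _ oz) /rank -(nth_mkseq 0 o an') index_uniq ?size_mkseq //.
by rewrite subKn // mem_nth ?size_mkseq.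
Qed.

Lemma rank_lt z o u w : ordering z o -> u <= n -> w <= n -> z u < z w ->
  rank o w < rank o u.
Proof.
move=> oz un wn uw; have [iu eu] := ordering_index oz un.
have [iw ew] := ordering_index oz wn; move: uw; rewrite -{1}eu -{1}ew.
by move/(ord_mono oz iu iw); rewrite /rank; lia.
Qed.

Lemma rank_inj z o u w : ordering z o -> u <= n -> w <= n ->
  rank o u = rank o w -> u = w.
Proof.
move=> oz un wn; have [iu eu] := ordering_index oz un.
have [iw ew] := ordering_index oz wn; rewrite /rank => e.
by rewrite -eu -ew; congr o; lia.
Qed.

Lemma ordering_volume z o : ordering z o -> 
  \sum_(0 <= a < n.+1) degree off (o (n - a)) = volume n off.
Proof.
move=> oz; rewrite big_nat_rev /= add0n.
rewrite (eq_big_nat _ _ (F2 := fun a => degree off (o a))); last first.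
  by move=> a an; congr (degree _ (o _)); lia.
rewrite (_ : \sum_(0 <= a < n.+1) _ = \sum_(u <- mkseq o n.+1) degree off u); last first.
  by rewrite big_map /index_iota subn0.
rewrite (perm_big _ (ord_perm oz)) -[iota 0 n.+1]/(index_iota 0 n.+1) big_nat_recr //=.
by rewrite {2}/degree (csr_end G) sub0n addn0.
Qed.

Hypothesis xord : ordering x ox.
Hypothesis yord : ordering y oy.
Hypothesis Xn : forall u, u < n -> x u <= n.
Hypothesis Yn : forall u, u < n -> y u <= n.
Hypothesis Xbot : x n = n + n + 2.
Hypothesis Ybot : y n = n + n + 2.

(** The time at which the configuration is treated by [fill_table]; its decrease
    along steps also bounds the length of the replay. *)
Definition key (s : config) : nat :=
  (rank ox s.1.1 * n.+1 + rank oy s.1.2) * 3 + (2 - s.2).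

Lemma move_key s s' : config_ok n s -> Move s s' ->
  config_ok n s' /\ rank ox s'.1.1 * n.+1 + rank oy s'.1.2 < rank ox s.1.1 * n.+1 + rank oy s.1.2.
Proof.
case: s s' => [[u v] m] [[u' v'] m'] /and3P[/= un vn m2] /and3P[_ /eqP-> ].
have m'2 : next_mode x y u v m <= 2 by rewrite /next_mode; case: ifP.
have ry w : w <= n -> rank oy w <= n by rewrite /rank leq_subr.
have arcX t w w' (z : nat -> nat) : t < n -> (forall a, a < n -> z a <= n) -> z n = n + n + 2 ->
    pebble_arc n E z t w w' -> w' <= n /\ z w < z w'.
  move=> tn zn zb; rewrite /pebble_arc => /orP[/andP[/(csr_lt G)/andP[_ /ltnW wn] /eqP->]|] //.
  by case/andP=> /eqP-> /eqP->; rewrite zb; have := zn t tn; lia.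
case: ifP => _ /and3P[/eqP-> ar _].
  have [un' lt] := arcX _ _ _ _ t1n Xn Xbot ar.
  rewrite /config_ok /= un' vn m'2; split=> //.
  by have := rank_lt xord un un' lt; rewrite ltn_add2r ltn_pmul2r.
have [vn' lt] := arcX _ _ _ _ t2n Yn Ybot ar.
rewrite /config_ok /= un vn' m'2; split=> //.
by rewrite ltn_add2l; apply: (rank_lt yord).
Qed.

Lemma step_key s s' : config_ok n s -> Step s s' -> config_ok n s' /\ key s' < key s.
Proof.
case: s => [[u v] m] ok st; suff [m' [m'2 mv]] : exists m', m' <= 2 /\ Move (u, v, m') s'.
  have ok' : config_ok n (u, v, m') by case/and3P: ok => /= un vn _; apply/and3P.
  have [oks' lt] := move_key ok' mv; split=> //; rewrite /key /=; move: lt => /=.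
  lia.
have m2 : m <= 2 by case/and3P: ok.
case/orP: st => [mv|/and3P[_ _ /orP[mv|mv]]]; by [exists m|exists 1|exists 2].
Qed.

Lemma key_inj s s' : config_ok n s -> config_ok n s' -> key s = key s' -> s = s'.
Proof.
case: s s' => [[u v] m] [[u' v'] m'] /and3P[/= un vn m2] /and3P[/= un' vn' m2'].
rewrite /key /= => e.
have em : 2 - m = 2 - m'.
  by move: (congr1 (modn^~ 3) e); rewrite !modnMDl !modn_small //; lia.
have e2 : rank ox u * n.+1 + rank oy v = rank ox u' * n.+1 + rank oy v' by lia.
have rl w : rank oy w < n.+1 by rewrite ltnS /rank leq_subr.
have ev' : rank oy v = rank oy v'.
  by move: (congr1 (modn^~ n.+1) e2); rewrite !modnMDl !modn_small.
have eu' : rank ox u = rank ox u'.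
  by move: (congr1 (divn^~ n.+1) e2); rewrite !divnMDl // !divn_small // !addn0.
rewrite (rank_inj xord un un' eu') (rank_inj yord vn vn' ev').
by congr (_, _, _); lia.
Qed.

Definition filled (K : nat) (st : state) : Prop :=
  forall s, config_ok n s -> key s < K ->
    [/\ Spec (arrs st 10) s, arrs st 11 (Code s) = s.1.1 & arrs st 12 (Code s) = s.1.2].

Lemma filled_cell s st st' : config_ok n s -> filled (key s) st ->
  (forall i, i <> Code s -> [/\ arrs st' 10 i = arrs st 10 i,
     arrs st' 11 i = arrs st 11 i & arrs st' 12 i = arrs st 12 i]) ->
  arrs st' 11 (Code s) = s.1.1 -> arrs st' 12 (Code s) = s.1.2 ->
  (arrs st' 10 (Code s) != 0 -> s = goal_config n \/
     exists s', [/\ Step s s', arrs st 10 (Code s') != 0 &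
                   arrs st' 10 (Code s) = (Code s').+1]) ->
  (arrs st' 10 (Code s) = 0 -> s <> goal_config n /\
     forall s', Step s s' -> arrs st 10 (Code s') = 0) ->
  filled (key s).+1 st'.
Proof.
move=> ok fl same eU eV win lose r okr; rewrite ltnS leq_eqVlt => kr.
have old q : config_ok n q -> key q < key s -> [/\ arrs st' 10 (Code q) = arrs st 10 (Code q),
    arrs st' 11 (Code q) = arrs st 11 (Code q) & arrs st' 12 (Code q) = arrs st 12 (Code q)].
  move=> okq kq; apply: same => e.
  by have eq := code_inj okq ok e; rewrite eq ltnn in kq.
have [ers|/eqP nrs] := eqVneq (key r) (key s).
  have -> := key_inj okr ok ers; split=> //; split.
    move=> /win[|[s' [st1 T0 e]]]; [by left|right; exists s'].
    have [oks' ks'] := step_key ok st1.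
    by have [-> _ _] := old s' oks' ks'.
  move=> /lose[ng none]; split=> // s' st1.
  have [oks' ks'] := step_key ok st1.
  by have [-> _ _] := old s' oks' ks'; apply: none.
have {}kr : key r < key s by case/orP: kr => // /eqP.
have [[win' lose'] eU' eV'] := fl r okr kr; have [e10 e11 e12] := old r okr kr.
split; rewrite ?e11 ?e12 //; split; rewrite e10.
  move=> /win'[|[s' [st1 T0 e]]]; [by left|right; exists s'].
  have [oks' ks'] := step_key okr st1.
  by have [-> _ _] := old s' oks' (ltn_trans ks' kr).
move=> /lose'[ng none]; split=> // s' st1.
have [oks' ks'] := step_key okr st1.
by have [-> _ _] := old s' oks' (ltn_trans ks' kr); apply: none.
Qed.

Definition env_ordered (st : state) : Prop :=
  [/\ Env st, arrs st 7 =1 ox & arrs st 9 =1 oy].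

Lemma env_ordered_agree xs bs st st' : agree xs bs st st' ->
  all (fun z => z \notin xs) [:: 3; 4; 23; 24] ->
  all (fun b => b \notin bs) [:: 0; 1; 6; 7; 8; 9] -> env_ordered st -> env_ordered st'.
Proof.
move=> ag nx /= /and5P[b0 b1 b6 b7 /and3P[b8 b9 _]] [en e7 e9].
split; first by apply: (env_agree ag nx _ en); rewrite /= b0 b1 b6 b8.
- by move=> i; case: ag => _ ->.
- by move=> i; case: ag => _ ->.
Qed.

Lemma filled_ext K st st' : (forall b, b \in [:: 10; 11; 12] -> arrs st' b =1 arrs st b) ->
  filled K st -> filled K st'.
Proof.
move=> eb fl s ok ks; have [[w l] e11 e12] := fl s ok ks.
split; rewrite ?eb //; split; rewrite eb //.
  move=> /w[|[s' [st1 T0 ->]]]; [by left|right; exists s'; split=> //].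
  by rewrite eb.
by move=> /l[ng none]; split=> // s' /none; rewrite eb.
Qed.

Lemma run_fill_row u v k st : bounded B st -> env_ordered st ->
  u <= n -> v <= n -> vars st 7 = u -> vars st 15 = v ->
  k = rank ox u * n.+1 + rank oy v -> filled (k * 3) st ->
  run B (2400 + 600 * (degree off u + degree off v))
    (For 14 (Const 0) (Const 3) (Seq (Assign 16 (Defs.Sub (Const 2) (Var 14))) cell))
    st (filled (k.+1 * 3)).
Proof.
move=> bnd en un vn e7 e15 ek fl.
apply: (run_for B100 (l := 0) (h := 3) (f := fun _ => 710 + 200 * (degree off u + degree off v))
  (Inv := fun j st' => [/\ filled (k * 3 + j) st', vars st' 7 = u & vars st' 15 = v])) => //.
- by lia.
- by lia.
- by rewrite addn0.
- move=> j st1 j3 bnd1 ag1 ej [fl1 e7' e15'].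
  have en1 := env_ordered_agree ag1 isT isT en.
  apply: (run_assign_cons B100) => //; first by rewrite /= ej; lia.
  set st2 := set_var _ _ _ => bnd2.
  have en2 : env_ordered st2.
    apply: (@env_ordered_agree [:: 16] [::] st1 st2 _ isT isT en1).
    by split=> // z; rewrite inE /= => /negPf->.
  have e16 : vars st2 16 = 2 - j by rewrite /= ej.
  have e7'' : vars st2 7 = u by [].
  have e15'' : vars st2 15 = v by [].
  have fl2 : filled (k * 3 + j) st2 by [].
  clearbody st2.
  pose s : config := (u, v, 2 - j).
  have oks : config_ok n s by apply/and3P; rewrite /= leq_subr.
  have keys : key s = k * 3 + j by rewrite /key /= ek; lia.
  have comm : facing x y u v -> 2 - j = 0 ->
      Spec (arrs st2 10) (u, v, 1) /\ Spec (arrs st2 10) (u, v, 2).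
    move=> _ j2; split; [case: (fl2 (u, v, 1))|case: (fl2 (u, v, 2))] => //;
      solve [by apply/and3P | by rewrite /key /= -ek; lia].
  have [en2' _ _] := en2.
  apply: run_weaken (run_cell bnd2 en2' e7'' e15'' e16 _ un vn (frefl _) (frefl _) (frefl _) comm) _ _.
  + by lia.
  + by rewrite /=; lia.
  + move=> st3 bnd3 ag3 [same eU eV win lose] /=; split; last 2 first.
    * by case: (ag3) => ->.
    * by case: (ag3) => ->.
    have := @filled_cell s st2 st3 oks; rewrite keys => /(_ fl2 same eU eV win lose).
    by rewrite addnS.
- by rewrite sum_nat_const_nat; lia.
- by move=> j st1 _ _ -> _ [fl1 _ _]; rewrite mulSnr.
Qed.

Lemma run_fill_table st : bounded B st -> env_ordered st ->
  run B (3000 * (n.+1 * n.+1) + 1300 * (n.+1 * volume n off)) fill_table st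
    (filled (n.+1 * n.+1 * 3)).
Proof.
move=> bnd en; have [[[v3 v4 _ _] _ _ _ _] _ _] := en.
have nB : n.+1 < B by lia.
pose f a := 100 + n.+1 * 2500 + 600 * volume n off + (n.+1 * 600) * degree off (ox (n - a)).
apply: (run_for B100 (l := 0) (h := n.+1) (f := f)
  (Inv := fun a st' => filled (a * n.+1 * 3) st')) => //.
- by lia.
- by move=> st' ag /=; have [[[_ -> _ _] _ _ _ _] _ _] := env_ordered_agree ag isT isT en.
- move=> a st1 an bnd1 ag1 ea fl1.
  have en1 := env_ordered_agree ag1 isT isT en.
  have [[[v3' v4' _ _] _ _ _ _] e7 e9] := en1.
  have an' : a <= n by lia.
  have [ra oa] := rank_nth xord an'.
  set u := ox (n - a) in ra oa.
  apply: (run_assign_cons B100) => //; first exact: (proj2 bnd1).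
  set st2 := set_var _ _ _ => bnd2.
  have en2 : env_ordered st2.
    apply: (@env_ordered_agree [:: 7] [::] st1 st2 _ isT isT en1).
    by split=> // z; rewrite inE /= => /negPf->.
  have e7' : vars st2 7 = u by rewrite /= ea v3' e7.
  have fl2 : filled (a * n.+1 * 3) st2 by [].
  clearbody st2.
  pose g b := 2410 + 600 * degree off u + 600 * degree off (oy (n - b)).
  apply: (run_for B100 (l := 0) (h := n.+1) (f := g)
    (Inv := fun b st' => filled ((a * n.+1 + b) * 3) st')) => //.
  + by lia.
  + by move=> st' ag /=; have [[[_ -> _ _] _ _ _ _] _ _] := env_ordered_agree ag isT isT en2.
  + by rewrite addn0.
  + move=> b st3 bn bnd3 ag3 eb fl3.
    have en3 := env_ordered_agree ag3 isT isT en2.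
    have [[[v3'' v4'' _ _] _ _ _ _] e7'' e9''] := en3.
    have bn' : b <= n by lia.
    have [rb ob] := rank_nth yord bn'.
    set v := oy (n - b) in rb ob.
    apply: (run_assign_cons B100) => //; first exact: (proj2 bnd3).
    set st4 := set_var _ _ _ => bnd4.
    have en4 : env_ordered st4.
      apply: (@env_ordered_agree [:: 15] [::] st3 st4 _ isT isT en3).
      by split=> // z; rewrite inE /= => /negPf->.
    have e15 : vars st4 15 = v by rewrite /= eb v3'' e9''.
    have e7c : vars st4 7 = u by rewrite /=; case: (ag3) => ->.
    have fl4 : filled ((a * n.+1 + b) * 3) st4 by [].
    clearbody st4.
    have ek : a * n.+1 + b = rank ox u * n.+1 + rank oy v by rewrite ra rb.
    apply: run_weaken (run_fill_row bnd4 en4 oa ob e7c e15 ek fl4) _ _.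
      by rewrite /g /= -/v; lia.
    by move=> st5 _ _; rewrite addnS.
  + rewrite sum_affine (ordering_volume yord) /f /= -/u; lia.
  + by move=> b st3 _ _ -> _; rewrite max0n addnC -mulSn.
- rewrite /f sum_affine (ordering_volume xord) subn0.
  move: (volume n off) => M; nia.
- by move=> a st1 _ _ -> _; rewrite max0n.
Qed.

Lemma key_lt s : config_ok n s -> key s < n.+1 * n.+1 * 3.
Proof.
case: s => [[u v] m] _; rewrite /key /=.
have rxu : rank ox u <= n by rewrite /rank leq_subr.
have ryv : rank oy v <= n by rewrite /rank leq_subr.
have : rank ox u * n.+1 + rank oy v < n.+1 * n.+1 by nia.
lia.
Qed.

(** Induction on the play: a lost entry would have only lost successors. *)
Lemma winning_filled st s : filled (n.+1 * n.+1 * 3) st -> config_ok n s ->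
  winning n E x y t1 t2 s -> arrs st 10 (Code s) != 0.
Proof.
move=> fl + win; elim: win => [|r r' st1 _ IH] ok; have [[_ lose] _ _] := fl _ ok (key_lt ok).
  by apply/eqP => /lose[].
have [ok' _] := step_key ok st1.
by apply/eqP => /lose[_ /(_ _ st1) T0]; move: (IH ok'); rewrite T0.
Qed.

(** Along a game a pebble never returns to a coordinate it has left, hence the
    replay never overwrites an output cell by another vertex. *)
Definition before (s s' : config) : Prop :=
  (s.1.1 = s'.1.1 \/ x s.1.1 < x s'.1.1) /\ (s.1.2 = s'.1.2 \/ y s.1.2 < y s'.1.2).

Lemma before_trans s1 s2 s3 : before s1 s2 -> before s2 s3 -> before s1 s3.
Proof.
case=> h1 h2 [h3 h4]; split.
  by case: h1 => [->//|h]; case: h3 => [<-|h']; right => //; apply: ltn_trans h'.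
by case: h2 => [->//|h]; case: h4 => [<-|h']; right => //; apply: ltn_trans h'.
Qed.

Lemma step_before s s' : Step s s' -> before s s'.
Proof.
have mv r r' : Move r r' -> before r r'.
  have arcZ t w w' (z : nat -> nat) : t < n -> (forall a, a < n -> z a <= n) ->
      z n = n + n + 2 -> pebble_arc n E z t w w' -> z w < z w'.
    move=> tn zn zb; rewrite /pebble_arc => /orP[/andP[_ /eqP->]|] //.
    by case/andP=> /eqP-> /eqP->; rewrite zb; have := zn t tn; lia.
  case: r r' => [[u v] m] [[u' v'] m'] /and3P[_ _]; case: ifP => _ /and3P[/eqP-> ar _].
    by split; [right; apply: arcZ t1n Xn Xbot ar|left].
  by split; [left|right; apply: arcZ t2n Yn Ybot ar].
case: s => [[u v] m] /orP[/mv//|/and3P[_ _ /orP[/mv|/mv]]] //.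
Qed.

Variables (iy : nat -> nat) (s1 s2 : nat).
Hypothesis s1n : s1 < n.
Hypothesis s2n : s2 < n.
Hypothesis xpos : forall u, u <= n -> 0 < x u.
Hypothesis iypos : forall v, v <= n -> 0 < iy v.
Hypothesis iy_inj : forall v w, v <= n -> w <= n -> iy v = iy w -> y v = y w.

Definition recorded (st : state) (s : config) : Prop :=
  arrs st 4 (x s.1.1 - 1) = s.1.1 /\ arrs st 5 (iy s.1.2 - 1) = s.1.2.

Let start : config := (s1, s2, 0).

(** The alternative at the end bounds the number of iterations: as long as the
    goal is not reached, each one lowers [key]. *)
Definition trace_inv (T : nat -> nat) (k : nat) (st : state) : Prop :=
  exists ss, let s := last start ss in
  [/\ path Step start ss /\ config_ok n s, vars st 22 = Code s, T (Code s) != 0,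
      forall r, r \in belast start ss ->
        [/\ config_ok n r, before r s & recorded st r] &
      s = goal_config n \/ (size ss = k /\ key s + k <= key start)].

Lemma run_trace_step T k st : bounded B st -> env_ordered st ->
  filled (n.+1 * n.+1 * 3) st -> arrs st 10 =1 T -> arrs st 13 =1 iy ->
  vars st 34 = Code (goal_config n) -> trace_inv T k st ->
  run B 60 trace_step st (trace_inv T k.+1).
Proof.
move=> bnd en fl eT eiy e34 [ss [[pss oks] e22 T0 rec fin]].
have [[[v3 v4 _ _] _ _ e6 _] _ _] := en.
set s := last start ss in oks e22 T0 rec fin.
have okg : config_ok n (goal_config n) by apply/and3P; split=> /=.
apply: run_test => //=; rewrite e22 e34.
  rewrite eqb0 negbK => /eqP e; have es : s = goal_config n by apply: code_inj e.
  by apply: run_skip => //; exists ss; split=> //; left.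
move/eqP; rewrite eqb0 => ne.
have ng : s <> goal_config n by move=> es; move: ne; rewrite es eqxx.
case: fin => [/ng//|[sz ks]].
have [[win _] eU eV] := fl s oks (key_lt oks).
have [|/ng//|[s' [st1 T1 e10]]] := win; first by rewrite eT.
have [oks' ks'] := step_key oks st1.
have [un vn m2] := and3P oks.
apply: (run_assign_cons B100) => //; first exact: (proj2 bnd).
move=> bnd1; apply: (run_assign_cons B100) => //; first exact: (proj2 bnd1).
move=> bnd2; apply: (run_store_cons B100) => //; first exact: (proj1 bnd2).
move=> bnd3; apply: (run_store_cons B100) => //; first exact: (proj1 bnd3).
move=> bnd4; apply: (run_assign B100) => //.
  by rewrite /= e22 e10 subn1; have := code_lt Bn oks'; lia.
rewrite /= e22 eU eV e6 eiy e10.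
exists (rcons ss s'); rewrite last_rcons; split.
- by rewrite rcons_path pss.
- by rewrite /= subn1.
- by rewrite -eT.
- move=> r; rewrite belast_rcons lastI mem_rcons inE -/s => rin.
  have [okr bf] : config_ok n r /\ before r s.
    by case/orP: rin => [/eqP->|/rec[? ? _]]; split=> //; split; left.
  split=> //; first by apply: before_trans bf _; apply: step_before.
  rewrite /recorded /= ?eqxx /=.
  have [rxn rvn _] := and3P okr.
  case/orP: rin => [/eqP->|/rec[_ _ [r1 r2]]]; first by rewrite !eqxx.
  split; case: eqP => // e.
    case: bf => -[-> //|lt] _.
    by have := xpos rxn; have := xpos un; lia.
  case: bf => _ [-> //|lt].
  have := iypos rvn; have := iypos vn => p1 p2.
  have eiyr : iy r.1.2 = iy s.1.2 by move: e p1 p2; move: (iy _) (iy _) => a b; lia.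
  by have := iy_inj rvn vn eiyr; move=> eyy; move: lt; rewrite eyy ltnn.
- by right; rewrite size_rcons sz; split=> //; lia.
Qed.

(** The array 13 gives the output position for the second path.  It is a copy of
    the original Y, which differs from the coordinate in use when the second path
    is reversed. *)
Lemma run_attempt st : bounded B st -> env_ordered st -> arrs st 13 =1 iy ->
  vars st 31 = s1 -> vars st 32 = s2 ->
  run B (4000 * (n.+1 * n.+1) + 1300 * (n.+1 * volume n off)) attempt st (fun st' =>
    if vars st' 0 == 0 then ~ winning n E x y t1 t2 start
    else exists ss, [/\ path Step start ss, last start ss = goal_config n &
      forall r, r \in belast start ss -> recorded st' r]).
Proof.
move=> bnd en eiy e31 e32.
have [M eM] : exists M, M = n.+1 * n.+1 by eexists.
have M0 : 0 < M by rewrite eM.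
have [N eN] : exists N, N = n.+1 * volume n off by eexists.
apply: (run_cons (run_fill_table bnd en)); rewrite -?eM -?eN; first by lia.
move=> st1 bnd1 ag1 fl1.
have en1 := env_ordered_agree ag1 isT isT en.
have [[[v3 v4 _ _] _ _ _ _] _ _] := en1.
have eiy1 : arrs st1 13 =1 iy by move=> i; case: (ag1) => _ ->.
have [e31' e32'] : vars st1 31 = s1 /\ vars st1 32 = s2.
  by case: (ag1) => agv _; split; rewrite agv.
have oks : config_ok n start by apply/and3P; split=> //=; exact: ltnW.
have okg : config_ok n (goal_config n) by apply/and3P; split=> /=.
have cB := code_lt Bn oks; have gB := code_lt Bn okg.
have [ec eg] : Code start = s1 * n.+1 + s2 /\ Code (goal_config n) = n * n.+1 + n by [].
apply: (run_assign_cons B100) => //; [by rewrite /=; lia|by rewrite /= v4 e31' e32'; lia|].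
move=> bnd2; apply: (run_assign_cons B100) => //; [by rewrite /=; lia|by rewrite /= v4 v3; lia|].
move=> bnd3; apply: (run_assign_cons B100) => //; [by rewrite /=; lia|by rewrite /= v4; lia|].
set st4 := set_var _ 33 _ => bnd4.
have ag4 : agree [:: 22; 34; 33] [::] st1 st4.
  split=> // z; rewrite !inE !negb_or => /and3P[z1 z2 z3] /=.
  by rewrite (negPf z1) (negPf z2) (negPf z3).
have en4 := env_ordered_agree ag4 isT isT en1.
have [e22 e34 e33] : [/\ vars st4 22 = Code start, vars st4 34 = Code (goal_config n) &
    vars st4 33 = n.+1 * n.+1 * 3].
  by rewrite /= v3 v4 e31' e32'.
have eiy4 : arrs st4 13 =1 iy by [].
have fl4 : filled (M * 3) st4 by [].
clearbody st4.
apply: run_test => //; [by rewrite /=; lia| |]; rewrite /= e22 => T0; last first.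
  apply: (run_assign B100) => //=; [by lia|by lia|].
  move=> win; have := winning_filled (s := start) (st := st4).
  by rewrite -eM => /(_ fl4 oks win); rewrite T0.
apply: (@run_cons _ _ (50 + 80 * (M * 3)) _ _ _ (trace_inv (arrs st4 10) (M * 3))); last first.
- move=> st5 bnd5 ag5 [ss [[pss _] _ _ rec fin]].
  apply: (run_assign B100) => //; [by rewrite /=; lia|by rewrite /=; lia|].
  rewrite /=; exists ss; split=> //.
    case: fin => // -[_ ]; have := key_lt oks; rewrite -eM; lia.
  by move=> r /rec[].
- by rewrite /=; lia.
- apply: (run_for B100 (l := 0) (h := M * 3) (f := fun _ => 60)
    (Inv := trace_inv (arrs st4 10))) => //.
  + by lia.
  + by have := B100; lia.
  + by move=> st5 ag5 /=; case: (ag5) => -> // _; rewrite e33 eM.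
  + exists [::]; split=> //=; right; split=> //; by rewrite addn0.
  + move=> k st5 _ bnd5 ag5 _ inv5.
    have en5 := env_ordered_agree ag5 isT isT en4.
    apply: run_weaken (run_trace_step (T := arrs st4 10) (k := k) bnd5 en5 _ _ _ _ inv5) _ _ => //.
    * rewrite -eM; apply: filled_ext fl4 => b; rewrite !inE => b3.
      by move=> i; case: (ag5) => _ -> //=; rewrite !inE; case/or3P: b3 => /eqP->.
    * by move=> i; case: (ag5) => _ ->.
    * by move=> i; case: (ag5) => _ ->.
    * by case: (ag5) => ->.
  + by rewrite sum_nat_const_nat; lia.
  + by move=> k st5 _ _ -> _; rewrite max0n.
Qed.

End Fill.

(** * Shortest paths as plays of the game *)

Section Routes.

Variables (n : nat) (E : rel nat) (off nbr : nat -> nat).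
Hypothesis G : csr n E off nbr.

Definition climb (z : nat -> nat) (u w : nat) : bool := E u w && (z w == (z u).+1).

Definition route (z : nat -> nat) (s t : nat) (p : seq nat) : Prop :=
  [/\ sorted (climb z) p, head n p = s, last n p = t, p <> [::] & s < n].

Lemma route_lt z s t p : route z s t p -> all (fun u => u < n) p.
Proof.
case: p => [|a p] [//= pp ea _ _ sn]; subst a; rewrite sn /=.
elim: p s {sn} pp => //= b p IH a /andP[/andP[/(csr_lt G)/andP[_ ->] _] pp] /=.
exact: IH pp.
Qed.

Lemma chain_route z s t p : s < n -> t < n -> chain n E z t s p -> route z s t p.
Proof.
case: p => [|a p] sn tn [/= hd pp]; first by rewrite hd ltnn in sn.
subst a; suff [h1 h2] : path (climb z) s p /\ last s p = t.
  by split=> //=; case: p h2 {pp h1} => //= b p.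
elim: p s sn pp => [|b p IH] s sn /=.
  rewrite andbT /pebble_arc => /orP[/andP[/(csr_lt G)]|/andP[/eqP-> _]//].
  by rewrite ltnn andbF.
case/andP=> ar pp.
have dead c : pebble_arc n E z t n c = false.
  apply/negbTE; rewrite /pebble_arc negb_or negb_and; apply/andP; split.
    by apply/orP; left; apply/negP => /(csr_lt G); rewrite ltnn.
  by rewrite eq_sym (ltn_eqF tn).
have cl : climb z s b.
  case/orP: ar => // /andP[_ /eqP eb]; subst b.
  by case: p pp {IH} => [|c p] /=; rewrite dead.
have bn : b < n by case/andP: cl => /(csr_lt G)/andP[].
by have [h1 h2] := IH b bn pp; rewrite cl.
Qed.

Lemma route_chain z s t p : route z s t p -> chain n E z t s p.
Proof.
case: p => [|a p] [//= pp ea lp _ sn]; subst a; split=> //=.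
rewrite rcons_path lp /pebble_arc !eqxx orbT andbT.
by apply: sub_path pp => u w; rewrite /climb => ->.
Qed.

Lemma route_nth z s t p : route z s t p -> z s = 1 ->
  forall i, i < size p -> z (nth n p i) = i.+1.
Proof.
move=> [/(sortedP n) sp hp _ pn _] zs; elim=> [|i IH] ip.
  by rewrite nth0 hp.
by have /andP[_ /eqP->] := sp i ip; rewrite IH // ltnW.
Qed.

Lemma route_last_size z s t p : route z s t p -> z s = 1 -> z t = size p.
Proof.
move=> r zs; have nthE := route_nth r zs; have [_ _ lp pn _] := r.
case: p lp pn nthE {r} => // a p /= lp _ nthE.
by have := nthE (size p) (ltnSn _); rewrite -last_nth -lp.
Qed.

Lemma route_edges z s t p : route z s t p -> sorted E p.
Proof. by case=> + _ _ _ _; apply: sub_sorted => u w /andP[]. Qed.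

(** Reversing a path and mirroring its coordinate restores the unit steps. *)
Lemma route_rev z s t p : (forall u, u < n -> z u <= n) -> t < n ->
  route z s t p -> route (mirror n z) t s (rev p).
Proof.
move=> zn tn r; have := route_lt r; have [sp hp lp pn sn] := r => /allP ltp.
split=> //.
- rewrite rev_sorted; apply: sub_sorted sp => u w /andP[e /eqP zw].
  have /andP[un wn] := csr_lt G e; rewrite /climb (csr_sym G e) /mirror un wn zw.
  by have := zn w wn; rewrite zw; lia.
- by case/lastP: p lp pn {r sp hp ltp} => // p a; rewrite last_rcons rev_rcons.
- by case: p hp pn {r sp lp ltp} => // a p; rewrite rev_cons last_rcons.
- by move/(congr1 rev); rewrite revK.
Qed.

Lemma mirror_route_rev z s t p : (forall u, u < n -> z u <= n) -> t < n ->
  route (mirror n z) s t p -> route z t s (rev p).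
Proof.
move=> zn tn r; have := route_lt r; have [sp hp lp pn sn] := r => /allP ltp.
split=> //.
- rewrite rev_sorted; apply: sub_sorted sp => u w /andP[e /eqP zw].
  have /andP[un wn] := csr_lt G e; rewrite /climb (csr_sym G e) /=.
  by move: zw; rewrite /mirror un wn; have := zn w wn; have := zn u un; lia.
- by case/lastP: p lp pn {r sp hp ltp} => // p a; rewrite last_rcons rev_rcons.
- by case: p hp pn {r sp lp ltp} => // a p; rewrite rev_cons last_rcons.
- by move/(congr1 rev); rewrite revK.
Qed.

Lemma layering_ordering s d o : layering n E s d o -> ordering n d o.
Proof.
move=> [_ pos _ _ dn on perm srt].
have mk : mkseq o n.+1 = rcons (mkseq o n) n.
  by rewrite /mkseq -addn1 iotaD map_cat /= add0n on cats1.
split.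
  by rewrite mk -addn1 iotaD /= add0n cats1 perm_rcons perm_sym perm_rcons perm_sym perm_cons.
have on' a : a < n -> o a < n.
  move=> an; have : o a \in mkseq o n by apply: map_f; rewrite mem_iota.
  by rewrite (perm_mem perm) mem_iota.
move=> a b an bn lt; rewrite ltnNge; apply/negP => ba.
have [ea|na] := eqVneq a n.
  subst a; move: lt; rewrite on dn; have [->|nb] := eqVneq b n; first by rewrite on dn; lia.
  by have := pos _ (on' b ltac:(lia)); lia.
have an' : a < n by lia.
have bn' : b < n by apply: leq_ltn_trans an'.
have : d (o b) <= d (o a).
  have := sorted_leq_nth leq_trans leqnn 0 srt.
  move=> /(_ b a); rewrite !inE size_map size_mkseq => /(_ bn' an' ba).
  by rewrite !(nth_map 0) ?size_mkseq ?size_iota // !nth_iota.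
by lia.
Qed.

Lemma mirror_ordering s d o : layering n E s d o ->
  ordering n (mirror n d) (fun i => if i < n then o (n - i.+1) else o i).
Proof.
move=> lay; have ord := layering_ordering lay.
case: lay => _ pos _ _ dn on perm srt.
have on' a : a < n -> o a < n.
  move=> an; have : o a \in mkseq o n by apply: map_f; rewrite mem_iota.
  by rewrite (perm_mem perm) mem_iota.
set o' := (fun i => _).
have mk : mkseq o' n.+1 = rcons (rev (mkseq o n)) n.
  rewrite /mkseq -addn1 iotaD map_cat /= add0n /o' ltnn on cats1; congr rcons.
  apply: (@eq_from_nth _ 0); rewrite ?size_rev !size_map //.
  move=> i; rewrite size_iota => iN; rewrite nth_rev !size_map size_iota //.
  by rewrite !(nth_map 0) ?size_iota ?nth_iota ?add0n ?iN //; lia.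
split.
  rewrite mk -addn1 iotaD /= add0n cats1 perm_rcons perm_sym perm_rcons perm_sym perm_cons.
  by rewrite perm_rev.
have low a : a < n -> mirror n d (o' a) = n.+1 - d (o (n - a.+1)).
  by move=> an; rewrite /mirror /o' an on' //; lia.
have top : mirror n d (o' n) = n + n + 2 by rewrite /mirror /o' ltnn on ltnn.
move=> a b an bn; have [an'|na] := ltnP a n; last first.
  have -> : a = n by lia.
  rewrite top; have [bn'|nb] := ltnP b n; first by rewrite low //; lia.
  have -> : b = n by lia.
  by rewrite top ltnn.
have [bn'|nb] := ltnP b n; last by lia.
rewrite !low // => lt; have la : n - a.+1 <= n by lia.
have lb : n - b.+1 <= n by lia.
have ltd : d (o (n - b.+1)) < d (o (n - a.+1)) by lia.
by have := ord_mono ord lb la ltd; lia.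
Qed.

(** The properties of a distance layering that survive [mirror]. *)
Record coordinate (z : nat -> nat) : Prop := Coordinate {
  coord_edge : forall u w, E u w -> (z w <= (z u).+1) && (z u <= (z w).+1);
  coord_pos : forall u, u < n -> 0 < z u <= n;
  coord_bot : z n = n + n + 2 }.

Lemma layering_coordinate s d o : layering n E s d o -> coordinate d.
Proof.
move=> lay; split; [|exact: lay_pos lay|exact: lay_bot lay].
by move=> u w e; rewrite (lay_edge lay e) (lay_edge lay (csr_sym G e)).
Qed.

Lemma mirror_coordinate z : coordinate z -> coordinate (mirror n z).
Proof.
move=> cz; split.
- move=> u w e; have /andP[un wn] := csr_lt G e; rewrite /mirror un wn.
  by have := coord_edge cz e; have := coord_pos cz un; have := coord_pos cz wn; lia.
- by move=> u un; rewrite /mirror un; have := coord_pos cz un; lia.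
- by rewrite /mirror ltnn; apply: coord_bot.
Qed.

Lemma coord_le z u : coordinate z -> u < n -> z u <= n.
Proof. by move=> cz un; case/andP: (coord_pos cz un). Qed.

Section Game.

Variables (x y : nat -> nat) (s1 s2 t1 t2 : nat).
Hypothesis cx : coordinate x.
Hypothesis cy : coordinate y.
Hypothesis (s1n : s1 < n) (s2n : s2 < n) (t1n : t1 < n) (t2n : t2 < n).

Lemma play_routes ss :
  path (pebble_step n E x y t1 t2) (s1, s2, 0) ss ->
  last (s1, s2, 0) ss = goal_config n ->
  exists p q, [/\ route x s1 t1 p, route y s2 t2 q,
    forall w, w \in p -> w \in q -> False,
    forall w, w \in p -> exists2 r, r \in belast (s1, s2, 0) ss & r.1.1 = w &
    forall w, w \in q -> exists2 r, r \in belast (s1, s2, 0) ss & r.1.2 = w].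
Proof.
move=> pss lss; have pre : mode_pre x y (s1, s2, 0) by [].
have [p [q [cp cq [dis _ _ _] inp inq]]] := pebble_sound (csr_lt G) (coord_edge cx)
  (coord_edge cy) (fun u => coord_le cx (u := u)) (fun u => coord_le cy (u := u))
  (coord_bot cx) (coord_bot cy) t1n t2n pss lss pre.
have rp := chain_route s1n t1n cp; have rq := chain_route s2n t2n cq.
exists p, q; split=> //.
- move=> w wp; have [r] := inp w wp; rewrite lastI mem_rcons inE lss.
  case/orP=> [/eqP-> ewn|ri <-]; last by exists r.
  by have := allP (route_lt rp) w wp; rewrite -ewn ltnn.
- move=> w wq; have [r] := inq w wq; rewrite lastI mem_rcons inE lss.
  case/orP=> [/eqP-> ewn|ri <-]; last by exists r.
  by have := allP (route_lt rq) w wq; rewrite -ewn ltnn.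
Qed.

Lemma routes_winning P Q : route x s1 t1 P -> route y s2 t2 Q ->
  (forall w, w \in P -> w \in Q -> False) -> ~ crossing n x y P Q ->
  winning n E x y t1 t2 (s1, s2, 0).
Proof.
move=> rP rQ dis nc.
have [hp sp] := route_chain rP; have [hq sq] := route_chain rQ.
have := pebble_complete (csr_lt G) (coord_edge cx)
  (coord_edge cy) (fun u => coord_le cx (u := u)) (fun u => coord_le cy (u := u))
  (coord_bot cx) (coord_bot cy) t1n t2n sp sq dis nc.
by rewrite !nth0 hp hq.
Qed.

End Game.

(** Disjoint paths that could be played in neither game would cross along an
    antidiagonal in both pictures. *)
Lemma no_routes x y s1 s2 t1 t2 P Q : coordinate x -> coordinate y ->
  x s1 = 1 -> y s2 = 1 -> s1 < n -> s2 < n -> t1 < n -> t2 < n ->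
  ~ winning n E x y t1 t2 (s1, s2, 0) ->
  ~ winning n E x (mirror n y) t1 s2 (s1, t2, 0) ->
  route x s1 t1 P -> route y s2 t2 Q ->
  (forall w, w \in P -> w \in Q -> False) -> False.
Proof.
move=> cx cy xs ys s1n s2n t1n t2n lose lose' rP rQ dis.
apply: lose; apply: (routes_winning cx cy _ _ rP rQ dis) => // cr.
have rQ' := route_rev (fun u => coord_le cy (u := u)) t2n rQ.
apply: lose'; apply: (routes_winning cx (mirror_coordinate cy) _ _ rP rQ') => //.
  by move=> w wP; rewrite mem_rev; apply: dis.
apply: (crossing_exclusive (csr_lt G) (coord_edge cx) (coord_edge cy)
  (fun u => coord_le cy (u := u)) (route_edges rP) (route_edges rQ)) cr => i ip.
  by split; [apply: (allP (route_lt rP)); apply: mem_nth|apply: route_nth rP xs i ip].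
by split; [apply: (allP (route_lt rQ)); apply: mem_nth|apply: route_nth rQ ys i ip].
Qed.

End Routes.

(** * The input graph and its shortest paths *)

Section Input.

Variables (n : nat) (e : rel 'I_n) (L : 'I_n -> seq 'I_n).
Hypothesis e_sym : symmetric e.
Hypothesis e_irr : irreflexive e.
Hypothesis e_conn : connected_graph e.
Hypothesis L_adj : adjacency_lists e L.

Definition edge_nat (u w : nat) : bool :=
  if insub u is Some i then if insub w is Some j then e i j else false else false.

Lemma edge_natE (i j : 'I_n) : edge_nat i j = e i j.
Proof. by rewrite /edge_nat !valK. Qed.

Lemma edge_natP u w : edge_nat u w ->
  exists i j : 'I_n, [/\ u = i, w = j & e i j].
Proof.
rewrite /edge_nat; case: insubP => // i _ <-; case: insubP => // j _ <- ij.
by exists i, j.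
Qed.

Definition row_nat (u : nat) : seq nat :=
  if insub u is Some i then [seq val v | v <- L i] else [::].

Lemma row_natE (i : 'I_n) : row_nat i = [seq val v | v <- L i].
Proof. by rewrite /row_nat valK. Qed.

Lemma neighboursE : neighbours L = flatten (mkseq row_nat n).
Proof.
rewrite /neighbours map_flatten -map_comp /mkseq -val_enum_ord -map_comp.
by congr flatten; apply: eq_map => i /=; rewrite row_natE.
Qed.

Lemma offsetsE u : u <= n -> nth 0 (offsets L) u = size (flatten (mkseq row_nat u)).
Proof.
move=> un; rewrite nth_mkseq // size_flatten /shape sumnE !big_map.
have -> : iota 0 u = index_iota 0 u by rewrite /index_iota subn0.
rewrite big_mkord (big_ord_widen n (fun w => size (row_nat w)) un).
by apply: eq_bigr => i _; rewrite row_natE size_map.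
Qed.

Lemma offsets_next u : u < n ->
  nth 0 (offsets L) u.+1 = nth 0 (offsets L) u + size (row_nat u).
Proof.
move=> un; rewrite !offsetsE ?(ltnW un) //.
by rewrite /mkseq -addn1 iotaD map_cat flatten_cat size_cat /= cats0.
Qed.

Lemma neighbours_row u k : u < n -> k < size (row_nat u) ->
  nth 0 (neighbours L) (nth 0 (offsets L) u + k) = nth 0 (row_nat u) k.
Proof.
move=> un kr; rewrite offsetsE 1?ltnW // neighboursE.
have -> : mkseq row_nat n = mkseq row_nat u ++ row_nat u :: map row_nat (iota u.+1 (n - u.+1)).
  rewrite /mkseq -{1}(subnKC (ltnW un)) iotaD map_cat add0n; congr (_ ++ _).
  by rewrite -[n - u]prednK ?subn_gt0 // -subnS.
by rewrite flatten_cat nth_cat ltnNge leq_addr /= addKn nth_cat kr.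
Qed.

Lemma input_csr : csr n edge_nat (nth 0 (offsets L)) (nth 0 (neighbours L)).
Proof.
split.
- by move=> u w /edge_natP[i [j [-> -> _]]]; rewrite !ltn_ord.
- by move=> u w /edge_natP[i [j [-> -> ij]]]; rewrite edge_natE e_sym.
- move=> u w un; pose i := Ordinal un; have [_ memL] := L_adj i.
  have eu : u = i by [].
  split=> [/edge_natP[i' [j [ui -> ij]]]|[k]].
    have ei : i' = i by apply: val_inj.
    have jr : val j \in row_nat u by rewrite eu row_natE mem_map ?memL -?ei //; exact: val_inj.
    exists (nth 0 (offsets L) u + index (val j) (row_nat u)).
      by rewrite leq_addr offsets_next // ltn_add2l index_mem.
    by rewrite neighbours_row ?index_mem // nth_index.
  rewrite offsets_next // => /andP[uk ku] <-.
  have kr : k - nth 0 (offsets L) u < size (row_nat u) by rewrite ltn_subLR.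
  rewrite -(subnKC uk) neighbours_row //; move: (mem_nth 0 kr).
  set r := nth 0 (row_nat u) _; rewrite (row_natE i : row_nat u = _) => /mapP[j jL ->].
  by rewrite (edge_natE i j : edge_nat u _ = _) -memL.
- by rewrite nth_default // size_mkseq.
Qed.

(** Each edge is counted once from either end; the pairs with decreasing entries
    are the swapped edges. *)
Lemma input_volume : volume n (nth 0 (offsets L)) = 2 * num_edges e.
Proof.
rewrite /volume big_mkord.
have -> : \sum_(i < n) degree (nth 0 (offsets L)) i = \sum_(i < n) \sum_(j < n) (e i j : nat).
  apply: eq_bigr => i _; rewrite /degree offsets_next // addKn row_natE size_map.
  have [uq memL] := L_adj i.
  rewrite -(card_uniqP uq) -sum1_card big_mkcond /=; apply: eq_bigr => j _.
  by rewrite memL; case: (e i j).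
rewrite pair_big /=.
have -> : \sum_(p : 'I_n * 'I_n) (e p.1 p.2 : nat) = #|[set p : 'I_n * 'I_n | e p.1 p.2]|.
  rewrite -sum1_card [RHS]big_mkcond /=; apply: eq_bigr => p _; rewrite inE.
  by case: (e _ _).
rewrite -(cardsID [set p : 'I_n * 'I_n | p.1 < p.2]) mul2n -addnn; congr (_ + _).
  by apply: eq_card => p; rewrite !inE.
pose swap (p : 'I_n * 'I_n) := (p.2, p.1).
have swap_inj : injective swap by move=> [a b] [a' b'] [-> ->].
rewrite /num_edges -[RHS](card_imset _ swap_inj); apply: eq_card => -[i j].
rewrite !inE /=; apply/andP/imsetP => [[nlt eij]|[[i' j']]]; last first.
  by rewrite !inE /= => /andP[eij lt] [-> ->]; rewrite e_sym eij -leqNgt ltnW.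
exists (j, i) => //; rewrite !inE /= e_sym eij ltn_neqAle leqNgt nlt andbT.
by apply/eqP => /val_inj ji; rewrite ji e_irr in eij.
Qed.

Lemma input_connected (s : 'I_n) w : w < n ->
  exists2 p, path edge_nat s p & last (val s) p = w.
Proof.
move=> wn; have /connectP[p pp lp] := e_conn s (Ordinal wn).
exists (map val p); last by rewrite last_map -lp.
by rewrite path_map; apply: sub_path pp => a b; rewrite /= edge_natE.
Qed.

(** A connected graph on two or more vertices has no isolated vertex.  The term 1
    accounts for the graph with one vertex. *)
Lemma vertices_le_volume : n * n <= n * volume n (nth 0 (offsets L)) + 1.
Proof.
have [n1|n1] := leqP n 1.
  by apply: leq_trans (leq_mul n1 n1) _; rewrite addn1.
suff : n <= volume n (nth 0 (offsets L)) by move=> h; have := leq_mul (leqnn n) h; lia.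
rewrite /volume -{1}[n]subn0 -[n - 0]muln1 -sum_nat_const_nat; rewrite !big_mkord.
apply: leq_sum => i _; rewrite /degree offsets_next // addKn row_natE size_map.
pose j : 'I_n := if val i == 0 then Ordinal n1 else Ordinal (ltnW n1).
have ij : i != j.
  by rewrite /j -val_eqE; case: (val i =P 0) => [e0|/eqP] /=; rewrite ?[nat_of_ord _]e0.
have /connectP[p pp lp] := e_conn i j.
case: p pp lp => [_ /= ji|a p /= /andP[ia _] _]; first by rewrite ji eqxx in ij.
have [_ memL] := L_adj i.
by move: ia; rewrite -memL; case: (L i).
Qed.

Lemma lipschitz_path (z : nat -> nat) (s : nat) p :
  (forall u w, edge_nat u w -> z w <= (z u).+1) -> path edge_nat s p ->
  z (last s p) <= z s + size p.
Proof.
move=> ze; elim: p s => [|a p IH] s /=; first by rewrite addn0.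
by move=> /andP[/ze sa /IH]; lia.
Qed.

Section Shortest.

Variables (s : 'I_n) (d o : nat -> nat).
Hypothesis lay : layering n edge_nat s d o.

Lemma is_path_nat (t : 'I_n) P : is_path e s t P ->
  [/\ sorted edge_nat (map val P), head n (map val P) = s,
      last n (map val P) = t & P <> [::]].
Proof.
case: P => [|z p] //= /and4P[/eqP-> pp /eqP lp _]; split=> //.
  by rewrite path_map; apply: sub_path pp => a b; rewrite /= edge_natE.
by rewrite last_map lp.
Qed.

Lemma is_path_size (t : 'I_n) P : is_path e s t P -> d t <= size P.
Proof.
case: P => // z p H; have [/= pp ez lp _] := is_path_nat H.
have := lipschitz_path (lay_edge lay) pp.
by rewrite lp size_map ez (lay_src lay).
Qed.

(** No path reaches a vertex in fewer steps than its distance, and unit steps in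
    the distance use exactly that many. *)
Lemma route_shortest (t : 'I_n) p : route n edge_nat d s t p ->
  exists P, map val P = p /\ shortest_path e s t P.
Proof.
move=> r; have ltp := route_lt input_csr r.
have [P eP] : exists P : seq 'I_n, map val P = p.
  elim: p ltp {r} => [|a p IH] /=; first by exists [::].
  by case/andP=> an /IH[P <-]; exists (Ordinal an :: P).
exists P; split=> //; have [sp hp lp pn _] := r.
have szP : d t = size P.
  by rewrite (route_last_size r (lay_src lay)) -eP size_map.
have nthE := route_nth r (lay_src lay).
split; last first.
  by move=> Q /is_path_size; rewrite szP /path_length -!subn1; apply: leq_sub2r.
have uqP : uniq P.
  rewrite -(map_inj_uniq val_inj) eP; apply/(uniqP n) => i j.
  rewrite !inE => ip jp eij; have := nthE i ip; have := nthE j jp.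
  by rewrite eij => -> [].
case: P eP uqP {szP} => [|z P] eP uqP; first by rewrite -eP in pn.
move: sp hp lp; rewrite -eP /= => sp hp lp.
have ez : z = s by apply: val_inj.
rewrite /= ez eqxx; subst z; apply/and3P; split=> //; last 1 first.
  by move: uqP => /= ->; rewrite andbT; apply/eqP; apply: val_inj; rewrite /= -lp last_map.
move: sp; rewrite path_map; apply: sub_path => a b /=.
by rewrite /climb edge_natE => /andP[].
Qed.

(** A shortest path has as many vertices as the label of its end, and labels grow
    by at most one per step; so no step can be wasted. *)
Lemma shortest_route (t : 'I_n) P : shortest_path e s t P ->
  route n edge_nat d s t (map val P).
Proof.
case=> pathP minP; have [sp hp lp pn] := is_path_nat pathP.
have szP : size P = d t.
  apply/eqP; rewrite eqn_leq is_path_size // andbT.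
  have [q [pq lq sq]] := lay_path lay (ltn_ord t).
  have [r [rs rp]] : exists r, map val r = q /\ path e s r.
    elim: q (s) pq {lq sq} => [|a q IH] i /=; first by exists [::].
    case/andP=> ia pq; have [i' [j [_ ea _]]] := edge_natP ia; subst a.
    have [r [er pr]] := IH j pq; exists (j :: r); rewrite /= er pr.
    by rewrite -edge_natE ia.
  have lr : last s r = t by apply: val_inj; rewrite /= -lq -rs last_map.
  case: (shortenP rp) lr => r' pr' ur' sub lr'.
  have /minP : is_path e s t (s :: r') by rewrite /is_path eqxx pr' lr' eqxx ur'.
  rewrite /path_length /= => le; rewrite -sq -rs size_map.
  have : size r' <= size r by apply: uniq_leq_size => //; case/andP: ur'.
  by move=> rr; have := leq_trans le rr; case: (size P).
have cd := layering_coordinate input_csr lay.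
have lip := lipschitz_along n (coord_edge cd) sp.
have sz : size (map val P) = d t by rewrite size_map.
have pos : 0 < d t by case/andP: (coord_pos cd (ltn_ord t)).
have dE i : i < size (map val P) -> d (nth n (map val P) i) = i.+1.
  rewrite sz => id; have := lip 0 i; have := lip i (d t).-1.
  have -> : nth n (map val P) (d t).-1 = t by rewrite -sz nth_last.
  rewrite nth0 hp (lay_src lay) sz; set a := d (nth _ _ _).
  by move=> /(_ id ltac:(lia)) h1 /(_ pos id) h2; lia.
split=> //; first apply/(sortedP n) => i ip.
  rewrite /climb !dE ?(ltnW ip) // eqxx andbT.
  exact: (sortedP n sp).
by move/(congr1 size); rewrite sz => dt0; rewrite dt0 in pos.
Qed.

End Shortest.

End Input.

(** * The complete search *)

(** Arrays 13 and 14 keep Y and its enumeration, which are overwritten for the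
    second game. *)
Definition save_second : cmd :=
  For 12 (Const 0) (Var 4)
    (Seq (Store 13 (Var 12) (Get 8 (Var 12))) (Store 14 (Var 12) (Get 9 (Var 12)))).

(** Mirrors Y, reverses its enumeration, and exchanges source and target of the
    second path in the variables 32 and 24. *)
Definition reverse_second : cmd :=
  Seq (For 12 (Const 0) (Var 3)
        (Seq (Store 8 (Var 12) (Defs.Sub (Var 4) (Get 13 (Var 12))))
             (Store 9 (Var 12) (Get 14 (Defs.Sub (Var 3) (Add (Var 12) (Const 1))))))) (
  Seq (Assign 35 (Var 32)) (
  Seq (Assign 32 (Var 24))
      (Assign 24 (Var 35)))).

Definition search : cmd :=
  Seq (Assign 5 (Var 31)) (
  Seq (bfs 6 7) (
  Seq (Assign 5 (Var 32)) (
  Seq (bfs 8 9) (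
  Seq save_second (
  Seq (Assign 1 (Get 6 (Var 23))) (
  Seq (Assign 2 (Get 8 (Var 24))) (
  Seq attempt
      (If (Var 0) Skip (Seq reverse_second attempt))))))))).

(** Variables 31 and 32 hold the sources, 23 and 24 the targets. *)
Definition dsp_program : cmd :=
  Seq (Assign 3 (Var 0)) (
  Seq (Assign 4 (Add (Var 3) (Const 1))) (
  Seq (Assign 31 (Get 2 (Const 0))) (
  Seq (Assign 32 (Get 2 (Const 1))) (
  Seq (Assign 23 (Get 3 (Const 0))) (
  Seq (Assign 24 (Get 3 (Const 1)))
      search))))).

Section Search.

Variables (B n : nat) (E : rel nat) (off nbr : nat -> nat) (s1 s2 t1 t2 : nat).
Hypothesis Bn : 9 * (n.+1 * n.+1) + 100 <= B.
Hypothesis G : csr n E off nbr.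
Hypothesis (s1n : s1 < n) (s2n : s2 < n) (t1n : t1 < n) (t2n : t2 < n).
Hypothesis conn : forall s w, s < n -> w < n -> exists2 p, path E s p & last s p = w.

Let B100 : 100 <= B. Proof. by lia. Qed.

(** The second path runs from a2 to b2, so that the statement serves both the
    original and the reversed second path. *)
Lemma run_attempt_routes x y ox oy iy a2 b2 st :
  coordinate n E x -> coordinate n E y -> ordering n x ox -> ordering n y oy ->
  a2 < n -> b2 < n -> (forall v, v <= n -> 0 < iy v) ->
  (forall v w, v <= n -> w <= n -> iy v = iy w -> y v = y w) ->
  bounded B st -> env_ordered n off nbr x y ox oy t1 b2 st -> arrs st 13 =1 iy ->
  vars st 31 = s1 -> vars st 32 = a2 ->
  run B (4000 * (n.+1 * n.+1) + 1300 * (n.+1 * volume n off)) attempt st (fun st' =>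
    if vars st' 0 == 0 then ~ winning n E x y t1 b2 (s1, a2, 0)
    else exists p q, [/\ route n E x s1 t1 p, route n E y a2 b2 q,
      forall w, w \in p -> w \in q -> False,
      forall w, w \in p -> arrs st' 4 (x w - 1) = w &
      forall w, w \in q -> arrs st' 5 (iy w - 1) = w]).
Proof.
move=> cx cy xo yo a2n b2n ipos iinj bnd en e13 e31 e32.
have xpos u : u <= n -> 0 < x u.
  rewrite leq_eqVlt => /orP[/eqP->|un]; first by rewrite (coord_bot cx); lia.
  by case/andP: (coord_pos cx un).
apply: run_weaken (run_attempt Bn G t1n b2n xo yo (fun u => coord_le cx (u := u))
  (fun u => coord_le cy (u := u)) (coord_bot cx) (coord_bot cy) s1n a2n xpos ipos iinj
  bnd en e13 e31 e32) (leqnn _) _.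
move=> st' _ _; case: ifP => // _ [ss [pss lss rec]].
have [p [q [rp rq dis inp inq]]] := play_routes G cx cy s1n a2n t1n b2n pss lss.
exists p, q; split=> //.
  by move=> w /inp[r /rec[h _] <-].
by move=> w /inq[r /rec[_ h] <-].
Qed.

Lemma run_save_second y oy st : bounded B st -> graph_at n off nbr st ->
  arrs st 8 =1 y -> arrs st 9 =1 oy ->
  run B (100 + 60 * n) save_second st (fun st' =>
    forall i, i <= n -> arrs st' 13 i = y i /\ arrs st' 14 i = oy i).
Proof.
move=> bnd gr e8 e9; have [v3 v4 _ _] := gr.
apply: (run_for B100 (l := 0) (h := n.+1) (f := fun _ => 20)
  (Inv := fun k st' => forall i, i < k -> arrs st' 13 i = y i /\ arrs st' 14 i = oy i)) => //.
- by lia.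
- by lia.
- by move=> st' [ag _] /=; rewrite ag.
- move=> k st1 kn bnd1 [agv aga] ek inv.
  apply: (run_store_cons B100) => //; first exact: (proj2 bnd1).
  move=> bnd2; apply: (run_store B100) => //; first exact: (proj2 bnd1).
  rewrite /= ek => i ik; case: eqP => [->|ne].
    by rewrite (aga 8) // (aga 9) //= e8 e9.
  by apply: inv; lia.
- by rewrite sum_nat_const_nat; lia.
- by move=> k st1 _ _ -> _ inv i ik; apply: inv; rewrite max0n ltnS.
Qed.

Definition reversed (oy : nat -> nat) (i : nat) : nat :=
  if i < n then oy (n - i.+1) else oy i.

Lemma run_reverse_second y oy st : bounded B st -> graph_at n off nbr st ->
  arrs st 8 =1 y -> arrs st 9 =1 oy ->
  (forall i, i <= n -> arrs st 13 i = y i /\ arrs st 14 i = oy i) ->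
  run B (120 + 60 * n) reverse_second st (fun st' =>
    [/\ arrs st' 8 =1 mirror n y, arrs st' 9 =1 reversed oy,
        vars st' 32 = vars st 24 & vars st' 24 = vars st 32]).
Proof.
move=> bnd gr e8 e9 copy; have [v3 v4 _ _] := gr.
apply: (@run_cons _ _ (100 + 60 * n) _ _ _ (fun st' =>
    arrs st' 8 =1 mirror n y /\ arrs st' 9 =1 reversed oy)); last first.
- move=> st1 bnd1 [agv _] [rev8 rev9].
  apply: (run_assign_cons B100) => //; [by rewrite /=; lia|exact: (proj1 bnd1)|].
  move=> bnd2; apply: (run_assign_cons B100) => //; [by rewrite /=; lia|exact: (proj1 bnd1)|].
  move=> bnd3; apply: (run_assign B100) => //; [by rewrite /=; lia|exact: (proj1 bnd1)|].
  by split=> //=; rewrite !agv.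
- by lia.
apply: (run_for B100 (l := 0) (h := n) (f := fun _ => 30)
  (Inv := fun k st' => forall i,
     arrs st' 8 i = (if i < k then mirror n y i else y i) /\
     arrs st' 9 i = (if i < k then reversed oy i else oy i))) => //.
- by lia.
- by lia.
- by move=> st' [ag _] /=; rewrite ag.
- by move=> i /=; rewrite e8 e9.
- move=> k st1 /andP[_ kn] bnd1 [agv aga] ek inv.
  have ar b i : b \notin [:: 8; 9] -> arrs st1 b i = arrs st b i by move=> bn; apply: aga.
  have [k13 _] := copy k (ltnW kn).
  have nk : n - k.+1 <= n by lia.
  have [_ k14] := copy _ nk.
  apply: (run_store_cons B100) => //.
    by rewrite /= agv //; apply: leq_ltn_trans (leq_subr _ _) _; rewrite v4; lia.
  move=> bnd2; apply: (run_store B100) => //; first exact: (proj2 bnd1).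
  rewrite /= ek !agv // v3 v4 addn1 (ar 13) // (ar 14) // k13 k14 => i.
  case: eqP => [->|ne]; first by rewrite ltnSn /mirror /reversed kn.
  by have -> : (i < k.+1) = (i < k) by lia.
- by rewrite sum_nat_const_nat; lia.
- move=> k st1 _ _ -> _; rewrite max0n => inv; split=> i; have [h8 h9] := inv i.
    by rewrite h8 /mirror; case: (i < n).
  by rewrite h9 /reversed; case: (i < n).
Qed.

Definition answer (x y : nat -> nat) (st : state) : Prop :=
  if vars st 0 == 0 then
    forall P Q, route n E x s1 t1 P -> route n E y s2 t2 Q ->
      (forall w, w \in P -> w \in Q -> False) -> False
  else exists p q, [/\ route n E x s1 t1 p, route n E y s2 t2 q,
      forall w, w \in p -> w \in q -> False,
      forall w, w \in p -> arrs st 4 (x w - 1) = w &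
      forall w, w \in q -> arrs st 5 (y w - 1) = w] /\
    vars st 1 = x t1 /\ vars st 2 = y t2.

Lemma run_search st : bounded B st -> graph_at n off nbr st ->
  vars st 31 = s1 -> vars st 32 = s2 -> vars st 23 = t1 -> vars st 24 = t2 ->
  (forall i, arrs st 6 i = 0) -> (forall i, arrs st 8 i = 0) ->
  run B (2000 + 200 * n + 800 * (n * (n + volume n off) + 1) +
         2 * (4000 * (n.+1 * n.+1) + 1300 * (n.+1 * volume n off)))
    search st (fun st' => exists x ox y oy,
      [/\ layering n E s1 x ox, layering n E s2 y oy & answer x y st']).
Proof.
move=> bnd gr e31 e32 e23 e24 z6 z8.
have [M eM] : exists M, M = 4000 * (n.+1 * n.+1) + 1300 * (n.+1 * volume n off) by eexists.
have [N eN] : exists N, N = n * (n + volume n off) by eexists.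
rewrite -eM -eN.
apply: (run_assign_cons B100) => //; first exact: (proj1 bnd).
set sta := set_var _ _ _ => bnda.
have gra : graph_at n off nbr sta by [].
apply: (run_cons (bfs_correct (D := 6) (O := 7) Bn G isT isT isT s1n
  (fun w => conn s1n (w := w)) bnda gra e31 (fun i _ => z6 i))); rewrite -?eN; first by rewrite /=; lia.
move=> st1 bnd1 ag1 lay1; have gr1 := graph_agree ag1 isT isT isT isT gra.
have [av1 aa1] := ag1.
apply: (run_assign_cons B100) => //; [by rewrite /=; lia|exact: (proj1 bnd1)|].
set stb := set_var _ _ _ => bndb.
have grb : graph_at n off nbr stb by [].
have e5b : vars stb 5 = s2 by rewrite /= av1.
have z8b i : i < n -> arrs stb 8 i = 0 by move=> _; rewrite /= aa1 // z8.
apply: (run_cons (bfs_correct (D := 8) (O := 9) Bn G isT isT isT s2n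
  (fun w => conn s2n (w := w)) bndb grb e5b z8b)); rewrite -?eN; first by rewrite /=; lia.
move=> st2 bnd2 ag2 lay2; have gr2 := graph_agree ag2 isT isT isT isT grb.
have [av2 aa2] := ag2.
set x := arrs st1 6 in lay1; set ox := arrs st1 7 in lay1.
set y := arrs st2 8 in lay2; set oy := arrs st2 9 in lay2.
have [cx cy] := (layering_coordinate G lay1, layering_coordinate G lay2).
have [xo yo] := (layering_ordering lay1, layering_ordering lay2).
apply: (run_cons (run_save_second bnd2 gr2 (frefl _) (frefl _))); first by rewrite /=; lia.
move=> st3 bnd3 ag3 sav3; have gr3 := graph_agree ag3 isT isT isT isT gr2.
have [av3 aa3] := ag3.
apply: (run_assign_cons B100) => //; [by rewrite /=; lia|exact: (proj2 bnd3)|].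
move=> bndc; apply: (run_assign_cons B100) => //; [by rewrite /=; lia|exact: (proj2 bndc)|].
set st4 := set_var _ 2 _ => bnd4.
have v3 z : z \notin [:: 12; 5; 6; 7; 8; 9; 10; 1; 2] -> vars st4 z = vars st z.
  rewrite !inE => zn; rewrite /= !ifN; [|lia|lia].
  rewrite av3 ?inE; last by lia.
  rewrite av2 /= ?inE; last by lia.
  rewrite ifN; last by lia.
  rewrite av1 /= ?inE; last by lia.
  by rewrite ifN //; lia.
have [f31 f32 f23 f24] : [/\ vars st4 31 = s1, vars st4 32 = s2, vars st4 23 = t1 & vars st4 24 = t2].
  by split; rewrite v3.
have a6 : arrs st4 6 =1 x by move=> i; rewrite /= aa3 // aa2.
have a7 : arrs st4 7 =1 ox by move=> i; rewrite /= aa3 // aa2.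
have a8 : arrs st4 8 =1 y by move=> i; rewrite /= aa3.
have a9 : arrs st4 9 =1 oy by move=> i; rewrite /= aa3.
have a13 i : i <= n -> arrs st4 13 i = y i /\ arrs st4 14 i = oy i by apply: sav3.
have e1 : vars st4 1 = x t1.
  by rewrite /= av3 // av2 //= av1 //= e23 aa3 // aa2.
have e2 : vars st4 2 = y t2.
  by rewrite /= av3 // av2 //= av1 //= e24 aa3.
have gr4 : graph_at n off nbr st4 by [].
clearbody st4.
have en4 : env_ordered n off nbr x y ox oy t1 t2 st4 by split.
pose iy := arrs st4 13.
have iyE i : i <= n -> iy i = y i by case/a13.
have ypos v : v <= n -> 0 < y v.
  rewrite leq_eqVlt => /orP[/eqP->|vn]; first by rewrite (coord_bot cy); lia.
  by case/andP: (coord_pos cy vn).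
have ipos v : v <= n -> 0 < iy v by move=> vn; rewrite iyE // ypos.
have iinj v w : v <= n -> w <= n -> iy v = iy w -> y v = y w.
  by move=> vn wn; rewrite !iyE.
apply: (run_cons (run_attempt_routes cx cy xo yo s2n t2n ipos iinj bnd4 en4 (frefl _) f31 f32));
  rewrite -?eM; first by rewrite /=; lia.
move=> st5 bnd5 ag5 res5; have gr5 := graph_agree ag5 isT isT isT isT gr4.
have [av5 aa5] := ag5.
apply: run_test => //; [by rewrite /=; lia| |] => /= v0.
  apply: run_skip => //; first by lia.
  exists x, ox, y, oy; split=> //; move: res5; rewrite /answer (negPf v0).
  move=> [p [q [rp rq dis r4 r5]]]; exists p, q; split; last by rewrite !av5.
  split=> // w wq; have wn := allP (route_lt G rq) w wq.
  by rewrite -iyE ?r5 // ltnW.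
move: res5; rewrite v0 eqxx => lose.
have a58 : arrs st5 8 =1 y by move=> i; rewrite aa5.
have a59 : arrs st5 9 =1 oy by move=> i; rewrite aa5.
have copy5 i : i <= n -> arrs st5 13 i = y i /\ arrs st5 14 i = oy i.
  by move=> /a13[h1 h2]; rewrite !aa5.
apply: (run_cons (run_reverse_second bnd5 gr5 a58 a59 copy5)); first by rewrite /=; lia.
move=> st6 bnd6 ag6 [rev8 rev9 w32 w24]; have gr6 := graph_agree ag6 isT isT isT isT gr5.
have [av6 aa6] := ag6.
have cy' := mirror_coordinate G cy; have yo' := mirror_ordering lay2.
have en6 : env_ordered n off nbr x (mirror n y) ox (reversed oy) t1 s2 st6.
  split=> //; last by move=> i; rewrite aa6 // aa5.
  split=> //; [by rewrite av6 // av5|by rewrite w24 av5|].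
  by move=> i; rewrite aa6 // aa5.
have [g31 g32] : vars st6 31 = s1 /\ vars st6 32 = t2.
  by rewrite w32 av6 // !av5.
have a613 : arrs st6 13 =1 iy by move=> i; rewrite aa6 // aa5.
have iinj' v w : v <= n -> w <= n -> iy v = iy w -> mirror n y v = mirror n y w.
  move=> vn wn; rewrite !iyE // /mirror => eyw.
  have bot u : u <= n -> (u < n) = (y u <= n).
    rewrite leq_eqVlt => /orP[/eqP->|un]; first by rewrite ltnn (coord_bot cy); lia.
    by rewrite un (coord_le cy un).
  by rewrite (bot v vn) (bot w wn) eyw.
apply: run_weaken (run_attempt_routes cx cy' xo yo' t2n s2n ipos iinj' bnd6 en6 a613 g31 g32) _ _.
  by rewrite -eM; lia.
move=> st7 bnd7 [av7 aa7] res7; exists x, ox, y, oy; split=> //; move: res7.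
rewrite /answer; case: ifP => [_ lose' P Q rP rQ dis|_ [p [q [rp rq dis r4 r5]]]].
  exact: (no_routes G cx cy (lay_src lay1) (lay_src lay2) s1n s2n t1n t2n lose lose' rP rQ dis).
exists p, (rev q); split; last by rewrite !av7 // !av6 // !av5.
split=> //.
- by apply: (mirror_route_rev G (fun u => coord_le cy (u := u))).
- by move=> w wp; rewrite mem_rev; apply: dis.
- move=> w; rewrite mem_rev => wq; have wn := allP (route_lt G rq) w wq.
  by rewrite -iyE ?r5 // ltnW.
Qed.

End Search.

(** * Correctness within the time bound *)

(** An offset is at most n^2, a vertex less than n. *)
Lemma input_bounded n (e : rel 'I_n) (L : 'I_n -> seq 'I_n) (s t : 'I_2 -> 'I_n) :
  adjacency_lists e L -> bounded ((n + 2) ^ 5) (dsp_input L s t).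
Proof.
move=> L_adj; have nB : n * n + n < (n + 2) ^ 5.
  by rewrite !expnS expn0; nia.
have nthB (l : seq nat) i : all (fun v => v <= n * n + n) l -> nth 0 l i < (n + 2) ^ 5.
  move=> al; have [il|il] := ltnP i (size l); last by rewrite nth_default //; lia.
  by apply: leq_ltn_trans nB; apply: (allP al); apply: mem_nth.
split=> [x|a i] /=; first by case: (x == 0); lia.
have ordl (l : seq 'I_n) : all (fun v => v <= n * n + n) [seq val v | v <- l].
  apply/allP => v /mapP[w _ ->]; have := ltn_ord w; have := leq_addl (n * n) n.
  by move=> h1 h2; apply: leq_trans (ltnW h2) h1.
have ordf (f : 'I_2 -> 'I_n) l : all (fun v => v <= n * n + n) [seq val (f j) | j <- l].
  by have := ordl (map f l); rewrite -map_comp.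
apply: nthB; case: a => [|[|[|[|a]]]]; [|exact: ordl|exact: ordf|exact: ordf|by case: a].
apply/allP => v /mapP[u _ ->]; apply: leq_trans (_ : \sum_(w < n) n <= _).
  rewrite big_mkcond /=; apply: leq_sum => w _; case: ifP => // _.
  have [uq _] := L_adj w; rewrite -(card_uniqP uq).
  by apply: leq_trans (max_card _) _; rewrite card_ord.
by rewrite sum_nat_const card_ord leq_addr.
Qed.

Lemma run_dsp_program n (e : rel 'I_n) (L : 'I_n -> seq 'I_n) (s t : 'I_2 -> 'I_n) :
  symmetric e -> connected_graph e -> adjacency_lists e L ->
  run ((n + 2) ^ 5)
    (2100 + 200 * n + 800 * (n * (n + volume n (nth 0 (offsets L))) + 1) +
     2 * (4000 * (n.+1 * n.+1) + 1300 * (n.+1 * volume n (nth 0 (offsets L)))))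
    dsp_program (dsp_input L s t) (fun st' => exists x ox y oy,
      [/\ layering n (edge_nat e) (s ord0) x ox, layering n (edge_nat e) (s ord_max) y oy &
          answer n (edge_nat e) (s ord0) (s ord_max) (t ord0) (t ord_max) x y st']).
Proof.
move=> e_sym e_conn L_adj.
have n0 : 0 < n by case: (s ord0) => i; apply: leq_ltn_trans.
have Bn : 9 * (n.+1 * n.+1) + 100 <= (n + 2) ^ 5.
  have h : 27 * ((n + 2) * (n + 2)) <= (n + 2) ^ 5.
    by rewrite (expnD _ 3 2) leq_mul // (_ : 27 = 3 ^ 3) // leq_exp2r //; lia.
  by apply: leq_trans h; nia.
have bnd := input_bounded s t L_adj.
have B100 : 100 <= (n + 2) ^ 5 by apply: leq_trans Bn; apply: leq_addl.
have G := input_csr e_sym L_adj.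
have conn (a w : nat) : a < n -> w < n -> exists2 p, path (edge_nat e) a p & last a p = w.
  by move=> an; apply: (input_connected e_conn (Ordinal an)).
have enum2 (f : 'I_2 -> 'I_n) : [seq val (f i) | i <- enum 'I_2] = [:: val (f ord0); val (f ord_max)].
  rewrite !enum_ordSl /= (_ : enum 'I_0 = [::]) /=; last by apply: size0nil; rewrite size_enum_ord.
  by congr [:: _; val (f _)]; apply: val_inj.
have [s0 s1] := (ltn_ord (s ord0), ltn_ord (s ord_max)).
have [t0 t1] := (ltn_ord (t ord0), ltn_ord (t ord_max)).
set V := volume _ _.
have [K eK] : exists K, K = 2000 + 200 * n + 800 * (n * (n + V) + 1) +
    2 * (4000 * (n.+1 * n.+1) + 1300 * (n.+1 * V)) by eexists.
apply: (@run_weaken _ (100 + K) _ _ _ (fun st' => exists x ox y oy,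
      [/\ layering n (edge_nat e) (s ord0) x ox, layering n (edge_nat e) (s ord_max) y oy &
          answer n (edge_nat e) (s ord0) (s ord_max) (t ord0) (t ord_max) x y st'])) => //;
  last by lia.
apply: (run_assign_cons B100) => //; first exact: (proj1 bnd).
move=> bnd1; apply: (run_assign_cons B100) => //; first by rewrite /=; lia.
move=> bnd2; apply: (run_assign_cons B100) => //; first exact: (proj2 bnd2).
move=> bnd3; apply: (run_assign_cons B100) => //; first exact: (proj2 bnd3).
move=> bnd4; apply: (run_assign_cons B100) => //; first exact: (proj2 bnd4).
move=> bnd5; apply: (run_assign_cons B100) => //; first exact: (proj2 bnd5).
set st1 := set_var _ 24 _ => bnd6.
have gr1 : graph_at n (nth 0 (offsets L)) (nth 0 (neighbours L)) st1.
  by split=> //=; rewrite addn1.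
have [e31 e32] : vars st1 31 = s ord0 /\ vars st1 32 = s ord_max by rewrite /= enum2.
have [e23 e24] : vars st1 23 = t ord0 /\ vars st1 24 = t ord_max by rewrite /= enum2.
have z6 i : arrs st1 6 i = 0 by rewrite /= nth_nil.
have z8 i : arrs st1 8 i = 0 by rewrite /= nth_nil.
apply: run_weaken (run_search Bn G s0 s1 t0 t1 conn bnd6 gr1 e31 e32 e23 e24 z6 z8) _ _ => //.
by rewrite -/V -eK /=; lia.
Qed.

Lemma answer_correct n (e : rel 'I_n) (L : 'I_n -> seq 'I_n) (s t : 'I_2 -> 'I_n) x ox y oy st :
  symmetric e -> adjacency_lists e L ->
  layering n (edge_nat e) (s ord0) x ox -> layering n (edge_nat e) (s ord_max) y oy ->
  answer n (edge_nat e) (s ord0) (s ord_max) (t ord0) (t ord_max) x y st ->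
  dsp_output_correct e s t st.
Proof.
move=> e_sym L_adj layx layy.
have two (i : 'I_2) : i = ord0 \/ i = ord_max.
  by case: i => [[|[|]]] // i2; [left|right]; apply: val_inj.
rewrite /answer /dsp_output_correct; case: ifP => _.
  move=> none [P [short dis]].
  apply: (none _ _ (shortest_route e_sym L_adj layx (short ord0))
                   (shortest_route e_sym L_adj layy (short ord_max))).
  move=> w /mapP[a aP ->] /mapP[b bP /val_inj ab]; subst b.
  by have /disjointFr/(_ aP) := dis ord0 ord_max isT; rewrite bP.
move=> [p [q [[rp rq dis rec4 rec5] [len1 len2]]]].
have [P [eP shortP]] := route_shortest e_sym L_adj layx rp.
have [Q [eQ shortQ]] := route_shortest e_sym L_adj layy rq.
exists (fun i : 'I_2 => if i == ord0 then P else Q); split; first split.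
- by move=> i; case: (two i) => ->.
- have disPQ : [disjoint P & Q].
    apply/pred0P => a /=; apply/negP => /andP[aP aQ].
    by apply: (dis (val a)); rewrite -?eP -?eQ map_f.
  by move=> i j; case: (two i) => ->; case: (two j) => -> //= _; rewrite disjoint_sym.
have out (d z r : nat -> nat) a b l : route n (edge_nat e) d a b l -> d a = 1 ->
    (forall w, w \in l -> r (d w - 1) = w) -> l = mkseq r (d b).
  move=> rl da rec; rewrite (route_last_size rl da).
  apply: (@eq_from_nth _ n) => [|i il]; first by rewrite size_mkseq.
  rewrite nth_mkseq // -[LHS]rec ?mem_nth //.
  by rewrite (route_nth rl da il) subn1.
move=> i; case: (two i) => ->; rewrite /=.
  by rewrite len1 eP; apply: out rp (lay_src layx) rec4.
by rewrite len2 eQ; apply: out rq (lay_src layy) rec5.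
Qed.

Theorem theorem1 :
  exists (prog : cmd) (C D : nat),
  forall (n : nat) (e : rel 'I_n) (L : 'I_n -> seq 'I_n) (s t : 'I_2 -> 'I_n),
    symmetric e -> irreflexive e -> connected_graph e -> adjacency_lists e L ->
    exists (T : nat) (st : state),
      [/\ exec ((n + 2) ^ D) prog (dsp_input L s t) T st,
          T <= C * (n * num_edges e + 1)
        & dsp_output_correct e s t st].
Proof.
(* words are bounded by B ^ 12 with B = (n + 2) ^ 5 *)
exists dsp_program, (62 * 1000), (5 * 12).
move=> n e L s t e_sym e_irr e_conn L_adj.
have [T [st [ex TK _ [x [ox [y [oy [layx layy ans]]]]]]]] :=
  run_dsp_program s t e_sym e_conn L_adj.
exists T, st; split.
- by rewrite expnM.
- apply: leq_trans TK _.
  have n0 : 0 < n by case: (s ord0) => i; apply: leq_ltn_trans.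
  have := vertices_le_volume e_conn L_adj.
  rewrite (input_volume e_sym e_irr L_adj).
  set m := num_edges e => nn.
  (* everything is bounded linearly in n * m and n * n *)
  have nm : m <= n * m by rewrite leq_pmull.
  have n1 : n <= n * n by rewrite leq_pmull.
  have -> : n.+1 * n.+1 = n * n + 2 * n + 1 by lia.
  have -> : n.+1 * (2 * m) = 2 * (n * m) + 2 * m by lia.
  have -> : n * (n + 2 * m) = n * n + 2 * (n * m) by lia.
  have e2 : n * (2 * m) = 2 * (n * m) by lia.
  rewrite e2 in nn; move: nm n1 nn; set p := n * m; set r := n * n => nm n1 nn.
  clearbody p r; lia.
- exact: answer_correct e_sym L_adj layx layy ans.
Qed.
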